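(* There exists a universal constant $C>1$ such that for every $n\ge2$ and every compact connected set $\Omega\subset\mathbb{R}^n$ with smooth boundary and non-empty interior, $$P^N_\Omega\le C\,P^H_\Omega,\qquad P^H_\Omega:=\sup_{h\in H}\frac{\mathrm{Var}_{\lambda_\Omega}h}{\int|\nabla h|^2\,d\lambda_\Omega},$$ where $H$ denotes the class of (non-constant) harmonic functions $h$ on $\Omega$. In fact, for large enough $n$ (larger than a universal constant), one can use $C=2$.
   Context: Universal means independent of $n$, $\Omega$ and any other parameter. $\lambda_\Omega$ is the uniform (normalized Lebesgue) probability measure on $\Omega$; $\mathrm{Var}_{\lambda_\Omega}f:=\int f^2\,d\lambda_\Omega-(\int f\,d\lambda_\Omega)^2$. $P^N_\Omega$ is the best constant such that $\mathrm{Var}_{\lambda_\Omega}f\le P^N_\Omega\int_\Omega|\nabla f|^2\,d\lambda_\Omega$ for all smooth $f:\Omega\to\mathbb{R}$ (no boundary conditions). Harmonic functions on $\Omega$ are functions smooth on $\Omega$ (up to the boundary) satisfying $\Delta h=0$ in the interior. *)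

(* Defs.v *)
From HB Require Import structures.
From mathcomp Require Import all_boot all_order all_algebra.
From mathcomp Require Import all_classical all_reals all_analysis measurable_realfun.

Set Implicit Arguments.
Unset Strict Implicit.
Unset Printing Implicit Defensive.
Import Order.TTheory GRing.Theory Num.Theory.
Import numFieldNormedType.Exports.
Local Open Scope classical_set_scope.
Local Open Scope ring_scope.

(* R^n is ['rV[R]_n] with its Borel sigma-algebra.  The library norm on
   ['rV[R]_n] is the sup norm: it induces the usual topology, but Euclidean
   lengths have to be written out as sums of squares. *)
Section rV_measurable.
Variables (R : realType) (n : nat).
Let borel : set (set 'rV[R]_n) := <<s @open 'rV[R]_n >>.

Let borel0 : borel set0.
Proof. exact: sigma_algebra0. Qed.

Let borelC A : borel A -> borel (~` A).
Proof. exact: sigma_algebraC. Qed.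

Let borel_bigcup (F : (set 'rV[R]_n)^nat) :
  (forall i, borel (F i)) -> borel (\bigcup_i F i).
Proof. exact: sigma_algebra_bigcup. Qed.

HB.instance Definition _ := @isMeasurable.Build (sigma_display (@open 'rV[R]_n))
  'rV[R]_n borel borel0 borelC borel_bigcup.

End rV_measurable.

Section borel_rV.
Context {R : realType}.

Lemma open_measurable_rV n (A : set 'rV[R]_n) : open A -> measurable A.
Proof. by move=> oA; exact: sub_sigma_algebra. Qed.

Lemma compact_measurable_rV n (A : set 'rV[R]_n) : compact A -> measurable A.
Proof.
move=> cA; rewrite -(setCK A); apply: measurableC; apply: open_measurable_rV.
by apply/closed_openC; apply: compact_closed => //; exact: norm_hausdorff.
Qed.

Lemma measurable_coord_rV n (j : 'I_n) :
  measurable_fun setT (fun v : 'rV[R]_n => v ord0 j).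
Proof.
apply: (@measurability _ _ _ _ _ _ _ (RGenOpens.measurableE R)).
move=> _ [_ [a [b ->]] <-]; rewrite setTI; apply: open_measurable_rV.
apply: open_comp => [v _|]; [exact: coord_continuous|exact: interval_open].
Qed.

Lemma measurable_fun_rV d (T : measurableType d) n (f : T -> 'rV[R]_n) :
  (forall j, measurable_fun setT (fun x => f x ord0 j)) -> measurable_fun setT f.
Proof.
move=> mf; apply: (@measurability _ _ _ _ _ _ (@open 'rV[R]_n)) => //.
move=> _ [A oA <-]; rewrite setTI.
pose c (q : {ffun 'I_n -> rat}) : 'rV[R]_n := \row_j ratr (q j).
pose B (qr : {ffun 'I_n -> rat} * rat) : set 'rV[R]_n :=
  ball (c qr.1) (ratr qr.2 : R).
have -> : f @^-1` A =
    \bigcup_qr (if `[< B qr `<=` A >] then f @^-1` B qr else set0).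
  rewrite -bigcup_mkcondr.
  apply/seteqP; split => [x Afx|x [qr]]; last first.
    by rewrite setTI /= => BA Bx; exact: BA.
  have /nbhs_ballP[e /= e0 eA] := open_nbhs_nbhs (conj oA Afx).
  have [r /itvP re] : exists r : rat, ratr r \in `]0, (e / 2) : R[.
    by have [r] := rat_in_itvoo (divr_gt0 e0 (ltr0n R 2)); exists r.
  have r0 : 0 < ratr r :> R by rewrite re.
  have hq j : exists q : rat, `|f x ord0 j - ratr q| < (ratr r : R).
    have [|q /itvP qr] :=
      @rat_in_itvoo R (f x ord0 j - ratr r) (f x ord0 j + ratr r).
      by rewrite ltrD2l gtrN.
    by exists q; rewrite ltr_distlC !qr.
  have [q qx] := choice hq.
  have cx : ball (c [ffun j => q j]) (ratr r) (f x).
    by split=> // i j; rewrite ord1 !mxE ffunE /ball/= distrC.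
  exists ([ffun j => q j], r) => //; split => //.
  move=> y By; apply: eA.
  apply: (@le_ball _ _ _ (ratr r + ratr r)).
    by rewrite [leRHS]splitr; apply: lerD; rewrite ltW// re.
  by apply: ball_triangle By; exact: ball_sym.
apply: countable_bigcupT_measurable => // -[q r].
case: ifP => // _; rewrite /B /=.
have [r0|r0] := ltP 0 (ratr r : R); last first.
  by rewrite (_ : _ @^-1` _ = set0)//; apply/seteqP; split=> x //= -[];
    rewrite ltNge r0.
rewrite (_ : _ @^-1` _ = \bigcap_(j in [set: 'I_n])
    (fun x => f x ord0 j) @^-1` ball (ratr (q j) : R) (ratr r : R)).
  apply: fin_bigcap_measurable => // j _.
  rewrite -[X in measurable X]setTI; apply: mf => //.
  by rewrite ball_itv.
apply/seteqP; split=> x /=.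
  by move=> [_ h] j _; have := h ord0 j; rewrite mxE.
by move=> h; split=> // i j; rewrite ord1 mxE; exact: h.
Qed.

End borel_rV.

Section lebesgue_rV_step.
Context {R : realType} (n : nat).
Variable mu : {sigma_finite_measure set 'rV[R]_n -> \bar R}.

Definition cons_rV (p : R * 'rV[R]_n) : 'rV[R]_n.+1 := row_mx (p.1)%:M p.2.

Definition uncons_rV (v : 'rV[R]_n.+1) : R * 'rV[R]_n :=
  (v ord0 ord0, @rsubmx _ 1 1 n v).

Lemma measurable_cons_rV : measurable_fun setT cons_rV.
Proof.
apply: measurable_fun_rV => j.
rewrite -[j](@fintype.splitK 1 n); case: (@fintype.split 1 n j) => k /=.
  under eq_fun do rewrite (@row_mxEl _ 1 1 n) mxE (ord1 k) mulr1n.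
  exact: measurable_fst.
under eq_fun do rewrite (@row_mxEr _ 1 1 n).
exact: (measurableT_comp (measurable_coord_rV k) measurable_snd).
Qed.

Lemma measurable_uncons_rV : measurable_fun setT uncons_rV.
Proof.
apply/measurable_fun_pairP; split; first exact: measurable_coord_rV.
apply: measurable_fun_rV => j; rewrite /comp/=.
by under eq_fun do rewrite mxE; exact: measurable_coord_rV.
Qed.

Lemma cons_rVK : cancel cons_rV uncons_rV.
Proof.
move=> [x v]; congr pair; last by rewrite /= row_mxKr.
rewrite /= (_ : ord0 = @lshift 1 n ord0); last exact/val_inj.
by rewrite (@row_mxEl _ 1 1 n) mxE eqxx mulr1n.
Qed.

Definition lebesgue_rV_step : set 'rV[R]_n.+1 -> \bar R :=
  pushforward (@lebesgue_measure R \x mu)%E cons_rV.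

Let step0 : lebesgue_rV_step set0 = 0%E.
Proof. by rewrite /lebesgue_rV_step /pushforward preimage_set0 measure0. Qed.

Let step_ge0 A : (0 <= lebesgue_rV_step A)%E.
Proof. by rewrite /lebesgue_rV_step /pushforward; exact: measure_ge0. Qed.

Let step_sigma_additive : semi_sigma_additive lebesgue_rV_step.
Proof.
move=> F mF tF mUF; rewrite /lebesgue_rV_step /pushforward preimage_bigcup.
have mcons A : measurable A -> measurable (cons_rV @^-1` A).
  by move=> mA; rewrite -[X in measurable X]setTI; exact: measurable_cons_rV.
apply: measure_semi_sigma_additive.
- by move=> k; exact: mcons.
- apply/trivIsetP => i j _ _ ij; rewrite -preimage_setI.
  by move/trivIsetP : tF => /(_ _ _ _ _ ij) ->//; rewrite preimage_set0.
- by rewrite -preimage_bigcup; exact: mcons.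
Qed.

HB.instance Definition _ := isMeasure.Build _ _ _ lebesgue_rV_step
  step0 step_ge0 step_sigma_additive.

Let step_sigma_finite : sigma_finite setT lebesgue_rV_step.
Proof.
have /sigma_finiteP[F [FT ndF Foo]] := sigma_finiteT (@lebesgue_measure R).
have /sigma_finiteP[G [GT ndG Goo]] := sigma_finiteT mu.
exists (fun i => uncons_rV @^-1` (F i `*` G i)).
  apply/esym/seteqP; split => // v _.
  have [i _ Fi] : (\bigcup_i F i) (uncons_rV v).1 by rewrite -FT.
  have [j _ Gj] : (\bigcup_j G j) (uncons_rV v).2 by rewrite -GT.
  exists (maxn i j) => //; split.
    exact: (subsetPset _ _ (ndF _ _ (leq_maxl i j))).
  exact: (subsetPset _ _ (ndG _ _ (leq_maxr i j))).
move=> i; have [mF Fi] := Foo i; have [mG Gi] := Goo i; split.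
  rewrite -[X in measurable X]setTI; apply: measurable_uncons_rV => //.
  exact: measurableX.
rewrite /lebesgue_rV_step /pushforward -comp_preimage.
rewrite (_ : _ \o _ = id); last by apply/funext => p; rewrite /= cons_rVK.
by rewrite /= product_measure1E// lte_mul_pinfty// ge0_fin_numE.
Qed.

HB.instance Definition _ := Measure_isSigmaFinite.Build _ _ _ lebesgue_rV_step
  step_sigma_finite.

End lebesgue_rV_step.

Fixpoint lebesgue_rV {R : realType} (n : nat) :
    {sigma_finite_measure set 'rV[R]_n -> \bar R} :=
  match n with
  | 0 => \d_ (0 : 'rV[R]_0)
  | n'.+1 => lebesgue_rV_step (lebesgue_rV n')
  end.

Lemma lebesgue_rV_box {R : realType} (n : nat) (A : 'I_n -> set R) :
  (forall j, measurable (A j)) ->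
  lebesgue_rV n [set v | forall j, A j (v ord0 j)] =
  (\prod_(j < n) lebesgue_measure (A j))%E.
Proof.
elim: n A => [|n IH] A mA.
  by rewrite big_ord0 /= diracE mem_set// => -[].
pose B := [set v : 'rV[R]_n | forall j, A (lift ord0 j) (v ord0 j)].
have mB : measurable B.
  rewrite (_ : B = \bigcap_(j in [set: 'I_n])
      (fun v => v ord0 j) @^-1` A (lift ord0 j)); last first.
    by apply/seteqP; split=> [v Bv j _|v Bv j]; exact: Bv.
  apply: fin_bigcap_measurable => // j _.
  by rewrite -[X in measurable X]setTI; exact: measurable_coord_rV.
rewrite big_ord_recl -(IH (fun j => A (lift ord0 j)))// -/B.
transitivity ((@lebesgue_measure R \x lebesgue_rV n)%E (A ord0 `*` B)); last first.
  by rewrite product_measure1E; [|exact: mA|].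
rewrite /= /lebesgue_rV_step /pushforward; congr ((_ \x _)%E _).
have c0 (p : R * 'rV[R]_n) : cons_rV p ord0 ord0 = p.1 :> R.
  by have /(congr1 fst) := @cons_rVK R n p.
have cS (p : R * 'rV[R]_n) j : cons_rV p ord0 (lift ord0 j) = p.2 ord0 j :> R.
  have /(congr1 (fun q : R * 'rV[R]_n => q.2 ord0 j)) := @cons_rVK R n p.
  by rewrite /= mxE => <-; congr (cons_rV _ _ _); exact/val_inj.
apply/seteqP; split=> [p Ap|p [A0 AS] j] /=.
  split=> [|j]; first by have := Ap ord0; rewrite c0.
  by have := Ap (lift ord0 j); rewrite cS.
by case: (unliftP ord0 j) => [k ->|->]; rewrite ?cS ?c0//; exact: AS.
Qed.

Section calculus.
Context {R : realType} {n : nat}.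
Implicit Types (f h rho : 'rV[R]_n -> R) (U Omega : set 'rV[R]_n).

Definition partial (i : 'I_n) f : 'rV[R]_n -> R :=
  fun x => 'D_(delta_mx ord0 i) (f : 'rV[R]_n -> R^o) x.

Definition grad f (x : 'rV[R]_n) : 'rV[R]_n := \row_i partial i f x.

Definition sqnorm2 (v : 'rV[R]_n) : R := \sum_i v ord0 i ^+ 2.

Definition laplacian f (x : 'rV[R]_n) : R := \sum_i partial i (partial i f) x.

Definition iter_partial (s : seq 'I_n) f : 'rV[R]_n -> R := foldr partial f s.

(* C^oo on an open set: iterated partial derivatives of all orders exist and
   are continuous. *)
Definition smooth_in U f : Prop :=
  forall (s : seq 'I_n) (x : 'rV[R]_n), U x ->
    {for x, continuous (iter_partial s f)} /\
    forall i, derivable (iter_partial s f : 'rV[R]_n -> R^o) x (delta_mx ord0 i).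

(* A function on a closed set is smooth (up to the boundary) when it extends
   to a C^oo function on an open neighbourhood of that set.  Functions are
   total here, so [f] stands for such an extension; only its values on
   [Omega] enter the integrals below. *)
Definition smooth_on Omega f : Prop :=
  exists U, [/\ open U, Omega `<=` U & smooth_in U f].

Definition frontier Omega : set 'rV[R]_n := closure Omega `\` Omega°.

(* The frontier is an embedded C^oo hypersurface, given locally as a regular
   level set.  For a compact connected set with non-empty interior this forces
   the set to lie locally on exactly one side of its frontier. *)
Definition smooth_boundary Omega : Prop :=
  forall p, frontier Omega p -> exists U rho,
    [/\ open U, U p, smooth_in U rho, grad rho p != 0 &
        frontier Omega `&` U = [set x | U x /\ rho x = 0]].

Definition harmonic_on Omega h : Prop :=
  smooth_on Omega h /\ forall x, Omega° x -> laplacian h x = 0.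

Definition nonconstant_on Omega h : Prop :=
  ~ exists c, forall x, Omega x -> h x = c.

End calculus.

Section poincare.
Context {R : realType} {n : nat} {Omega : set 'rV[R]_n}.
Variable mOmega : measurable Omega.
Local Open Scope ereal_scope.

(* The Dirac mass is the value [mnormalize] requires when the volume of
   [Omega] is 0 or infinite, which does not occur for a compact set with
   non-empty interior. *)
Definition unif : probability 'rV[R]_n R :=
  mnormalize (mrestr (lebesgue_rV n) mOmega) \d_(0%R : 'rV[R]_n).

Definition var_unif (f : 'rV[R]_n -> R) : R :=
  (\int[unif]_(x in Omega) (f x ^+ 2) - (\int[unif]_(x in Omega) f x) ^+ 2)%R.

Definition energy_unif (f : 'rV[R]_n -> R) : R :=
  (\int[unif]_(x in Omega) sqnorm2 (grad f x))%R.

Definition neumann_poincare : \bar R :=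
  ereal_inf [set P%:E | P in [set P : R |
    forall f, smooth_on Omega f -> (var_unif f <= P * energy_unif f)%R]].

Definition harmonic_poincare : \bar R :=
  ereal_sup [set (var_unif h / energy_unif h)%:E | h in [set h |
    harmonic_on Omega h /\ nonconstant_on Omega h]].

End poincare.

(* Main.v *)
From HB Require Import structures.
Require Import Defs.
From mathcomp Require Import all_boot all_order all_algebra.
From mathcomp Require Import all_classical all_reals all_analysis.
From mathcomp Require Import measurable_realfun.
From mathcomp Require Import ring lra.
Import Order.TTheory GRing.Theory Num.Theory.
Import numFieldNormedType.Exports.
Set Implicit Arguments.
Unset Strict Implicit.
Unset Printing Implicit Defensive.
Local Open Scope classical_set_scope.
Local Open Scope ring_scope.

(** The Neumann problem is reduced to harmonic functions and to a Dirichlet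
    problem.  Write [D] for the gradient and all norms for L2 norms on [Omega].

    - Splitting.  For small [kap > 0] consider the scalar product
    [B(f, g) = kap * <f, g> + <D f, D g>] ([bil]) and split a smooth [f] as
    [h + w], with [h] harmonic and [w] orthogonal to all harmonic functions
    for [B].  The harmonic part satisfies the Poincare inequality with the
    constant [p] of harmonic functions.  The claim is that [w] satisfies
    [|w| <= sqrt P * |D w|] with a Dirichlet constant [P] ([core_estimate]).
    As [D h] and [D w] are orthogonal up to terms of order [kap], this gives
    [Var f <= (sqrt p * |D h| + sqrt P * |D w|)^2 <= (p + P) * |D f|^2] when
    [kap] tends to 0 ([split_limit], [var0_le_sum]).

    - Orthogonality replaces a boundary condition.  Let [G] be the Newton
    kernel and [V = kap * (G * w) - sum_i (d_i G) * (d_i w)], where [w] and its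
    gradient are extended by 0 outside [Omega] ([pot]).  For [x] outside
    [Omega], [V x] is the product [B(w, G(x - .))] with a harmonic function,
    hence 0 ([pot_tail]).  So [V] vanishes outside [Omega] and satisfies a
    Dirichlet Poincare inequality [|V| <= sqrt P * |D V|]; and it solves
    [- Delta V = kap * w - div (D w)] weakly on the whole space ([pot_green]).
    Testing this equation with [V], then with [w] itself, gives
      [|D V|^2 <= kap * |w| * |V| + |D w| * |D V|]  ([cutpot_energy]),
      [kap * |w|^2 + |D w|^2 <= |D V| * |D w|]      ([cutpot_lower]).
    The first yields [|D V| <= kap * sqrt P * |w| + |D w|], and inserting this
    in the second one leaves [kap * |w|^2 <= kap * sqrt P * |w| * |D w|].

    - Approximations.  No projection onto harmonic functions is constructed:
    a minimizing sequence provides [w] orthogonal up to a factor [eta]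
    ([almost_orthogonal]).  The kernel is smoothed at scale [tau], hence
    harmonic at distance [tau] only; [V] is then of order [eta], not 0, outside
    the [tau]-neighbourhood of [Omega], and it is cut off inside the
    [4 * tau]-neighbourhood.  The test function [w]
    has to be defined near [Omega] with bounds that do not depend on [eta];
    therefore the equation is tested with a first remainder [w0], chosen
    before [tau], and the final [w], chosen for an [eta] much smaller than
    [tau], is close to it ([almost_orthogonal_close]).

    - Constants.  Coordinates are harmonic functions of energy 1, so their
    variances are at most [p].  Among densities with such variances the
    Gaussian one has the largest entropy, whence
    [|Omega| <= (2 * pi * e * p)^(n / 2)] ([gaussian_volume_le]).  Conversely a
    set of volume smaller than that of the cube of side [2 * a] satisfies a
    Dirichlet inequality: a function [V] supported in it has correlations
    [int V * V(. + z)] whose mean over the cube is at most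
    [|A| / (2 * a)^n * |V|^2], whereas each of them is at least
    [|V|^2 - |z . D V|^2 / 2] ([dirichlet_cube]).  This allows
    [P = (a^2 / 6) / (1 - |A| / (2 * a)^n)].  With [a^2 = be * p] the volume
    ratio is at most [(pi * e / (2 * be))^(n / 2)].  Since [pi * e < 12] some
    [be < 6] makes the ratio tend to 0, and [P <= p] for large [n]; in every
    dimension [n >= 2], [be = 12] gives [P <= 4 * p]. *)

(** * Lebesgue measure on row vectors *)

Section lebesgue_basics.
Context {R : realType}.

Lemma lebesgue_measure_shift (c : R) (A : set R) : measurable A ->
  lebesgue_measure ((fun x => x + c) @^-1` A) = lebesgue_measure A.
Proof.
move=> mA.
have mshift : measurable_fun [set: measurableTypeR R] (fun x : R => x + c).
  by apply: measurable_funD.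
pose f_mixin := @isMeasurableFun.Build _ _ (measurableTypeR R) (measurableTypeR R) _ mshift.
pose f : {mfun measurableTypeR R >-> measurableTypeR R} := HB.pack (fun x : R => x + c) f_mixin.
have := @lebesgue_measure_unique R (pushforward lebesgue_measure f).
move=> /(_ mshift) /(_ _ A mA) -> // X [[a b]] /= ab <-.
rewrite /pushforward /=.
rewrite (_ : _ @^-1` _ = [set` `]a - c, b - c]]); last first.
  by apply/seteqP; split => x /=; rewrite !in_itv/= ltrBlDr lerBrDr.
rewrite !lebesgue_measure_itv/= !lte_fin ltrD2r -!EFinD.
by case: ifP => // _; congr (_%:E); ring.
Qed.

Lemma ge0_integral_shift (c : R) (f : R -> \bar R) :
  measurable_fun setT f -> (forall v, 0 <= f v)%E ->
  (\int[lebesgue_measure]_x f (x + c)%R = \int[lebesgue_measure]_x f x)%E.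
Proof.
move=> mf f0.
have mshift : measurable_fun [set: measurableTypeR R] (fun x : R => x + c).
  by apply: measurable_funD.
pose f_mixin := @isMeasurableFun.Build _ _ (measurableTypeR R) (measurableTypeR R) _ mshift.
pose g : {mfun measurableTypeR R >-> measurableTypeR R} := HB.pack (fun x : R => x + c) f_mixin.
transitivity (\int[pushforward lebesgue_measure g]_x f x)%E.
  by rewrite ge0_integral_pushforward//.
apply: eq_measure_integral => A mA _.
exact: lebesgue_measure_shift.
Qed.

Lemma ge0_integral_rVS n (f : 'rV[R]_n.+1 -> \bar R) :
  measurable_fun setT f -> (forall v, 0 <= f v)%E ->
  (\int[lebesgue_rV n.+1]_v f v =
   \int[@lebesgue_measure R]_x \int[lebesgue_rV n]_v f (cons_rV (x, v)))%E.
Proof.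
move=> mf f0.
transitivity (\int[@lebesgue_measure R \x lebesgue_rV n]_p f (cons_rV p))%E.
  have := @ge0_integral_pushforward _ _ (measurableTypeR R * 'rV[R]_n)%type _ R
    (@cons_rV R n) (@measurable_cons_rV R n)
    (@lebesgue_measure R \x lebesgue_rV n)%E setT f measurableT mf.
  by rewrite preimage_setT => ->.
rewrite (fubini_tonelli1 (fun p : measurableTypeR R * 'rV[R]_n => f (cons_rV p)))//.
exact: measurableT_comp (@measurable_cons_rV R n).
Qed.

Lemma cons_rV_ord0 n (p : R * 'rV[R]_n) : cons_rV p ord0 ord0 = p.1 :> R.
Proof. by have /(congr1 fst) := @cons_rVK R n p. Qed.

Lemma cons_rV_lift n (p : R * 'rV[R]_n) j :
  cons_rV p ord0 (lift ord0 j) = p.2 ord0 j :> R.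
Proof.
have /(congr1 (fun q : R * 'rV[R]_n => q.2 ord0 j)) := @cons_rVK R n p.
by rewrite /= mxE => <-; congr (cons_rV _ _ _); exact/val_inj.
Qed.

Lemma uncons_rVK n : cancel (@uncons_rV R n) (@cons_rV R n).
Proof.
move=> v; apply/rowP => j; case: (unliftP ord0 j) => [k ->|->].
  rewrite cons_rV_lift/= mxE; congr (v _ _); exact/val_inj.
by rewrite cons_rV_ord0.
Qed.

Lemma cons_rVD n (x y : R) (u v : 'rV[R]_n) :
  cons_rV (x, u) + cons_rV (y, v) = cons_rV (x + y, u + v).
Proof.
apply/rowP => j; rewrite mxE; case: (unliftP ord0 j) => [k ->|->].
  by rewrite !cons_rV_lift/= mxE.
by rewrite !cons_rV_ord0.
Qed.

Lemma measurable_addr_rV n (c : 'rV[R]_n) :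
  measurable_fun setT (fun v : 'rV[R]_n => v + c).
Proof.
apply: measurable_fun_rV => j; under eq_fun do rewrite mxE.
by apply: measurable_funD => //; exact: measurable_coord_rV.
Qed.

Lemma ge0_integral_rV_shift n (c : 'rV[R]_n) (f : 'rV[R]_n -> \bar R) :
  measurable_fun setT f -> (forall v, 0 <= f v)%E ->
  (\int[lebesgue_rV n]_v f (v + c)%R = \int[lebesgue_rV n]_v f v)%E.
Proof.
elim: n c f => [|n IH] c f mf f0.
  by apply: eq_integral => x _; rewrite (_ : x + c = x)//; apply/rowP => -[].
have mf' := measurableT_comp mf (@measurable_cons_rV R n).
rewrite !ge0_integral_rVS//; last exact: measurableT_comp (measurable_addr_rV c).
pose G (x : measurableTypeR R) := (\int[lebesgue_rV n]_v f (cons_rV (x, v)))%E.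
transitivity (\int[lebesgue_measure]_x G (x + (uncons_rV c).1)%R)%E; last first.
  rewrite (@ge0_integral_shift _ G)//; last by move=> x; exact: integral_ge0.
  exact: (measurable_fun_fubini_tonelli_F (m2 := lebesgue_rV n)
    (fun p : measurableTypeR R * 'rV[R]_n => f (cons_rV p))).
apply: eq_integral => x _; rewrite /G.
have mfx : measurable_fun setT
    (fun v : 'rV[R]_n => f (cons_rV (x + (uncons_rV c).1, v))).
  apply: (measurableT_comp mf); apply: (measurableT_comp (@measurable_cons_rV R n)).
  exact: pair1_measurable.
rewrite -(IH (uncons_rV c).2 _ mfx (fun v => f0 _)).
by apply: eq_integral => v _; rewrite -[in LHS](uncons_rVK c) cons_rVD.
Qed.

Lemma ge0_integral_prod_rV n (g : 'I_n -> R -> R) :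
  (forall i, measurable_fun setT (g i)) -> (forall i x, 0 <= g i x) ->
  (\int[lebesgue_rV n]_v (\prod_i g i (v ord0 i))%:E =
   \prod_i \int[lebesgue_measure]_x (g i x)%:E)%E.
Proof.
elim: n g => [|n IH] g mg g0.
  rewrite big_ord0; under eq_integral do rewrite big_ord0.
  by rewrite integral_cst//= diracT mule1.
have mprod m (h : 'I_m -> R -> R) : (forall i, measurable_fun setT (h i)) ->
    measurable_fun setT (fun v : 'rV[R]_m => (\prod_i h i (v ord0 i))%:E).
  move=> mh; apply/measurable_EFinP; apply: measurable_prod => i _.
  exact: measurableT_comp (mh i) (measurable_coord_rV i).
rewrite ge0_integral_rVS//; [|exact: mprod|by move=> v; rewrite lee_fin prodr_ge0].
rewrite big_ord_recl.
transitivity (\int[lebesgue_measure]_x ((g ord0 x)%:E *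
    \prod_(i < n) \int[lebesgue_measure]_x (g (lift ord0 i) x)%:E))%E.
  apply: eq_integral => x _.
  under eq_integral.
    move=> v _; rewrite big_ord_recl cons_rV_ord0/= EFinM.
    under eq_bigr do rewrite cons_rV_lift/=.
    over.
  have mg' := mprod n _ (fun i => mg (lift ord0 i)).
  rewrite ge0_integralZl//= ?lee_fin//.
  by rewrite (IH (fun i => g (lift ord0 i))).
  by move=> v _; rewrite lee_fin prodr_ge0.
rewrite ge0_integralZr//.
- by apply/measurable_EFinP; exact: mg.
- by move=> x _; rewrite lee_fin.
- by apply: prode_ge0 => i _; apply: integral_ge0 => x _; rewrite lee_fin.
Qed.

End lebesgue_basics.

(** * Integrals of bounded functions with bounded support *)

HB.lock Definition J {R : realType} {n : nat} (f : 'rV[R]_n -> R) : R :=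
  \int[lebesgue_rV n]_x f x.

Section nice_functions.
Context {R : realType} {n : nat}.
Implicit Types f g K : 'rV[R]_n -> R.

Lemma ler_mx_normP (x : 'rV[R]_n) (r : R) : 0 <= r ->
  `|x| <= r <-> forall j, `|x ord0 j| <= r.
Proof.
move=> r0; split=> [xr j|xr].
  apply: le_trans xr; rewrite [leRHS]/Num.norm/= mx_normrE.
  exact: (le_bigmax _ (fun i : 'I_1 * 'I_n => `|x i.1 i.2|) (ord0, j)).
rewrite [leLHS]/Num.norm/= mx_normrE; apply: bigmax_le => // -[i j] _ /=.
by rewrite (ord1 i).
Qed.

Definition cbox (r : R) : set 'rV[R]_n := [set v | forall j, v ord0 j \in `[-r, r]].

Lemma cboxE r (v : 'rV[R]_n) : 0 <= r -> cbox r v <-> `|v| <= r.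
Proof.
move=> r0; rewrite (ler_mx_normP v r0).
by split=> h j; move: (h j); rewrite /= in_itv/= ler_norml.
Qed.

Lemma measurable_cbox r : measurable (cbox r).
Proof.
rewrite (_ : cbox r = \bigcap_(j in [set: 'I_n])
    (fun v => v ord0 j) @^-1` [set` `[-r, r]%R]).
  apply: fin_bigcap_measurable => // j _.
  by rewrite -[X in measurable X]setTI; exact: measurable_coord_rV.
by apply/seteqP; split=> [v Bv j _|v Bv j]; exact: Bv.
Qed.

Lemma lebesgue_cbox r : 0 <= r ->
  lebesgue_rV n (cbox r) = ((2 * r) ^+ n)%:E.
Proof.
move=> r0; rewrite /cbox (lebesgue_rV_box (A := fun _ => [set` `[-r, r]%R]))//.
have -> : lebesgue_measure [set` `[-r, r]%R] = (2 * r)%:E :> \bar R.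
  rewrite lebesgue_measure_itv/= lte_fin.
  case: ifPn => [_|]; first by rewrite -EFinB; congr (_%:E); ring.
  rewrite -leNgt => rr; congr (_%:E).
  have -> : r = 0 by lra.
  by rewrite mulr0.
by rewrite prodEFin prodr_const card_ord.
Qed.

(** Locally bounded measurable functions: convolution kernels, polynomials and
    potentials, stable under sums and products. *)
Definition lbm f := measurable_fun setT f /\
  forall r : R, exists M : R, forall x, `|x| <= r -> `|f x| <= M.

(** Bounded measurable functions with bounded support. The integral is
    additive and monotone on this class without further integrability
    conditions, and it is stable under translations and under multiplication
    by [lbm] functions. *)
Definition nice f := lbm f /\ exists r : R, forall x, r < `|x| -> f x = 0.

Lemma niceP f : nice f <-> measurable_fun setT f /\
  exists r M : R, [/\ 0 <= r, 0 <= M, forall x, `|f x| <= M & forall x, ~ cbox r x -> f x = 0].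
Proof.
split=> [[[mf bf] [r fr]]|[mf [r [M [r0 M0 fM fr]]]]].
  split=> //; have [M fM] := bf (Num.max r 0).
  have rf x : Num.max r 0 < `|x| -> f x = 0.
    by move=> rx; apply: fr; apply: le_lt_trans rx; rewrite le_max lexx.
  exists (Num.max r 0), (Num.max M 0); split.
  - by rewrite le_max lexx orbT.
  - by rewrite le_max lexx orbT.
  - move=> x; have [xr|/rf ->] := leP `|x| (Num.max r 0).
      by apply: le_trans (fM x xr) _; rewrite le_max lexx.
    by rewrite normr0 le_max lexx orbT.
  - have m0 : 0 <= Num.max r 0 by rewrite le_max lexx orbT.
    by move=> x; rewrite (cboxE x m0) => /negP; rewrite -ltNge; exact: rf.
split; first by split=> // s; exists M => x _; exact: fM.
by exists r => x xr; apply: fr; rewrite (cboxE x r0); apply/negP; rewrite -ltNge.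
Qed.

Lemma nice_lbm f : nice f -> lbm f. Proof. by case. Qed.

Lemma nice_meas f : nice f -> measurable_fun setT f. Proof. by case=> -[]. Qed.

Lemma lbm_cst c : lbm (fun _ => c).
Proof. by split=> [|r]; [exact: measurable_cst|exists `|c|]. Qed.

Lemma lbmD f g : lbm f -> lbm g -> lbm (fun x => f x + g x).
Proof.
move=> [mf bf] [mg bg]; split; first exact: measurable_funD.
move=> r; have [M fM] := bf r; have [N gN] := bg r; exists (M + N) => x xr.
by rewrite (le_trans (ler_normD _ _))// lerD ?fM ?gN.
Qed.

Lemma lbmM f g : lbm f -> lbm g -> lbm (fun x => f x * g x).
Proof.
move=> [mf bf] [mg bg]; split; first exact: measurable_funM.
move=> r; have [M fM] := bf r; have [N gN] := bg r; exists (M * N) => x xr.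
by rewrite normrM ler_pM ?fM ?gN.
Qed.

Lemma lbmN f : lbm f -> lbm (fun x => - f x).
Proof.
move=> [mf bf]; split; first exact: measurableT_comp.
by move=> r; have [M fM] := bf r; exists M => x xr; rewrite normrN fM.
Qed.

Lemma lbmB f g : lbm f -> lbm g -> lbm (fun x => f x - g x).
Proof. by move=> lf /lbmN; exact: lbmD. Qed.

Lemma lbmZ c f : lbm f -> lbm (fun x => c * f x).
Proof. by move=> lf; apply: lbmM => //; exact: lbm_cst. Qed.

Lemma lbm_sum (I : Type) (s : seq I) (f : I -> 'rV[R]_n -> R) :
  (forall i, lbm (f i)) -> lbm (fun x => \sum_(i <- s) f i x).
Proof.
move=> lf; elim: s => [|i s IH].
  by under eq_fun do rewrite big_nil; exact: lbm_cst.
by under eq_fun do rewrite big_cons; exact: lbmD.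
Qed.

Lemma lbm_norm f : lbm f -> lbm (fun x => `|f x|).
Proof.
move=> [mf bf]; split; first exact: measurableT_comp.
by move=> r; have [M fM] := bf r; exists M => x xr; rewrite normr_id fM.
Qed.

Lemma lbm_shift c f : lbm f -> lbm (fun x => f (x + c)).
Proof.
move=> [mf bf]; split; first exact: measurableT_comp (measurable_addr_rV c).
move=> r; have [M fM] := bf (r + `|c|); exists M => x xr; apply: fM.
by rewrite (le_trans (ler_normD _ _))// lerD.
Qed.

Lemma lbm_comp1 (F : R -> R) f : continuous F -> lbm f -> lbm (fun x => F (f x)).
Proof.
move=> cF [mf bf]; split.
  by apply: measurableT_comp => //; exact: continuous_measurable_fun.
move=> r; have [M fM] := bf r.
have [M0|M0] := leP 0 M; last first.
  exists 0 => x /fM; move: (normr_ge0 (f x)) => h1 h2; exfalso.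
  by move: (lt_le_trans M0 h1); rewrite ltNge h2.
have cFM : {within `[- M, M], continuous F}.
  exact: continuous_subspaceT.
have MM : - M <= M by rewrite ge0_cp.
have [c _ cM] := EVT_max MM cFM.
have [d _ dM] := EVT_min MM cFM.
exists (Num.max `|F c| `|F d|) => x /fM; rewrite ler_norml => xM.
have xI : f x \in `[- M, M] by rewrite in_itv.
have := cM _ xI; have := dM _ xI; rewrite le_max => h1 h2.
have [F0|F0] := leP 0 (F (f x)).
  by rewrite ger0_norm// (le_trans h2 (ler_norm _)).
by apply/orP; right; rewrite ltr0_norm// -normrN (le_trans _ (ler_norm _))// lerN2.
Qed.

Lemma lbm_coord j : lbm (fun x => x ord0 j).
Proof.
split; first exact: measurable_coord_rV.
move=> r; have [r0|r0] := leP 0 r.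
  by exists r => x; rewrite (ler_mx_normP x r0) => /(_ j).
by exists 0 => x xr; have := le_lt_trans xr r0; rewrite ltNge normr_ge0.
Qed.

Lemma nice0 : nice (fun _ => 0).
Proof. by split; [exact: lbm_cst|exists 0]. Qed.

Lemma niceD f g : nice f -> nice g -> nice (fun x => f x + g x).
Proof.
move=> [lf [r fr]] [lg [s gs]]; split; first exact: lbmD.
by exists (Num.max r s) => x; rewrite gt_max => /andP[/fr -> /gs ->]; rewrite addr0.
Qed.

Lemma niceMl f g : nice f -> lbm g -> nice (fun x => f x * g x).
Proof.
move=> [lf [r fr]] lg; split; first exact: lbmM.
by exists r => x /fr ->; rewrite mul0r.
Qed.

Lemma niceMr f g : lbm f -> nice g -> nice (fun x => f x * g x).
Proof. by move=> lf ng; under eq_fun do rewrite mulrC; exact: niceMl. Qed.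

Lemma niceZ c f : nice f -> nice (fun x => c * f x).
Proof. by move=> nf; apply: niceMr => //; exact: lbm_cst. Qed.

Lemma niceN f : nice f -> nice (fun x => - f x).
Proof.
move=> [lf [r fr]]; split; first exact: lbmN.
by exists r => x /fr ->; rewrite oppr0.
Qed.

Lemma niceB f g : nice f -> nice g -> nice (fun x => f x - g x).
Proof. by move=> lf /niceN; exact: niceD. Qed.

Lemma nice_sum (I : Type) (s : seq I) (f : I -> 'rV[R]_n -> R) :
  (forall i, nice (f i)) -> nice (fun x => \sum_(i <- s) f i x).
Proof.
move=> lf; elim: s => [|i s IH].
  by under eq_fun do rewrite big_nil; exact: nice0.
by under eq_fun do rewrite big_cons; exact: niceD.
Qed.

Lemma nice_norm f : nice f -> nice (fun x => `|f x|).
Proof.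
move=> [lf [r fr]]; split; first exact: lbm_norm.
by exists r => x /fr ->; rewrite normr0.
Qed.

Lemma nice_sqr f : nice f -> nice (fun x => f x ^+ 2).
Proof. by move=> nf; under eq_fun do rewrite expr2; apply: niceMl => //; case: nf. Qed.

Lemma nice_shift c f : nice f -> nice (fun x => f (x + c)).
Proof.
move=> [lf [r fr]]; split; first exact: lbm_shift.
exists (r + `|c|) => x xr; apply: fr.
have := ler_normB (x + c) c; rewrite addrK; lra.
Qed.

Lemma nice_indic A : measurable A -> (exists r, A `<=` cbox r) -> nice \1_A.
Proof.
move=> mA [r Ar]; apply/niceP; split; first exact: measurable_indic.
exists (Num.max r 0), 1; split => // [|x|x xr].
- by rewrite le_max lexx orbT.
- by rewrite indicE; case: (x \in A); rewrite ?normr1 ?normr0.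
- rewrite indicE memNset// => /Ar Ax; apply: xr => j; have := Ax j.
  by rewrite !in_itv/= => /andP[a b]; rewrite le_max b orTb andbT lerNl le_max; lra.
Qed.

Notation mu := (lebesgue_rV n).

(** Shared by the single integrals and by the double integrals of Fubini's
    theorem. *)
Lemma integrable_finite_supp d (T : measurableType d)
    (m : {measure set T -> \bar R}) (A : set T) (f : T -> R) (M : R) :
  measurable A -> (m A < +oo)%E -> measurable_fun setT f ->
  (forall x, `|f x| <= M) -> (forall x, ~ A x -> f x = 0) ->
  m.-integrable setT (EFin \o f).
Proof.
move=> mA Aoo mf fM fA.
have -> : EFin \o f = (EFin \o f) \_ A.
  apply/funext => x; rewrite patchE; case: ifPn => //; rewrite notin_setE => /fA /= ->//.
apply/(integrable_mkcond _ mA); apply: measurable_bounded_integrable => //.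
  exact: measurable_funS mf.
exists M; split; first exact: num_real.
by move=> N MN x _ /=; apply: le_trans (fM x) (ltW MN).
Qed.

Lemma nice_integrable f : nice f -> mu.-integrable setT (EFin \o f).
Proof.
move=> /niceP[mf [r [M [r0 _ fM fr]]]].
have Aoo : (mu (cbox r) < +oo)%E by rewrite (lebesgue_cbox r0) ltry.
exact: (integrable_finite_supp (measurable_cbox r) Aoo mf fM fr).
Qed.

Lemma JdefE f : J f = \int[mu]_x f x.
Proof. by rewrite J.unlock. Qed.

Lemma eq_J f g : f =1 g -> J f = J g.
Proof. by move=> fg; rewrite !J.unlock; apply: eq_Rintegral => x _; exact: fg. Qed.

Lemma JE f : nice f -> (J f)%:E = (\int[mu]_x (f x)%:E)%E.
Proof. by move=> /nice_integrable nf; rewrite J.unlock fineK//; exact: integrable_fin_num. Qed.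

Lemma JD f g : nice f -> nice g -> J (fun x => f x + g x) = J f + J g.
Proof. by move=> nf ng; rewrite !J.unlock; apply: RintegralD => //; exact: nice_integrable. Qed.

Lemma JB f g : nice f -> nice g -> J (fun x => f x - g x) = J f - J g.
Proof. by move=> nf ng; rewrite !J.unlock; apply: RintegralB => //; exact: nice_integrable. Qed.

Lemma JZ c f : nice f -> J (fun x => c * f x) = c * J f.
Proof. by move=> nf; rewrite !J.unlock; apply: RintegralZl => //; exact: nice_integrable. Qed.

Lemma J0 : J (fun _ : 'rV[R]_n => 0) = 0.
Proof. by rewrite J.unlock Rintegral_cst ?mul0r. Qed.

Lemma JN f : nice f -> J (fun x => - f x) = - J f.
Proof.
move=> nf; rewrite -mulN1r -JZ//; apply: eq_J => x; by rewrite mulN1r.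
Qed.

Lemma J_sum (I : Type) (s : seq I) (f : I -> 'rV[R]_n -> R) :
  (forall i, nice (f i)) -> J (fun x => \sum_(i <- s) f i x) = \sum_(i <- s) J (f i).
Proof.
move=> lf; elim: s => [|i s IH].
  rewrite big_nil; transitivity (J (fun _ : 'rV[R]_n => 0)); last exact: J0.
  by apply: eq_J => x; rewrite big_nil.
rewrite big_cons -IH -JD//; last exact: nice_sum.
by apply: eq_J => x; rewrite big_cons.
Qed.

Lemma J_ge0 f : (forall x, 0 <= f x) -> 0 <= J f.
Proof. by move=> f0; rewrite J.unlock; apply: Rintegral_ge0. Qed.

Lemma le_J f g : nice f -> nice g -> (forall x, f x <= g x) -> J f <= J g.
Proof. by move=> nf ng fg; rewrite !J.unlock; apply: le_Rintegral => // ; exact: nice_integrable. Qed.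

Lemma J_norm f : nice f -> `|J f| <= J (fun x => `|f x|).
Proof. by move=> nf; rewrite !J.unlock; apply: le_normr_Rintegral => //; exact: nice_integrable. Qed.

(** Writing [f] as [(|f| + f) - |f|] reduces the invariance to nonnegative
    functions. *)
Lemma J_shift c f : nice f -> J (fun x => f (x + c)) = J f.
Proof.
move=> nf.
have J_shift0 g : nice g -> (forall x, 0 <= g x) -> J (fun x => g (x + c)) = J g.
  move=> ng g0; apply: EFin_inj; rewrite !JE//; last exact: nice_shift.
  apply: (ge0_integral_rV_shift c (f := EFin \o g)) => //.
    by apply/measurable_EFinP; exact: nice_meas.
have nn := nice_norm nf.
have np := niceD nn nf.
have E1 := J_shift0 _ nn (fun x => normr_ge0 (f x)).
have p0 x : 0 <= `|f x| + f x by have := ler_norm (- f x); rewrite normrN; lra.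
have E2 := J_shift0 _ np p0.
transitivity (J (fun x => `|f x| + f x) - J (fun x => `|f x|)).
  rewrite -E1 -E2 -JB; [|exact: (nice_shift c np)|exact: (nice_shift c nn)].
  by apply: eq_J => x; ring.
by rewrite -JB//; apply: eq_J => x; ring.
Qed.

Lemma measurable_subr_rV :
  measurable_fun setT (fun p : 'rV[R]_n * 'rV[R]_n => p.1 - p.2).
Proof.
apply: measurable_fun_rV => j; under eq_fun do rewrite !mxE.
apply: measurable_funB.
- exact: (measurableT_comp (measurable_coord_rV j) measurable_fst).
- exact: (measurableT_comp (measurable_coord_rV j) measurable_snd).
Qed.

Lemma J_fubini (F : 'rV[R]_n * 'rV[R]_n -> R) (r M : R) :
  measurable_fun setT F -> 0 <= r -> (forall p, `|F p| <= M) ->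
  (forall p, ~ (cbox r p.1 /\ cbox r p.2) -> F p = 0) ->
  [/\ measurable_fun setT (fun x => J (fun y => F (x, y))),
      measurable_fun setT (fun y => J (fun x => F (x, y))) &
  J (fun x => J (fun y => F (x, y))) = J (fun y => J (fun x => F (x, y)))].
Proof.
move=> mF r0 FM Fr.
have bfin : (mu (cbox r) < +oo)%E by rewrite (lebesgue_cbox r0) ltry.
have intF : (mu \x mu)%E.-integrable setT (EFin \o F).
  have mrr : measurable (cbox r `*` cbox r) by apply: measurableX; exact: measurable_cbox.
  have foo : ((mu \x mu) (cbox r `*` cbox r) < +oo)%E.
    rewrite product_measure1E; [|exact: measurable_cbox..].
    by apply: lte_mul_pinfty => //; rewrite ge0_fin_numE.
  exact: (integrable_finite_supp mrr foo mF FM Fr).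
have Mb := measurable_cbox r.
have n1 x : mu.-integrable setT (EFin \o (fun y => F (x, y))).
  apply: (integrable_finite_supp Mb bfin _ (fun y => FM (x, y))).
    exact: measurableT_comp mF (pair1_measurable _).
  by move=> y ry; apply: Fr => -[].
have n2 y : mu.-integrable setT (EFin \o (fun x => F (x, y))).
  apply: (integrable_finite_supp Mb bfin _ (fun x => FM (x, y))).
    exact: measurableT_comp mF (pair2_measurable _).
  by move=> x ry; apply: Fr => -[].
have E1 x : (J (fun y => F (x, y)))%:E = (\int[mu]_y (F (x, y))%:E)%E.
  by have h := n1 x; rewrite J.unlock fineK//; exact: integrable_fin_num.
have E2 y : (J (fun x => F (x, y)))%:E = (\int[mu]_x (F (x, y))%:E)%E.
  by have h := n2 y; rewrite J.unlock fineK//; exact: integrable_fin_num.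
split.
- apply/measurable_EFinP; rewrite (_ : EFin \o _ = fubini_F mu (EFin \o F)).
    exact: (measurable_fubini_F intF).
  by apply/funext => x /=; rewrite E1.
- apply/measurable_EFinP; rewrite (_ : EFin \o _ = fubini_G mu (EFin \o F)).
    exact: (measurable_fubini_G intF).
  by apply/funext => x /=; rewrite E2.
- rewrite [LHS]JdefE [RHS]JdefE; congr fine; under eq_integral do rewrite E1.
  under [RHS]eq_integral do rewrite E2.
  exact: (Fubini intF).
Qed.

Definition conv g K (x : 'rV[R]_n) := J (fun y => g y * K (x - y)).

Lemma lbm_refl x K : lbm K -> lbm (fun y => K (x - y)).
Proof.
move=> [mK bK]; split.
  exact: (measurableT_comp mK (measurableT_comp measurable_subr_rV (pair1_measurable x))).
move=> r; have [M KM] := bK (`|x| + r); exists M => y yr; apply: KM.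
by rewrite (le_trans (ler_normB _ _))// lerD.
Qed.

Lemma nice_conv_in x g K : nice g -> lbm K -> nice (fun y => g y * K (x - y)).
Proof. by move=> ng lK; apply: niceMl => //; exact: lbm_refl. Qed.

Lemma J_fubini_conv f g K : nice f -> nice g -> lbm K ->
  [/\ measurable_fun setT (fun x => f x * conv g K x) &
   J (fun x => f x * conv g K x) = J (fun y => g y * J (fun x => f x * K (x - y)))].
Proof.
move=> nf ng lK.
have /niceP[mf [r [M [r0 M0 fM fr]]]] := nf.
have /niceP[mg [s [N [s0 N0 gN gs]]]] := ng.
have [L KL] := lK.2 (r + s).
pose F (p : 'rV[R]_n * 'rV[R]_n) := f p.1 * (g p.2 * K (p.1 - p.2)).
have mF : measurable_fun setT F.
  apply: measurable_funM; first exact: measurableT_comp mf measurable_fst.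
  apply: measurable_funM; first exact: measurableT_comp mg measurable_snd.
  exact: measurableT_comp lK.1 measurable_subr_rV.
have F0 p : ~ (cbox r p.1 /\ cbox s p.2) -> F p = 0.
  move=> /not_andP[/fr|/gs]; rewrite /F => ->; by rewrite ?mul0r ?mulr0.
have L0 : 0 <= Num.max L 0 by rewrite le_max lexx orbT.
have FM p : `|F p| <= M * (N * Num.max L 0).
  have [[h1 h2]|/F0 ->] := pselect (cbox r p.1 /\ cbox s p.2); last first.
    by rewrite normr0 !mulr_ge0.
  rewrite !normrM; apply: ler_pM => //; apply: ler_pM => //.
  rewrite le_max KL// (le_trans (ler_normB _ _))// lerD//; exact/cboxE.
have rs0 : 0 <= Num.max r s by rewrite le_max r0.
have sub t (x : 'rV[R]_n) : t <= Num.max r s -> cbox t x -> cbox (Num.max r s) x.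
  move=> ts tx j; have := tx j; rewrite !in_itv/= => /andP[a b].
  by apply/andP; split; lra.
have [|m1 m2 E] := J_fubini mF rs0 FM.
  move=> p h; apply: F0 => -[h1 h2]; apply: h; split.
    by apply: sub h1; rewrite le_max lexx.
  by apply: sub h2; rewrite le_max lexx orbT.
have E1 : (fun x => J (fun y => F (x, y))) = (fun x => f x * conv g K x).
  by apply/funext => x; exact: (JZ (f x) (nice_conv_in x ng lK)).
split; first by rewrite -E1.
rewrite -E1 E; apply: eq_J => y.
have nfK : nice (fun x => f x * K (x - y)).
  exact: (niceMl nf (lbm_shift (- y) lK)).
rewrite -(JZ (g y) nfK).
by apply: eq_J => x; rewrite /F/=; ring.
Qed.

(** Measurability is the delicate part: Fubini's theorem gives it for [f *
    conv g K] with [f] of bounded support, hence on every cube. *)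
Lemma conv_lbm g K : nice g -> lbm K -> lbm (conv g K).
Proof.
move=> ng lK.
have /niceP[mg [s [N [s0 N0 gN gs]]]] := ng.
split; last first.
  move=> r; have [L KL] := lK.2 (r + s).
  exists (J (fun y => `|g y| * Num.max L 0)) => x xr.
  apply: le_trans (J_norm (nice_conv_in x ng lK)) _.
  apply: le_J => [||y]; first exact/nice_norm/nice_conv_in.
    by apply: niceMl; [exact: nice_norm|exact: lbm_cst].
  have [ys|/gs ->] := pselect (cbox s y); last by rewrite !(mul0r,normr0).
  rewrite normrM ler_wpM2l// le_max KL// (le_trans (ler_normB _ _))// lerD//.
  exact/cboxE.
pose f_ (m : nat) := \1_(cbox m%:R) : 'rV[R]_n -> R.
have nf m : nice (f_ m).
  by apply: nice_indic; [exact: measurable_cbox|exists m%:R].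
apply: (@measurable_fun_cvg _ _ _ _ (fun m x => f_ m x * conv g K x)) => //.
  by move=> m; have [] := J_fubini_conv (nf m) ng lK.
move=> x _; apply: (@cvg_near_cst).
near=> m; rewrite /f_ indicE mem_set ?mul1r//; apply/cboxE => //.
near: m; exact: nbhs_infty_ger.
Unshelve. all: end_near. Qed.

End nice_functions.

(** * Cauchy-Schwarz and dominated convergence *)

Section cauchy_schwarz.
Context {R : realType} {n : nat}.
Implicit Types f g : 'rV[R]_n -> R.

(** The discriminant of a nonnegative quadratic polynomial; every
    Cauchy-Schwarz inequality below is an instance. *)
Lemma discr_le (A B C : R) : 0 <= C ->
  (forall t, 0 <= A + 2 * t * B + t ^+ 2 * C) -> B ^+ 2 <= A * C.
Proof.
move=> C0 h.
have [C1|C1] := eqVneq C 0.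
  rewrite C1 mulr0; have [->|B1] := eqVneq B 0; first by rewrite expr0n.
  have := h (- (A + 1) / (2 * B)); rewrite C1 mulr0 addr0.
  have -> : 2 * (- (A + 1) / (2 * B)) * B = - (A + 1) by field.
  lra.
have := h (- B / C).
have -> : A + 2 * (- B / C) * B + (- B / C) ^+ 2 * C = (A * C - B ^+ 2) / C by field.
by rewrite pmulr_lge0 ?invr_gt0 ?lt_def ?C1// subr_ge0.
Qed.

Lemma J_CS f g : nice f -> nice g ->
  J (fun x => f x * g x) ^+ 2 <= J (fun x => f x ^+ 2) * J (fun x => g x ^+ 2).
Proof.
move=> nf ng; apply: discr_le => [|t]; first by apply: J_ge0 => x; rewrite sqr_ge0.
have nfg := niceMl nf (nice_lbm ng).
have nf2 := nice_sqr nf; have ng2 := nice_sqr ng.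
have -> : J (fun x => f x ^+ 2) + 2 * t * J (fun x => f x * g x) +
    t ^+ 2 * J (fun x => g x ^+ 2) = J (fun x => (f x + t * g x) ^+ 2).
  rewrite -(JZ (2 * t) nfg) -(JZ (t ^+ 2) ng2) -(JD nf2 (niceZ _ nfg)).
  rewrite -(JD (niceD nf2 (niceZ _ nfg)) (niceZ _ ng2)).
  by apply: eq_J => x; ring.
by apply: J_ge0 => x; rewrite sqr_ge0.
Qed.

Lemma J_dct (f_ : nat -> 'rV[R]_n -> R) f (r M : R) : 0 <= r ->
  (forall k, measurable_fun setT (f_ k)) ->
  (forall k x, `|f_ k x| <= M) -> (forall k x, ~ cbox r x -> f_ k x = 0) ->
  (forall x, f_ k x @[k --> \oo] --> f x) ->
  nice f /\ J (f_ k) @[k --> \oo] --> J f.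
Proof.
move=> r0 mf fM fr ff.
have M0 : 0 <= M by apply: le_trans (fM 0%N 0).
have n_ k : nice (f_ k) by apply/niceP; split=> //; exists r, M; split=> //; exact: fr.
have mlim : measurable_fun setT f.
  by apply: (measurable_fun_cvg mf) => x _; exact: ff.
have nf : nice f.
  apply/niceP; split=> //; exists r, M; split=> //.
  - move=> x; have cf : `|f_ k x| @[k --> \oo] --> `|f x| by apply: cvg_norm; exact: ff.
    rewrite -(cvg_lim _ cf)//; apply: limr_le; first exact: cvgP cf.
    by apply: nearW => k.
  - move=> x xr; rewrite -(cvg_lim _ (ff x))//.
    by under eq_fun do rewrite fr//; rewrite lim_cst.
split=> //.
have ng : nice (fun x : 'rV[R]_n => M * \1_(cbox r) x).
  by apply: niceZ; apply: nice_indic; [exact: measurable_cbox|exists r].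
have mu_cvg := @dominated_convergence _ _ R (lebesgue_rV n) setT measurableT
  (fun k x => (f_ k x)%:E) (EFin \o f) (fun x : 'rV[R]_n => (M * \1_(cbox r) x)%:E).
have [||||| _ _ cv] := mu_cvg.
- by move=> k; apply/measurable_EFinP; exact: mf.
- exact/measurable_EFinP.
- by apply: aeW => x _; apply: cvg_EFin; [exact: nearW|exact: ff].
- exact: nice_integrable ng.
- apply: aeW => x k _ /=; rewrite lee_fin indicE.
  have [/mem_set ->|xr] := pselect (cbox r x); first by rewrite mulr1.
  by rewrite fr// memNset// mulr0 normr0.
- rewrite (_ : (fun k => J (f_ k)) = fun k => \int[lebesgue_rV n]_x f_ k x); last first.
    by rewrite J.unlock.
  apply/fine_cvg; rewrite -[X in _ --> X]/((J f)%:E : \bar R) in cv *.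
  by rewrite (JE nf).
Qed.

End cauchy_schwarz.

(** * Difference quotients *)

Section line_derivatives.
Context {R : realType} {n : nat}.
Implicit Types (f : 'rV[R]_n -> R) (x v : 'rV[R]_n).

Lemma is_derive_line f (x v : 'rV[R]_n) (t d : R) :
  is_derive (x + t *: v) v (f : 'rV[R]_n -> R^o) d ->
  is_derive t 1 (fun s : R => (f (x + s *: v) : R^o)) d.
Proof.
move=> [df Df].
have E : (fun h : R => h^-1 *: (((fun s : R => (f (x + s *: v) : R^o)) \o shift t) (h *: 1) - f (x + t *: v)))
  = (fun h : R => h^-1 *: ((f \o shift (x + t *: v)) (h *: v) - f (x + t *: v))).
  apply/funext => h /=; congr (_ *: (f _ - _)).
  by rewrite [_%:A]mulr1 scalerDl addrCA.
split; first by rewrite /derivable E.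
by rewrite -Df /derive E.
Qed.

Lemma is_derive_line0 f (x v : 'rV[R]_n) (d : R) :
  is_derive x v (f : 'rV[R]_n -> R^o) d ->
  (f (x + h *: v) - f x) / h @[h --> 0^'] --> d.
Proof.
move=> [df <-].
have E : (fun h : R => (f (x + h *: v) - f x) / h) =
  (fun h : R => h^-1 *: ((f \o shift x) (h *: v) - f x)).
  by apply/funext => h /=; rewrite mulrC [h *: v + x]addrC.
rewrite E; exact: df.
Qed.

Lemma MVT_line f (D : 'rV[R]_n -> R) x v (h : R) :
  (forall s, is_derive (x + s *: v) v (f : 'rV[R]_n -> R^o) (D (x + s *: v))) ->
  exists2 c, `|c| <= `|h| & f (x + h *: v) - f x = D (x + c *: v) * h.
Proof.
move=> dD.
pose g := (fun s : R => (f (x + s *: v) : R^o)).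
have dg (s : R) : is_derive s 1 g (D (x + s *: v)) by exact: is_derive_line.
have cg a b : {within `[a, b], continuous g}.
  by apply: derivable_within_continuous => s _; have [] := dg s.
have g0 : g 0 = f x by rewrite /g scale0r addr0.
have [h0|h0] := leP 0 h.
  have [c] := MVT_segment h0 (fun s _ => dg s) (cg _ _).
  rewrite in_itv/= subr0 g0 => /andP[c0 ch] E; exists c => //.
  by rewrite !ger0_norm//.
have [c] := MVT_segment (ltW h0) (fun s _ => dg s) (cg _ _).
rewrite in_itv/= sub0r g0 => /andP[c0 ch] E; exists c.
  by rewrite !ler0_norm ?lerN2// ltW.
by rewrite -opprB E mulrN opprK.
Qed.

End line_derivatives.

Section l2_shift.
Context {R : realType} {n : nat}.
Implicit Types (V : 'rV[R]_n -> R).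

Lemma cvg_2V : (2 ^- k : R) @[k --> \oo] --> (0 : R).
Proof.
rewrite (_ : (fun k : nat => 2 ^- k) = (fun k : nat => (2^-1) ^+ k)).
  by apply: cvg_expr; rewrite ger0_norm ?invr_ge0// invf_lt1// ltr1n.
by apply/funext => k; rewrite exprVn.
Qed.

(** By the mean value theorem the difference quotients are bounded by the
    supremum of [D], so dominated convergence applies. The exponent is 1 for
    integration by parts and 2 for [l2_shift_le]. *)
Lemma J_cvg_quotient V (D : 'rV[R]_n -> R) v m : nice V -> nice D ->
  (forall x, is_derive x v (V : 'rV[R]_n -> R^o) (D x)) ->
  J (fun x => ((V (x + 2 ^- k *: v) - V x) / 2 ^- k) ^+ m.+1) @[k --> \oo] -->
  J (fun x => D x ^+ m.+1).
Proof.
move=> nV nD dV.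
have /niceP[mV [r [M [r0 M0 VM Vr]]]] := nV.
have /niceP[mD [s [N [s0 N0 DN Ds]]]] := nD.
have p2 k : 0 < 2 ^- k :> R by rewrite invr_gt0 exprn_gt0.
have p21 k : 2 ^- k <= 1 :> R by rewrite invf_le1 ?exprn_gt0// exprn_ege1// ler1n.
have rv0 : 0 <= r + `|v| by rewrite addr_ge0.
have far k (x : 'rV[R]_n) : r + `|v| < `|x| -> V (x + 2 ^- k *: v) = 0 /\ V x = 0.
  move=> xr; split; apply: Vr => /(cboxE _ r0) h; move: xr; rewrite ltNge => /negP; apply.
    have := ler_normB (x + 2 ^- k *: v) (2 ^- k *: v); rewrite addrK => /le_trans; apply.
    apply: lerD => //; rewrite normrZ ger0_norm; last exact: ltW.
    by apply: ler_piMl => //; exact: p21.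
  by rewrite (le_trans h)// lerDl.
have [||||_ cv] := @J_dct R n (fun k x => ((V (x + 2 ^- k *: v) - V x) / 2 ^- k) ^+ m.+1)
  (fun x => D x ^+ m.+1) (r + `|v|) (N ^+ m.+1) rv0; last exact: cv.
- by move=> k; apply: measurable_funX; apply: measurable_funM => //;
    apply: measurable_funB => //; exact: (lbm_shift _ (nice_lbm nV)).1.
- move=> k x; rewrite normrX lerXn2r ?nnegrE//.
  have [c _ ->] := MVT_line (2 ^- k) (fun t => dV (x + t *: v)).
  by rewrite mulfK// gt_eqF.
- move=> k x xr; have [|-> ->] := far k x; last by rewrite subrr mul0r expr0n.
  by rewrite ltNge; apply/negP => /(cboxE x rv0).
- move=> x; apply: (@cvg_comp _ _ _ _ (fun t : R => t ^+ m.+1) _ (nbhs (D x))); last exact: exprn_continuous.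
  have /cvgr_dnbhsP := is_derive_line0 (dV x).
  apply; split; last exact: cvg_2V.
  by move=> k; rewrite gt_eqF.
Qed.

(** Splitting the displacement into [2 ^ k] equal steps reduces the estimate to
    infinitesimal displacements, where it becomes an equality. *)
Lemma l2_shift_le V (D : 'rV[R]_n -> R) v : nice V -> nice D ->
  (forall x, is_derive x v (V : 'rV[R]_n -> R^o) (D x)) ->
  J (fun x => (V (x + v) - V x) ^+ 2) <= J (fun x => D x ^+ 2).
Proof.
move=> nV nD dV.
have ns w : nice (fun x => (V (x + w) - V x) ^+ 2).
  by apply: nice_sqr; exact: (niceB (nice_shift w nV) nV).
(* The parallelogram inequality bounds the increment over [w] by those over
   its two halves, which have the same norm by translation invariance. *)
have half w : J (fun x => (V (x + w) - V x) ^+ 2) <=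
    4 * J (fun x => (V (x + 2^-1 *: w) - V x) ^+ 2).
  set u := 2^-1 *: w.
  have h1 : 2^-1 + 2^-1 = 1 :> R by field.
  have -> : w = u + u by rewrite /u -scalerDl h1 scale1r.
  have E := J_shift u (ns u).
  have -> : 4 * J (fun x => (V (x + u) - V x) ^+ 2) =
    2 * J (fun x => (V (x + u + u) - V (x + u)) ^+ 2) +
    2 * J (fun x => (V (x + u) - V x) ^+ 2) by rewrite E; ring.
  rewrite -(JZ 2 (nice_shift u (ns u))) -(JZ 2 (ns u)).
  rewrite -(JD (niceZ 2 (nice_shift u (ns u))) (niceZ 2 (ns u))).
  apply: le_J => [||x]; [exact: ns|exact: niceD (niceZ 2 (nice_shift u (ns u))) (niceZ 2 (ns u))|].
  rewrite [x + (u + u)]addrA; move: (V (x + u + u)) (V (x + u)) (V x) => a b c.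
  have := sqr_ge0 (a - 2 * b + c); rewrite -subr_ge0 => h.
  by rewrite -subr_ge0 (_ : _ - _ = (a - 2 * b + c) ^+ 2) ?sqr_ge0//; ring.
have iter k : J (fun x => (V (x + v) - V x) ^+ 2) <=
    J (fun x => ((V (x + 2 ^- k *: v) - V x) / 2 ^- k) ^+ 2).
  have -> : J (fun x => ((V (x + 2 ^- k *: v) - V x) / 2 ^- k) ^+ 2) =
    (2 ^+ k) ^+ 2 * J (fun x => (V (x + 2 ^- k *: v) - V x) ^+ 2).
    rewrite -(JZ _ (ns _)); apply: eq_J => x; rewrite invrK exprMn mulrC//.
  elim: k => [|k IH]; first by rewrite expr0 invr1 scale1r expr1n mul1r.
  apply: le_trans IH _; apply: le_trans (ler_wpM2l _ (half _)) _; first exact: sqr_ge0.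
  rewrite scalerA -invfM -exprS mulrA (_ : (2 ^+ k) ^+ 2 * 4 = (2 ^+ k.+1) ^+ 2)//.
  by rewrite [2 ^+ k.+1]exprS exprMn mulrC; congr (_ * _); rewrite expr2; ring.
rewrite -(cvg_lim _ (J_cvg_quotient (m := 1) nV nD dV))//.
apply: limr_ge; first exact: cvgP (J_cvg_quotient (m := 1) nV nD dV).
by apply: nearW => k; exact: iter.
Qed.

End l2_shift.

(** * Second moments of a cube *)

Section cube_moments.
Context {R : realType}.

Lemma integral_sqr_itv (a : R) (b g s : R) : 0 < a ->
  (\int[lebesgue_measure]_(x in `[(- a)%R, a]) ((b + x * g) ^+ 2 + s)%:E =
    (2 * a * (b ^+ 2 + s + a ^+ 2 / 3 * g ^+ 2))%:E)%E.
Proof.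
move=> a0.
pose F (x : R) := (b ^+ 2 + s) * x + b * g * x ^+ 2 + g ^+ 2 / 3 * x ^+ 3.
have dF (x : R) : is_derive x 1 F ((b + x * g) ^+ 2 + s).
  by apply: is_derive_eq; rewrite /GRing.scale/=; field.
have cF : continuous F.
  by move=> x; apply: differentiable_continuous; apply/derivable1_diffP; have [] := dF x.
rewrite (@continuous_FTC2 R (fun x => (b + x * g) ^+ 2 + s) F).
- by rewrite -EFinB /F; congr (_%:E); field.
- lra.
- apply: continuous_subspaceT => x.
  have df : is_derive x 1 (fun x : R => (b + x * g) ^+ 2 + s) (2 * (b + x * g) * g).
    by apply: is_derive_eq; rewrite /GRing.scale/=; ring.
  by apply: differentiable_continuous; apply/derivable1_diffP; have [] := df.
- by split=> [x _| |]; [have [] := dF x|apply: cvg_at_right_filter; exact: cF|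
    apply: cvg_at_left_filter; exact: cF].
- by move=> x _; rewrite derive1E; have [_ ->] := dF x.
Qed.

(** The constant [c] is what makes the induction on the dimension work: it
    collects the coordinates already integrated. *)
Lemma integral_cube_sqr n (a : R) (c : R) (g : 'I_n -> R) : 0 < a ->
  (\int[lebesgue_rV n]_z (\1_(cbox a) z * (c + \sum_i z ord0 i * g i) ^+ 2)%:E =
   ((2 * a) ^+ n * (c ^+ 2 + a ^+ 2 / 3 * \sum_i g i ^+ 2))%:E)%E.
Proof.
move=> a0; elim: n c g => [|n IH] c g.
  under eq_integral => z _.
    rewrite big_ord0 addr0 indicE mem_set ?mul1r; last by case.
    over.
  by rewrite integral_cst//= diracT mule1 big_ord0 mulr0 addr0 mul1r.
rewrite ge0_integral_rVS; last first.
- by move=> v; rewrite lee_fin mulr_ge0 ?sqr_ge0// indicE ler0n.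
- apply/measurable_EFinP; apply: measurable_funM.
    by apply: measurable_indic; exact: measurable_cbox.
  apply: measurable_funX; apply: measurable_funD => //.
  apply: measurable_sum => i; apply: measurable_funM => //.
  exact: measurable_coord_rV.
transitivity (\int[lebesgue_measure]_x ((\1_`[(- a)%R, a] x)%:E *
   ((2 * a) ^+ n * ((c + x * g ord0) ^+ 2 + a ^+ 2 / 3 * \sum_i g (lift ord0 i) ^+ 2))%:E))%E.
  apply: eq_integral => x _.
  have mi : measurable_fun setT (fun v : 'rV[R]_n => (\1_(cbox a) v *
      (c + x * g ord0 + \sum_(i < n) v ord0 i * g (lift ord0 i)) ^+ 2)%:E).
    apply/measurable_EFinP; apply: measurable_funM.
      by apply: measurable_indic; exact: measurable_cbox.
    apply: measurable_funX; apply: measurable_funD => //.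
    apply: measurable_sum => i; apply: measurable_funM => //.
    exact: measurable_coord_rV.
  rewrite -IH -ge0_integralZl//=; last first.
    by move=> v _; rewrite lee_fin mulr_ge0 ?sqr_ge0// indicE ler0n.
  apply: eq_integral => v _; rewrite -EFinM; congr (_%:E).
  rewrite [RHS]mulrA; congr (_ * _ ^+ 2); last first.
    rewrite big_ord_recl cons_rV_ord0/= addrA; congr (_ + _).
    by apply: eq_bigr => i _; rewrite cons_rV_lift.
  rewrite !indicE -natrM mulnb; congr (_%:R); congr (nat_of_bool _).
  apply/idP/andP => [/set_mem h|[/set_mem h1 /set_mem h2]].
    split; apply/mem_set; first by have := h ord0; rewrite cons_rV_ord0.
    by move=> j; have := h (lift ord0 j); rewrite cons_rV_lift.
  apply/mem_set => j; case: (unliftP ord0 j) => [k ->|->].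
    by rewrite cons_rV_lift; exact: h2.
  by rewrite cons_rV_ord0.
set S := \sum_i g (lift ord0 i) ^+ 2.
transitivity (((2 * a) ^+ n)%:E * \int[lebesgue_measure]_(x in `[(- a)%R, a])
    ((c + x * g ord0) ^+ 2 + a ^+ 2 / 3 * S)%:E)%E.
  have S0 : 0 <= a ^+ 2 / 3 * S.
    by rewrite mulr_ge0 ?divr_ge0 ?sqr_ge0// sumr_ge0// => i _; rewrite sqr_ge0.
  have mi : measurable_fun `[(- a)%R, a]
      (fun x : measurableTypeR R => ((c + x * g ord0) ^+ 2 + a ^+ 2 / 3 * S)%:E).
    apply/measurable_EFinP; apply: measurable_funD => //; apply: measurable_funX.
    by apply: measurable_funD => //; apply: measurable_funM.
  rewrite -ge0_integralZl//=; [|by move=> x _; rewrite lee_fin addr_ge0 ?sqr_ge0|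
    by rewrite lee_fin exprn_ge0// mulr_ge0// ltW].
  rewrite [RHS]integral_mkcond; apply: eq_integral => x _; rewrite patchE indicE.
  by case: ifP => _; rewrite ?mul1e ?mul0e// EFinM.
rewrite integral_sqr_itv// -EFinM; congr (_%:E).
by rewrite [_ ^+ n.+1]exprS big_ord_recl /S; ring.
Qed.

End cube_moments.

(** * The Dirichlet problem: a Faber-Krahn type estimate *)

Section dirichlet.
Context {R : realType} {n : nat}.
Implicit Types (V : 'rV[R]_n -> R) (dV : 'I_n -> 'rV[R]_n -> R).

Lemma sub_cbox (r s : R) : r <= s -> cbox r `<=` (cbox s : set 'rV[R]_n).
Proof.
move=> rs x xr j; have := xr j; rewrite !in_itv/= => /andP[h1 h2].
by apply/andP; split; lra.
Qed.

Lemma nice_cbox (a : R) : nice (\1_(cbox a) : 'rV[R]_n -> R).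
Proof. by apply: nice_indic; [exact: measurable_cbox|exists a]. Qed.

Lemma J_cbox (a : R) : 0 <= a -> J (\1_(cbox a) : 'rV[R]_n -> R) = (2 * a) ^+ n.
Proof.
move=> a0; apply: EFin_inj; rewrite (JE (nice_cbox a)) integral_indic//.
  by rewrite setIT; exact: lebesgue_cbox.
exact: measurable_cbox.
Qed.

Lemma J_cbox_sqr (a : R) (g : 'I_n -> R) : 0 < a ->
  J (fun z : 'rV[R]_n => \1_(cbox a) z * (\sum_i z ord0 i * g i) ^+ 2) =
  (2 * a) ^+ n * (a ^+ 2 / 3 * \sum_i g i ^+ 2).
Proof.
move=> a0; apply: EFin_inj; rewrite JE; last first.
  apply: niceMl; first exact: nice_cbox.
  under eq_fun do rewrite expr2.
  by apply: lbmM; apply: lbm_sum => i; apply: lbmM; [exact: lbm_coord|exact: lbm_cst|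
    exact: lbm_coord|exact: lbm_cst].
have := integral_cube_sqr 0 g a0; rewrite expr0n/= add0r => <-.
by apply: eq_integral => z _; rewrite add0r.
Qed.

Lemma nice_bound (f : 'rV[R]_n -> R) : nice f -> exists r M : R, [/\ 0 <= r, 0 <= M,
  forall x, `|f x| <= M & forall x, ~ cbox r x -> f x = 0].
Proof. by move=> /niceP[]. Qed.

(** The correlations [G z = int V * V(. + z)] are large, since [l2_shift_le]
    bounds [|V(. + z) - V|], and small in the mean: their integral over the
    cube is at most [(int |V|)^2], which Cauchy-Schwarz bounds by
    [|A| * int V^2].  The factor [a^2 / 6] is half of the second moment
    [a^2 / 3] of a coordinate on the cube. *)
Lemma dirichlet_cube V dV (A : set 'rV[R]_n) (a r0 : R) :
  0 < a -> measurable A -> A `<=` cbox r0 ->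
  nice V -> (forall i, nice (dV i)) -> (forall x, ~ A x -> V x = 0) ->
  (forall x v, is_derive x v (V : 'rV[R]_n -> R^o) (\sum_i v ord0 i * dV i x)) ->
  J (fun x => V x ^+ 2) * ((2 * a) ^+ n - J \1_A) <=
  (2 * a) ^+ n * (a ^+ 2 / 6) * \sum_i J (fun x => dV i x ^+ 2).
Proof.
move=> a0 mA Ar nV ndV VA dVV.
have lV := nice_lbm nV.
have nA : nice (\1_A : 'rV[R]_n -> R) by apply: nice_indic => //; exists r0.
have nQ := nice_cbox a.
set Q : 'rV[R]_n -> R := \1_(cbox a) in nQ *.
have Q0 z : 0 <= Q z by rewrite /Q indicE ler0n.
have Q1 z : `|Q z| <= 1 by rewrite ger0_norm// /Q indicE; case: (_ \in _).
have Qa z : ~ cbox a z -> Q z = 0 by move=> za; rewrite /Q indicE memNset.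
have [r [M [rge0 M0 VM Vr]]] := nice_bound nV.
pose G z := J (fun x => V x * V (x + z)).
have nVV z : nice (fun x => V x * V (x + z)) := niceMl nV (lbm_shift z lV).
have nV2 := nice_sqr nV.
pose D (z x : 'rV[R]_n) := \sum_i z ord0 i * dV i x.
have nD z : nice (D z) by apply: nice_sum => i; exact: niceZ.
have GD z : J (fun x => V x ^+ 2) - 2^-1 * J (fun x => D z x ^+ 2) <= G z.
  have nsh := nice_shift z nV.
  have nd := nice_sqr (niceB nsh nV).
  have E : J (fun x => (V (x + z) - V x) ^+ 2) = 2 * J (fun x => V x ^+ 2) - 2 * G z.
    have -> : 2 * J (fun x => V x ^+ 2) - 2 * G z =
       (J (fun x => V (x + z) ^+ 2) + J (fun x => V x ^+ 2)) - 2 * G z.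
      by rewrite (J_shift z nV2); ring.
    rewrite -(JD (nice_sqr nsh) nV2) -(JZ 2 (nVV z)).
    rewrite -(JB (niceD (nice_sqr nsh) nV2) (niceZ 2 (nVV z))).
    by apply: eq_J => x; ring.
  have := l2_shift_le nV (nD z) (fun x => dVV x z); rewrite E; lra.
(* Fubini for [V x * Q z * V (x + z)]; it also gives the measurability of the
   correlation [G]. *)
pose F (p : 'rV[R]_n * 'rV[R]_n) := V p.1 * (Q p.2 * V (p.1 + p.2)).
have mF : measurable_fun setT F.
  apply: measurable_funM; first exact: measurableT_comp (nice_meas nV) measurable_fst.
  apply: measurable_funM; first exact: measurableT_comp (nice_meas nQ) measurable_snd.
  apply: measurableT_comp (nice_meas nV) _.
  apply: measurable_fun_rV => j; under eq_fun do rewrite !mxE.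
  apply: measurable_funD.
  - exact: (measurableT_comp (measurable_coord_rV j) measurable_fst).
  - exact: (measurableT_comp (measurable_coord_rV j) measurable_snd).
have mr0 : 0 <= Num.max r a by rewrite le_max rge0.
have Qm z : ~ cbox (Num.max r a) z -> Q z = 0.
  by move=> h; apply: Qa => /(@sub_cbox a (Num.max r a))-/(_ _)/h; apply; rewrite le_max lexx orbT.
have Vm x : ~ cbox (Num.max r a) x -> V x = 0.
  by move=> h; apply: Vr => /(@sub_cbox r (Num.max r a))-/(_ _)/h; apply; rewrite le_max lexx.
have FM p : `|F p| <= M * (1 * M) by rewrite /F !normrM ler_pM// ler_pM.
have F0 p : ~ (cbox (Num.max r a) p.1 /\ cbox (Num.max r a) p.2) -> F p = 0.
  by move=> /not_andP[/Vm|/Qm]; rewrite /F => ->; rewrite ?mul0r ?mulr0.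
have [m1 m2 E] := J_fubini mF mr0 FM F0.
have EG z : J (fun x => F (x, z)) = Q z * G z.
  by rewrite -(JZ _ (nVV z)); apply: eq_J => x; rewrite /F/=; ring.
have nG : nice (fun z => Q z * G z).
  apply/niceP; split; first by under eq_fun do rewrite -EG.
  exists a, (J (fun x => M * `|V x|)); split.
  - exact: ltW.
  - by apply: J_ge0 => x; rewrite mulr_ge0.
  - move=> z; have -> : J (fun x => M * `|V x|) = 1 * J (fun x => M * `|V x|) by rewrite mul1r.
    rewrite normrM ler_pM//; apply: le_trans (J_norm (nVV z)) _.
    apply: le_J => [||x]; [exact: nice_norm|exact/niceZ/nice_norm|].
    by rewrite normrM mulrC ler_wpM2r.
  - by move=> z /Qa ->; rewrite mul0r.
have up : J (fun z => Q z * G z) <= J \1_A * J (fun x => V x ^+ 2).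
  have JV : J (fun x => `|V x|) ^+ 2 <= J \1_A * J (fun x => V x ^+ 2).
    have := J_CS nA (nice_norm nV).
    rewrite (_ : J (fun x => \1_A x ^+ 2) = J \1_A); last first.
      by apply: eq_J => x; rewrite indicE; case: (_ \in _); rewrite ?expr1n ?expr0n.
    rewrite (_ : J (fun x => \1_A x * `|V x|) = J (fun x => `|V x|)); last first.
      apply: eq_J => x; rewrite indicE; case: (pselect (A x)) => [/mem_set ->|Ax].
        by rewrite mul1r.
      by rewrite VA// normr0 mulr0.
    rewrite (_ : J (fun x => `|V x| ^+ 2) = J (fun x => V x ^+ 2))//.
    by apply: eq_J => x; rewrite real_normK ?num_real.
  apply: le_trans JV; rewrite expr2 -(JZ _ (nice_norm nV)).
  have -> : J (fun z => Q z * G z) = J (fun x => J (fun z => F (x, z))).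
    by rewrite E; apply: eq_J => z; rewrite EG.
  have nin x : nice (fun z => Q z * V (x + z)).
    apply: niceMl => //; rewrite (_ : (fun z => V (x + z)) = fun z => V (z + x)).
      exact: lbm_shift.
    by apply/funext => z; rewrite addrC.
  have bnd x : `|J (fun z => Q z * V (x + z))| <= J (fun y => `|V y|).
    apply: le_trans (J_norm (nin x)) _.
    rewrite -(J_shift x (nice_norm nV)).
    apply: le_J => [||z]; [exact: nice_norm|exact: (nice_shift x (nice_norm nV))|].
    by rewrite normrM [x + z]addrC -[leRHS]mul1r ler_wpM2r.
  have EV x : J (fun z => F (x, z)) = V x * J (fun z => Q z * V (x + z)).
    exact: (JZ (V x) (nin x)).
  have nEV : nice (fun x => J (fun z => F (x, z))).
    apply/niceP; split=> //; exists r, (M * J (fun y => `|V y|)); split=> //.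
    - by rewrite mulr_ge0//; apply: J_ge0.
    - by move=> x; rewrite EV normrM ler_pM.
    - by move=> x /Vr h; rewrite EV h mul0r.
  apply: le_J => // [|x]; first exact/niceZ/nice_norm.
  rewrite EV; apply: le_trans (ler_norm _) _.
  by rewrite normrM mulrC ler_wpM2r.
pose h x := \sum_i `|dV i x|.
have nh : nice h by apply: nice_sum => i; exact: nice_norm.
have [s [N [s0 N0 hN hs]]] := nice_bound nh.
have Dh z x : cbox a z -> `|D z x| <= a * h x.
  move=> za; rewrite /D /h mulr_sumr; apply: le_trans (ler_norm_sum _ _ _) _.
  apply: ler_sum => i _; rewrite normrM ler_wpM2r//.
  by move: (za i); rewrite /= in_itv/= ler_norml.
(* Fubini for [Q z * (z . D V x)^2]: for fixed [x] the average over [z] is a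
   second moment of the cube. *)
pose F2 (p : 'rV[R]_n * 'rV[R]_n) := Q p.2 * D p.2 p.1 ^+ 2.
have mF2 : measurable_fun setT F2.
  apply: measurable_funM; first exact: measurableT_comp (nice_meas nQ) measurable_snd.
  apply: measurable_funX; apply: measurable_sum => i; apply: measurable_funM.
    exact: (measurableT_comp (measurable_coord_rV i) measurable_snd).
  exact: measurableT_comp (nice_meas (ndV i)) measurable_fst.
have h0 x : 0 <= h x by apply: sumr_ge0 => i _.
have F2M p : `|F2 p| <= (a * N) ^+ 2.
  rewrite /F2; have [pa|/Qa ->] := pselect (cbox a p.2); last first.
    by rewrite mul0r normr0 sqr_ge0.
  rewrite normrM -[leRHS]mul1r ler_pM// normrX lerXn2r ?nnegrE ?mulr_ge0 ?(ltW a0)//.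
  apply: le_trans (Dh _ _ pa) _; rewrite ler_wpM2l ?(ltW a0)//.
  exact: le_trans (ler_norm _) (hN _).
have sa0 : 0 <= Num.max s a by rewrite le_max s0.
have F20 p : ~ (cbox (Num.max s a) p.1 /\ cbox (Num.max s a) p.2) -> F2 p = 0.
  rewrite /F2; have [pa|/Qa ->] := pselect (cbox a p.2); last by rewrite mul0r.
  move=> /not_andP[p1|]; last first.
    by move=> p2; exfalso; apply: p2; apply: sub_cbox pa; rewrite le_max lexx orbT.
  have hp : h p.1 = 0.
    by apply: hs => ps; apply: p1; apply: sub_cbox ps; rewrite le_max lexx.
  have := Dh _ p.1 pa; rewrite hp mulr0 normr_le0 => /eqP ->.
  by rewrite expr0n mulr0.
have [m3 m4 E2] := J_fubini mF2 sa0 F2M F20.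
have ED z : J (fun x => F2 (x, z)) = Q z * J (fun x => D z x ^+ 2).
  exact: (JZ (Q z) (nice_sqr (nD z))).
have nQD : nice (fun z => Q z * J (fun x => D z x ^+ 2)).
  apply/niceP; split; first by under eq_fun do rewrite -ED.
  exists a, (J (fun x => (a * h x) ^+ 2)); split.
  - exact: ltW.
  - by apply: J_ge0 => x; rewrite sqr_ge0.
  - move=> z; have [za|/Qa ->] := pselect (cbox a z); last first.
      by rewrite mul0r normr0; apply: J_ge0 => x; rewrite sqr_ge0.
    rewrite normrM -[leRHS]mul1r ler_pM// ger0_norm; last by apply: J_ge0 => x; rewrite sqr_ge0.
    apply: le_J => [||x]; [exact: nice_sqr|exact/nice_sqr/niceZ|].
    by rewrite -real_normK ?num_real// lerXn2r ?nnegrE ?mulr_ge0 ?(ltW a0)//; exact: Dh.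
  - by move=> z /Qa ->; rewrite mul0r.
have grad_avg : J (fun z => Q z * J (fun x => D z x ^+ 2)) =
    (2 * a) ^+ n * (a ^+ 2 / 3) * \sum_i J (fun x => dV i x ^+ 2).
  rewrite (_ : J _ = J (fun x => J (fun z => F2 (x, z)))); last first.
    by rewrite E2; apply: eq_J => z; rewrite ED.
  rewrite -J_sum; last by move=> i; exact: nice_sqr.
  rewrite -JZ; last by apply: nice_sum => i; exact: nice_sqr.
  by apply: eq_J => x; rewrite /F2/= /D J_cbox_sqr// mulrA.
have key : J (fun z => Q z * (J (fun x => V x ^+ 2) - 2^-1 * J (fun x => D z x ^+ 2)))
    <= J (fun z => Q z * G z).
  apply: le_J => // [|z]; last by rewrite ler_wpM2l.
  rewrite (_ : (fun z => _) = fun z => J (fun x => V x ^+ 2) * Q z -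
     2^-1 * (Q z * J (fun x => D z x ^+ 2))).
    by apply: niceB; apply: niceZ.
  by apply/funext => z; ring.
have keyE : J (fun z => Q z * (J (fun x => V x ^+ 2) - 2^-1 * J (fun x => D z x ^+ 2))) =
   J (fun x => V x ^+ 2) * (2 * a) ^+ n - 2^-1 *
   ((2 * a) ^+ n * (a ^+ 2 / 3) * \sum_i J (fun x => dV i x ^+ 2)).
  rewrite -grad_avg -(J_cbox (ltW a0)) -/Q -(JZ _ nQ) -(JZ _ nQD).
  rewrite -(JB (niceZ _ nQ) (niceZ _ nQD)).
  by apply: eq_J => z; ring.
rewrite keyE in key.
have := le_trans key up; rewrite mulrBr => k2.
set S := \sum_i _ in k2 *; set W := J _ in k2 *; set B := J \1_A in k2 *.
have -> : (2 * a) ^+ n * (a ^+ 2 / 6) * S = 2^-1 * ((2 * a) ^+ n * (a ^+ 2 / 3) * S) by field.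
by rewrite lerBlDr addrC -lerBlDr [W * B]mulrC.
Qed.

End dirichlet.

(** * Maximum entropy and volume *)

Section gaussian_volume.
Context {R : realType}.

(** From [exp (- 1 / 6) >= 5 / 6], to the power 6. *)
Lemma expR1_lt3 : expR 1 < 3 :> R.
Proof.
have h : expR (1 / 6) <= 6 / 5 :> R.
  have := @expR_ge1Dx R (- (1 / 6)); rewrite expRN => h.
  have e0 := expR_gt0 (1 / 6 : R).
  have h5 : 5 / 6 <= (expR (1 / 6) : R)^-1 by apply: le_trans h; lra.
  have : (expR (1 / 6) : R)^-1^-1 <= (5 / 6)^-1 by rewrite lef_pV2// posrE ?invr_gt0//; lra.
  by rewrite invrK; lra.
have -> : expR 1 = expR (1 / 6) ^+ 6 :> R.
  by rewrite -expRM_natl; congr expR; field.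
apply: (@le_lt_trans _ _ ((6 / 5) ^+ 6)); last by lra.
by rewrite lerXn2r// nnegrE ?expR_ge0//; lra.
Qed.

Context {n : nat}.

(** Maximum entropy of the Gaussian, in the form of Jensen's inequality: the
    product density with means [m i] and variance [s ^ 2] has total mass 1, its
    mean over [A] is at least the exponential of the mean of its logarithm, and
    that logarithm is controlled by the second moments. *)
Lemma gaussian_volume_le (A : set 'rV[R]_n) (m : 'I_n -> R) (s r : R) :
  0 < s -> measurable A -> A `<=` cbox r ->
  J (fun x : 'rV[R]_n => \1_A x * \sum_i (x ord0 i - m i) ^+ 2) <= n%:R * s ^+ 2 * J \1_A ->
  J \1_A <= (Num.sqrt (s ^+ 2 * pi *+ 2) * expR 2^-1) ^+ n.
Proof.
move=> s0 mA Ar hm.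
have nA : nice (\1_A : 'rV[R]_n -> R) by apply: nice_indic => //; exists r.
have sn0 : s != 0 by rewrite gt_eqF.
pose q : R := Num.sqrt (s ^+ 2 * pi *+ 2).
have q0 : 0 < q by rewrite sqrtr_gt0 pmulrn_lgt0// mulr_gt0 ?pi_gt0// exprn_gt0.
pose g (i : 'I_n) := normal_pdf (m i) s.
have gE (x : 'rV[R]_n) : \prod_i g i (x ord0 i) =
    q ^- n * expR (- (\sum_i (x ord0 i - m i) ^+ 2) / (2 * s ^+ 2)).
  rewrite (eq_bigr (fun i => q^-1 * expR (- (x ord0 i - m i) ^+ 2 / (2 * s ^+ 2)))); last first.
    by move=> i _; rewrite /g normal_pdfE// /normal_peak /normal_fun mulr_natl.
  rewrite big_split/= prodr_const card_ord exprVn; congr (_ * _).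
  by rewrite -expR_sum -mulr_suml sumrN.
have prod1 : (\int[lebesgue_rV n]_x (\prod_i g i (x ord0 i))%:E = 1)%E.
  rewrite ge0_integral_prod_rV; first last.
  - by move=> i x; exact: normal_pdf_ge0.
  - by move=> i; exact: measurable_normal_pdf.
  by rewrite big1// => i _; exact: integral_normal_pdf.
have mg : measurable_fun setT (fun x : 'rV[R]_n => \prod_i g i (x ord0 i)).
  apply: measurable_prod => i _.
  exact: measurableT_comp (measurable_normal_pdf (m i) s) (measurable_coord_rV i).
pose S (x : 'rV[R]_n) := \sum_i (x ord0 i - m i) ^+ 2.
have lS : lbm S.
  apply: lbm_sum => i; under eq_fun do rewrite expr2.
  by apply: lbmM; apply: lbmB; [exact: lbm_coord|exact: lbm_cst|exact: lbm_coord|exact: lbm_cst].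
pose c := q ^- n * expR (- (n%:R / 2)).
have c0 : 0 < c by rewrite mulr_gt0 ?expR_gt0// invr_gt0 exprn_gt0.
have s2 : 0 < 2 * s ^+ 2 by rewrite mulr_gt0// exprn_gt0.
(* Jensen's inequality with an explicit tangent: the exponential is compared
   with its tangent at [- n / 2], the mean of the logarithm of [g / q ^- n] in
   the extreme case of variance [s ^ 2]. *)
have tangent x : c * (1 + n%:R / 2) - c / (2 * s ^+ 2) * S x <= \prod_i g i (x ord0 i).
  rewrite gE -/(S x).
  have -> : - S x / (2 * s ^+ 2) = - (n%:R / 2) + (n%:R / 2 - S x / (2 * s ^+ 2)).
    by rewrite mulNr; ring.
  rewrite expRD [leRHS]mulrA -/c.
  have := expR_ge1Dx (n%:R / 2 - S x / (2 * s ^+ 2)) => h.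
  apply: le_trans (ler_wpM2l (ltW c0) h).
  by rewrite le_eqVlt; apply/orP; left; apply/eqP; ring.
have nL : nice (fun x => c * (1 + n%:R / 2) * \1_A x - c / (2 * s ^+ 2) * (\1_A x * S x)).
  by apply: niceB; apply: niceZ => //; exact: niceMl.
have up : J (fun x => c * (1 + n%:R / 2) * \1_A x - c / (2 * s ^+ 2) * (\1_A x * S x)) <= 1.
  rewrite -lee_fin (JE nL) -prod1.
  have g0 (x : 'rV[R]_n) : 0 <= \prod_i g i (x ord0 i).
    by apply: prodr_ge0 => i _; exact: normal_pdf_ge0.
  apply: le_integral => //.
  - exact: nice_integrable.
  - apply/integrableP; split; first exact/measurable_EFinP.
    rewrite (_ : (fun x => _) = fun x : 'rV[R]_n => (\prod_i g i (x ord0 i))%:E).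
      by rewrite prod1 ltry.
    by apply/funext => x; rewrite /= ger0_norm.
  - move=> x _; rewrite lee_fin indicE; case: (x \in A).
      by rewrite mulr1 mul1r; exact: tangent.
    by rewrite !(mulr0, mul0r) subr0.
move: up; rewrite JB; [|exact: niceZ|by apply: niceZ; exact: niceMl].
rewrite (JZ _ nA) (JZ _ (niceMl nA lS)) => up.
have cJ : c * J \1_A <= 1.
  apply: le_trans up.
  have h : c / (2 * s ^+ 2) * J (fun x => \1_A x * S x) <=
      c / (2 * s ^+ 2) * (n%:R * s ^+ 2 * J \1_A).
    by rewrite ler_wpM2l// divr_ge0 ?ltW.
  have -> : c * J \1_A = c * (1 + n%:R / 2) * J \1_A -
     c / (2 * s ^+ 2) * (n%:R * s ^+ 2 * J \1_A) by field.
  by rewrite lerD2l lerN2.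
have -> : (q * expR 2^-1) ^+ n = c^-1.
  rewrite /c invfM invrK exprMn expRN invrK; congr (_ * _).
  by rewrite -expRM_natl.
by rewrite -[c^-1]mul1r ler_pdivlMr// mulrC.
Qed.

End gaussian_volume.

(** * Differentiation under the integral *)

Section directional.
Context {R : realType} {n : nat}.
Implicit Types (f : 'rV[R]_n -> R) (x v : 'rV[R]_n).

(** Directional derivatives are derivatives of functions of one real variable,
    for which the chain rule is available. *)
Lemma is_derive_lineP f x v (d : R) :
  is_derive x v (f : 'rV[R]_n -> R^o) d <->
  is_derive (0 : R) 1 (fun h : R => (f (h *: v + x) : R^o)) d.
Proof.
have E : (fun h : R => h^-1 *: (((fun s : R => (f (s *: v + x) : R^o)) \o shift 0) (h *: 1)
   - f (0 *: v + x)))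
  = (fun h : R => h^-1 *: ((f \o shift x) (h *: v) - f x)).
  by apply/funext => h /=; rewrite [_%:A]mulr1 addr0 scale0r add0r.
split=> -[df Df].
  by split; [rewrite /derivable E|rewrite -Df /derive E].
by split; [move: df; rewrite /derivable E|rewrite -Df /derive E].
Qed.

Lemma is_derive_comp1 (F : R -> R) f x v (d e : R) :
  is_derive (f x) 1 (F : R -> R^o) e -> is_derive x v (f : 'rV[R]_n -> R^o) d ->
  is_derive x v ((fun y => F (f y)) : 'rV[R]_n -> R^o) (e * d).
Proof.
move=> dF /is_derive_lineP df; apply/is_derive_lineP.
apply: (@is_derive1_comp R F (fun h => f (h *: v + x))).
by rewrite scale0r add0r.
Qed.

Lemma is_derive_shift_rV f x v y (d : R) :
  is_derive (x - y) v (f : 'rV[R]_n -> R^o) d ->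
  is_derive x v ((fun z => f (z - y)) : 'rV[R]_n -> R^o) d.
Proof.
move=> [df Df].
have E : (fun h : R => h^-1 *: (((fun z => f (z - y) : R^o) \o shift x) (h *: v) - f (x - y)))
  = (fun h : R => h^-1 *: ((f \o shift (x - y)) (h *: v) - f (x - y))).
  by apply/funext => h /=; rewrite addrA.
by split; [rewrite /derivable E|rewrite -Df /derive E].
Qed.

Lemma is_derive_refl_rV f x v y (d : R) :
  is_derive (x - y) (- v) (f : 'rV[R]_n -> R^o) d ->
  is_derive y v ((fun z => f (x - z)) : 'rV[R]_n -> R^o) d.
Proof.
move=> [df Df].
have E : (fun h : R => h^-1 *: (((fun z => f (x - z) : R^o) \o shift y) (h *: v) - f (x - y)))
  = (fun h : R => h^-1 *: ((f \o shift (x - y)) (h *: (- v)) - f (x - y))).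
  by apply/funext => h /=; rewrite scalerN opprD addrCA.
by split; [rewrite /derivable E|rewrite -Df /derive E].
Qed.

Lemma is_derive_coord x v j :
  is_derive x v ((fun y => y ord0 j) : 'rV[R]_n -> R^o) (v ord0 j).
Proof.
apply/is_derive_lineP.
rewrite (_ : (fun h : R => _) = (fun h : R => (h * v ord0 j + x ord0 j : R^o))); last first.
  by apply/funext => h; rewrite !mxE.
by apply: is_derive_eq; rewrite /GRing.scale/= mulr1 addr0 mul0r add0r.
Qed.

(** By translation invariance every difference quotient of [f] has integral 0. *)
Lemma J_derive0 f (D : 'rV[R]_n -> R) v : nice f -> nice D ->
  (forall x, is_derive x v (f : 'rV[R]_n -> R^o) (D x)) -> J D = 0.
Proof.
move=> nf nD dV.
rewrite -(cvg_lim _ (J_cvg_quotient (m := 0) nf nD dV))//.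
rewrite (_ : (fun k => _) = cst 0) ?lim_cst//.
apply/funext => k.
rewrite (_ : J _ = (2 ^- k)^-1 * J (fun x => f (x + 2 ^- k *: v) - f x)); last first.
  rewrite -JZ; last exact: niceB (nice_shift _ nf) nf.
  by apply: eq_J => x; rewrite mulrC.
by rewrite JB ?(J_shift _ nf) ?subrr ?mulr0//; exact: nice_shift.
Qed.

Lemma J_by_parts f g (df dg : 'rV[R]_n -> R) v :
  lbm f -> lbm df -> nice g -> nice dg ->
  (forall x, is_derive x v (f : 'rV[R]_n -> R^o) (df x)) ->
  (forall x, is_derive x v (g : 'rV[R]_n -> R^o) (dg x)) ->
  J (fun x => df x * g x) = - J (fun x => f x * dg x).
Proof.
move=> lf ldf ng ndg Df Dg.
have n1 := niceMr ldf ng; have n2 := niceMr lf ndg.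
apply/eqP; rewrite -addr_eq0 -(JD n1 n2); apply/eqP.
apply: (@J_derive0 (fun x => f x * g x) _ v); [exact: niceMr|exact: niceD|move=> x].
have h := @is_deriveM R 'rV[R]_n f g x v (df x) (dg x) (Df x) (Dg x).
have E : f x *: (dg x : R^o) + g x *: (df x : R^o) = df x * g x + f x * dg x.
  by rewrite /GRing.scale/= addrC [g x * _]mulrC.
by rewrite -E; exact: h.
Qed.

Lemma is_derive_conv g K (K' : 'rV[R]_n -> R) v : nice g -> lbm K -> lbm K' ->
  (forall x, is_derive x v (K : 'rV[R]_n -> R^o) (K' x)) ->
  forall x, is_derive x v (conv g K : 'rV[R]_n -> R^o) (conv g K' x).
Proof.
move=> ng lK lK' dK x.
have [r [M [r0 M0 gM gr]]] := nice_bound ng.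
have [C CK] := lK'.2 (`|x| + `|v| + r).
pose f (t : R) (y : 'rV[R]_n) := g y * K (t *: v + x - y).
have df (t : R) y : is_derive t 1 (fun s : R => (f s y : R^o)) (g y * K' (t *: v + x - y)).
  have h : is_derive t 1 (fun s : R => (K (x - y + s *: v) : R^o)) (K' (x - y + t *: v)).
    by apply: is_derive_line; exact: dK.
  rewrite (_ : (fun s : R => (f s y : R^o)) = g y \*: (fun s : R => (K (x - y + s *: v) : R^o))); last first.
    by apply/funext => s; rewrite /f/= [s *: v + x]addrC addrAC.
  apply: is_derive_eq; rewrite /GRing.scale/=; congr (_ * K' _).
  by rewrite [t *: v + x]addrC addrAC.
have d1 t y : partial1of2 f t y = g y * K' (t *: v + x - y).
  by rewrite partial1of2E; have [_ ->] := df t y.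
pose G y := `|g y| * Num.max C 0.
have nG : nice G by apply: niceMl; [exact: nice_norm|exact: lbm_cst].
have I0 : (0 : R) \in `](-1), 1[ by rewrite in_itv/= ltrN10 ltr01.
have := @cvg_differentiation_under_integral R _ _ (lebesgue_rV n) f setT measurableT
  0 (-1) 1 I0 _ _ G _ (nice_integrable nG) _.
have -> : (fun h : R => h^-1 *: (\int[lebesgue_rV n]_y f (h + 0) y - \int[lebesgue_rV n]_y f 0 y)) =
   (fun h : R => h^-1 *: ((conv g K \o shift x) (h *: v) - conv g K x)).
  apply/funext => h; rewrite /conv /= !JdefE addr0; congr (_ *: (_ - _)).
  by apply: eq_Rintegral => y _; rewrite /f scale0r add0r.
have -> : \int[lebesgue_rV n]_y partial1of2 f 0 y = conv g K' x.
  rewrite /conv JdefE; apply: eq_Rintegral => y _.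
  by rewrite d1 scale0r add0r.
move=> cv.
have {}cv : h^-1 *: ((conv g K \o shift x) (h *: v) - conv g K x) @[h --> 0^'] --> conv g K' x.
  apply: cv.
  - by move=> t _; apply: nice_integrable; exact: nice_conv_in.
  - by move=> t y _ _; have [] := df t y.
  - by move=> y; rewrite /G mulr_ge0// le_max lexx orbT.
  - move=> t y; rewrite /= in_itv/= => /andP[t1 t2] _; rewrite d1 normrM /G.
    have [yr|/gr ->] := pselect (cbox r y); last by rewrite normr0 !mul0r.
    rewrite ler_wpM2l// le_max CK//.
    apply: le_trans (ler_normB _ _) _; apply: lerD; last exact/(cboxE y r0).
    rewrite addrC; apply: le_trans (ler_normD _ _) _; apply: lerD => //.
    rewrite normrZ ler_piMl// ler_norml; lra.
split; first by apply/cvg_ex; exists (conv g K' x).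
by apply: cvg_lim.
Qed.

End directional.

(** * Radial profiles *)

Section glue.
Context {R : realType}.
Variable b : R.
Implicit Types p f : R -> R.

(** A profile given by a power of [t] for [t > b] is continued to [t <= b] by
    its Taylor polynomial at [b], which removes the singularity at 0. *)
Definition glue p f (t : R) := if t <= b then p t else f t.

Lemma is_derive_glue p f p' f' :
  (forall t : R, is_derive t 1 (p : R -> R^o) (p' t)) ->
  (forall t : R, b <= t -> is_derive t 1 (f : R -> R^o) (f' t)) ->
  p b = f b -> p' b = f' b ->
  forall t : R, is_derive t 1 (glue p f : R -> R^o) (glue p' f' t).
Proof.
move=> dp df pf pf' t; rewrite {2}/glue; have [tb|tb|->] := ltgtP t b.
- apply: (@near_eq_is_derive R R^o R^o p).
  near=> s; rewrite /glue ifT//; apply: ltW; near: s; exact: lt_nbhsl.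
- have h := df _ (ltW tb); apply: (@near_eq_is_derive R R^o R^o f _ _ _ _ _ h).
  near=> s; rewrite /glue ifF//; apply/negbTE; rewrite -ltNge -ltrN2; near: s; apply: Nlt_nbhsl; by rewrite ltrN2.
- pose Q (g : R -> R) (h : R) := h^-1 *: (((g : R -> R^o) \o shift b) (h *: (1 : R^o)) - g b).
  have cp : Q p h @[h --> 0^'] --> p' b by have [+ <-] := dp b.
  have cf : Q f h @[h --> 0^'] --> p' b by rewrite pf'; have [+ <-] := df b (lexx b).
  have cg : Q (glue p f) h @[h --> 0^'] --> p' b.
    apply: (@cvg_at_right_left_dnbhs R R^o).
    - have := cvg_dnbhs_at_right cf; apply: cvg_trans; apply: near_eq_cvg.
      near=> e; rewrite /Q /= /glue lexx pf [e%:A]mulr1 ifF//.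
      apply/negbTE; rewrite -ltNge ltrDr; near: e; exact: nbhs_right_gt.
    - have := cvg_dnbhs_at_left cp; apply: cvg_trans; apply: near_eq_cvg.
      near=> e; rewrite /Q /= /glue lexx [e%:A]mulr1 ifT//.
      rewrite gerDr; apply: ltW; near: e; exact: nbhs_left_lt.
  split; first by apply/cvg_ex; exists (p' b).
  exact: cvg_lim cg.
Unshelve. all: end_near. Qed.

Lemma continuous_glue p f : continuous p ->
  (forall t : R, b <= t -> {for t, continuous f}) -> p b = f b -> continuous (glue p f).
Proof.
move=> cp cf pf t; rewrite /continuous_at; have [tb|tb|->] := ltgtP t b.
- rewrite {2}/glue (ltW tb); apply: cvg_trans (cp t); apply: near_eq_cvg.
  near=> s; rewrite /glue ifT//; apply: ltW; near: s; exact: lt_nbhsl.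
- rewrite {2}/glue leNgt tb/=; apply: cvg_trans (cf t (ltW tb)); apply: near_eq_cvg.
  near=> s; rewrite /glue ifF//; apply/negbTE; rewrite -ltNge -ltrN2; near: s; apply: Nlt_nbhsl; by rewrite ltrN2.
- rewrite {2}/glue lexx; apply/cvgrPdist_le => e e0.
  have c1 := cp b; have c2 : f s @[s --> b] --> p b by rewrite pf; exact: (cf b (lexx b)).
  near=> s; rewrite /glue; case: ifP => _; near: s.
    by move: c1 => /cvgrPdist_le; apply.
  by move: c2 => /cvgrPdist_le; apply.
Unshelve. all: end_near. Qed.

End glue.

Section radial_profile.
Context {R : realType}.
Variables (m b : R).
Hypothesis b0 : 0 < b.

Lemma is_derive_cpowR (c a t : R) : 0 < t ->
  is_derive t 1 (fun s : R => (c * s `^ a : R^o)) (c * a * t `^ (a - 1)).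
Proof.
move=> t0; have h := is_derive1_powR a t0.
by apply: is_derive_eq; rewrite /GRing.scale/= mulrA.
Qed.

(** The case [a = -1] is the logarithm, that is, the Newton kernel of the
    plane. *)
Lemma primitive_powR (a : R) : exists G : R -> R,
  forall t : R, 0 < t -> is_derive t 1 (G : R -> R^o) (t `^ a).
Proof.
have [->|a1] := eqVneq a (-1).
  exists (@ln R) => t t0; have h := is_derive1_ln t0.
  by apply: (is_derive_eq h); rewrite powR_inv1// ltW.
exists (fun t => (a + 1)^-1 * t `^ (a + 1)) => t t0.
have h := is_derive_cpowR (a + 1)^-1 (a + 1) t0.
have a10 : a + 1 != 0 by rewrite -[1]opprK subr_eq0.
by apply: (is_derive_eq h); rewrite mulVf// mul1r addrK.
Qed.

Let c1 := - b `^ (- m).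
Let c2 := m * b `^ (- m - 1).
Let c3 := - (m * (m + 1) * b `^ (- m - 2)).

(** With [q] the squared radius, the Newton kernel in dimension [2 * m] is, up
    to a constant, a function [F] of [q] with derivative [- q `^ (- m)]. The
    functions [prof1], [prof2], [prof3] are the derivatives of order 1, 2, 3
    of its continuation to [q <= b] by a cubic polynomial; [prof3] is still
    continuous. Prescribing the derivative rather than [F] treats the
    logarithmic case [m = 1] like the others. *)
Definition prof1 := glue b
  (fun t : R => c1 + c2 * (t - b) + c3 / 2 * (t - b) ^+ 2) (fun t => - 1 * t `^ (- m)).
Definition prof2 := glue b (fun t : R => c2 + c3 * (t - b)) (fun t => m * t `^ (- m - 1)).
Definition prof3 := glue b (fun t : R => c3) (fun t => - (m * (m + 1)) * t `^ (- m - 2)).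

Lemma is_derive_prof1 (t : R) : is_derive t 1 (prof1 : R -> R^o) (prof2 t).
Proof.
apply: is_derive_glue => {t} [t|t bt| |].
- by apply: is_derive_eq; rewrite /GRing.scale/=; field.
- have h := is_derive_cpowR (-1) (- m) (lt_le_trans b0 bt).
  by apply: (is_derive_eq h); rewrite mulN1r opprK.
- by rewrite subrr expr0n/= !mulr0 !addr0 mulN1r.
- by rewrite subrr mulr0 addr0.
Qed.

Lemma is_derive_prof2 (t : R) : is_derive t 1 (prof2 : R -> R^o) (prof3 t).
Proof.
apply: is_derive_glue => {t} [t|t bt| |].
- by apply: is_derive_eq; rewrite /GRing.scale/=; ring.
- have h := is_derive_cpowR m (- m - 1) (lt_le_trans b0 bt).
  apply: (is_derive_eq h); congr (_ * _ `^ _); ring.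
- by rewrite subrr mulr0 addr0.
- by rewrite /c3 mulNr.
Qed.

Lemma prof_primitive : exists F : R -> R,
  [/\ forall t : R, is_derive t 1 (F : R -> R^o) (prof1 t) &
   exists G : R -> R, (forall t : R, 0 < t -> is_derive t 1 (G : R -> R^o) (- 1 * t `^ (- m))) /\
     forall t : R, b < t -> F t = G t].
Proof.
have [G0 dG0] := primitive_powR (- m).
pose G t := - 1 * G0 t.
have dG (t : R) : 0 < t -> is_derive t 1 (G : R -> R^o) (- 1 * t `^ (- m)).
  by move=> t0; have h := dG0 t t0; apply: is_derive_eq.
exists (glue b (fun t : R => G b + c1 * (t - b) + c2 / 2 * (t - b) ^+ 2 + c3 / 6 * (t - b) ^+ 3) G).
split; last first.
  by exists G; split=> // t tb; rewrite /glue leNgt tb.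
apply: is_derive_glue => [t|t bt| |].
- by apply: is_derive_eq; rewrite /GRing.scale/=; field.
- exact: dG (lt_le_trans b0 bt).
- by rewrite subrr !expr0n/= !mulr0 !addr0.
- by rewrite subrr expr0n/= !mulr0 !addr0 mulN1r.
Qed.

Lemma derive_continuous (f f' : R -> R) :
  (forall t : R, is_derive t 1 (f : R -> R^o) (f' t)) -> continuous f.
Proof.
by move=> df t; apply: differentiable_continuous; apply/derivable1_diffP; have [] := df t.
Qed.

Lemma continuous_prof3 : continuous prof3.
Proof.
apply: continuous_glue => [t|t bt|]; [exact: cvg_cst| |by rewrite /c3 mulNr].
apply: differentiable_continuous; apply/derivable1_diffP.
by have [] := is_derive_cpowR (- (m * (m + 1))) (- m - 2) (lt_le_trans b0 bt).
Qed.

(** Minus the Laplacian of the radial function with derivative profile [prof1]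
    in dimension [2 * m], as a function of the squared radius. *)
Definition profk (t : R) := - (4 * m * prof1 t + 4 * t * prof2 t).

(** Outside [q <= b] this is the harmonicity of the Newton kernel; inside, the
    cubic continuation happens to have a Laplacian which is a square, so the
    mollifier is nonnegative. *)
Lemma profkE (t : R) : profk t = if t <= b then
  2 * m * (m + 1) * (m + 2) * b `^ (- m) * (1 - t / b) ^+ 2 else 0.
Proof.
have bE (a : R) : b `^ (a - 1) = b `^ a / b.
  by rewrite powRD ?powR_inv1 ?ltW//; apply/implyP => _; rewrite gt_eqF.
have bE2 : b `^ (- m - 2) = b `^ (- m) / b / b.
  by rewrite -!bE; congr (_ `^ _); ring.
rewrite /profk /prof1 /prof2 /glue; case: ifPn => tb.
  by rewrite /c1 /c2 /c3 bE2 bE; field; rewrite gt_eqF.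
have t0 : 0 < t by apply: lt_trans b0 _; rewrite ltNge.
have -> : t `^ (- m - 1) = t `^ (- m) / t.
  by rewrite powRD ?powR_inv1 ?ltW//; apply/implyP => _; rewrite gt_eqF.
by field; rewrite gt_eqF.
Qed.

Lemma is_derive_profk (t : R) : is_derive t 1 (profk : R -> R^o)
  (- ((4 * m + 4) * prof2 t + 4 * t * prof3 t)).
Proof.
have h1 := is_derive_prof1 t; have h2 := is_derive_prof2 t.
apply: is_derive_eq; rewrite /GRing.scale/=; ring.
Qed.

End radial_profile.

(** * Smoothness and gradients *)

Lemma is_derive_continuous1 {R : realType} (f : R -> R) (t d : R) :
  is_derive t 1 (f : R -> R^o) d -> f @ t --> f t.
Proof.
by move=> [df _]; apply: differentiable_continuous; apply/derivable1_diffP.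
Qed.

Section smooth_class.
Context {R : realType} {n : nat}.
Implicit Types (f g : 'rV[R]_n -> R) (x v : 'rV[R]_n).

Notation e_ i := (delta_mx ord0 i : 'rV[R]_n).

(** Smoothness of all orders by one induction: it suffices to find a class of
    continuous functions stable under partial derivatives. *)
Lemma smooth_in_class (U : set 'rV[R]_n) (C : ('rV[R]_n -> R) -> Prop) : open U ->
  (forall f, C f -> forall x, U x -> {for x, continuous f}) ->
  (forall f, C f -> forall i, exists g, C g /\
     forall x, U x -> is_derive x (e_ i) (f : 'rV[R]_n -> R^o) (g x)) ->
  forall f, C f -> smooth_in U f.
Proof.
move=> oU cC dC f Cf s.
suff [g [Cg gE]] : exists g, C g /\ forall x, U x -> iter_partial s f x = g x.
  move=> x Ux; have nE : \forall y \near x, g y = iter_partial s f y.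
    by near=> y; rewrite gE//; near: y; exact: open_nbhs_nbhs.
  split.
    suff : iter_partial s f y @[y --> x] --> g x.
      by move=> h; rewrite -(gE x Ux) in h; exact: h.
    by apply: cvg_trans (cC _ Cg _ Ux); exact: (near_eq_cvg nE).
  move=> i; have [h [_ dg]] := dC _ Cg i.
  apply: (@near_eq_derivable R 'rV[R]_n R^o g) => //.
  by have [] := dg x Ux.
elim: s => [|i s [g [Cg gE]]]; first by exists f.
have [h [Ch dg]] := dC _ Cg i; exists h; split=> // x Ux /=.
rewrite /partial (@near_eq_derive R 'rV[R]_n R^o _ g).
  by have [_ ->] := dg x Ux.
by near=> y; rewrite gE//; near: y; exact: open_nbhs_nbhs.
Unshelve. all: end_near. Qed.

Lemma smooth_in_eq (U : set 'rV[R]_n) f g : open U ->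
  (forall x, U x -> f x = g x) -> smooth_in U g -> smooth_in U f.
Proof.
move=> oU fg sg s.
have E t : forall x, U x -> iter_partial t g x = iter_partial t f x.
  elim: t => [|i t IH] x Ux /=; first by rewrite fg.
  apply: (@near_eq_derive R 'rV[R]_n R^o).
  by near=> y; apply: IH; near: y; exact: open_nbhs_nbhs.
move=> x Ux; have [cg dg] := sg s x Ux.
have nE : \forall y \near x, iter_partial s g y = iter_partial s f y.
  by near=> y; apply: E; near: y; exact: open_nbhs_nbhs.
split=> [|i]; last exact: (@near_eq_derivable R 'rV[R]_n R^o (iter_partial s g)).
suff : iter_partial s f y @[y --> x] --> iter_partial s g x.
  by move=> h; rewrite (E s x Ux) in h; exact: h.
by apply: cvg_trans cg; exact: (near_eq_cvg nE).
Unshelve. all: end_near. Qed.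

Lemma continuous_sqnorm2 (a : 'rV[R]_n) : continuous (fun y : 'rV[R]_n => sqnorm2 (a - y)).
Proof.
rewrite /sqnorm2; apply: continuous_big; first exact: add_continuous.
move=> i _ x.
apply: (@cvg_comp _ _ _ (fun y : 'rV[R]_n => (a - y) ord0 i) (fun t : R => t ^+ 2) _
  (nbhs ((a - x) ord0 i))); last exact: exprn_continuous.
rewrite (_ : (fun y : 'rV[R]_n => _) = fun y => a ord0 i - y ord0 i).
  have -> : (a - x) ord0 i = a ord0 i - x ord0 i by rewrite !mxE.
  by apply: (@cvgB R R^o _ (nbhs x) (nbhs_filter x)); [exact: cvg_cst|exact: coord_continuous].
by apply/funext => y; rewrite !mxE.
Qed.

Lemma is_derive_sqnorm2 x v :
  is_derive x v (@sqnorm2 R n : 'rV[R]_n -> R^o) (2 * \sum_i x ord0 i * v ord0 i).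
Proof.
have h i : is_derive x v ((fun y : 'rV[R]_n => y ord0 i ^+ 2) : 'rV[R]_n -> R^o)
    (2 * x ord0 i * v ord0 i).
  have hc := is_derive_coord x v i.
  apply: (@is_derive_comp1 R n (fun t => t ^+ 2)) => //.
  by apply: is_derive_eq; rewrite /GRing.scale/=; ring.
rewrite (_ : @sqnorm2 R n = \sum_(i < n) (fun y : 'rV[R]_n => y ord0 i ^+ 2 : R^o)); last first.
  by apply/funext => y; rewrite fct_sumE.
apply: is_derive_eq; rewrite mulr_sumr; apply: eq_bigr => i _; ring.
Qed.

(** Every directional derivative exists and is linear in the direction.  The
    mean value theorem along lines needs all directions, not only the axes. *)
Definition has_grad f (df : 'I_n -> 'rV[R]_n -> R) :=
  forall x v, is_derive x v (f : 'rV[R]_n -> R^o) (\sum_i v ord0 i * df i x).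

Lemma sum_delta (c : 'I_n -> R) i : \sum_j e_ i ord0 j * c j = c i.
Proof.
rewrite (bigD1 i)//= mxE !eqxx mul1r big1 ?addr0// => j ji.
by rewrite mxE eqxx/= (negbTE ji) mul0r.
Qed.

Lemma has_grad_partial f df : has_grad f df ->
  forall i x, is_derive x (e_ i) (f : 'rV[R]_n -> R^o) (df i x).
Proof. by move=> h i x; have := h x (e_ i); rewrite sum_delta. Qed.

Lemma has_grad_radial (F F' : R -> R) :
  (forall t : R, is_derive t 1 (F : R -> R^o) (F' t)) ->
  has_grad (fun x => F (sqnorm2 x)) (fun i x => 2 * x ord0 i * F' (sqnorm2 x)).
Proof.
move=> dF x v; have h := is_derive_comp1 (dF (sqnorm2 x)) (is_derive_sqnorm2 x v).
apply: (is_derive_eq h); rewrite mulrCA mulr_sumr mulr_sumr.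
by apply: eq_bigr => i _; ring.
Qed.

Lemma has_gradM f df g dg : has_grad f df -> has_grad g dg ->
  has_grad (fun x => f x * g x) (fun i x => f x * dg i x + g x * df i x).
Proof.
move=> hf hg x v; have h := @is_deriveM R 'rV[R]_n f g x v _ _ (hf x v) (hg x v).
have -> : \sum_i v ord0 i * (f x * dg i x + g x * df i x) =
   f x *: (\sum_i v ord0 i * dg i x : R^o) + g x *: (\sum_i v ord0 i * df i x : R^o).
  rewrite /GRing.scale/= !mulr_sumr -big_split/=; apply: eq_bigr => i _; ring.
exact: h.
Qed.

Lemma has_gradD f df g dg : has_grad f df -> has_grad g dg ->
  has_grad (fun x => f x + g x) (fun i x => df i x + dg i x).
Proof.
move=> hf hg x v; have h := @is_deriveD R 'rV[R]_n R^o f g x v _ _ (hf x v) (hg x v).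
have -> : \sum_i v ord0 i * (df i x + dg i x) =
   (\sum_i v ord0 i * df i x) + (\sum_i v ord0 i * dg i x).
  by rewrite -big_split/=; apply: eq_bigr => i _; ring.
exact: h.
Qed.

Lemma has_gradZ c f df : has_grad f df ->
  has_grad (fun x => c * f x) (fun i x => c * df i x).
Proof.
move=> hf x v; have h := @is_deriveZ R 'rV[R]_n R^o f c x v _ (hf x v).
have -> : \sum_i v ord0 i * (c * df i x) = c *: (\sum_i v ord0 i * df i x : R^o).
  by rewrite /GRing.scale/= mulr_sumr; apply: eq_bigr => i _; ring.
exact: h.
Qed.

Lemma has_grad_coord j : has_grad (fun x => x ord0 j) (fun i x => (i == j)%:R).
Proof.
move=> x v; have := is_derive_coord x v j.
rewrite (_ : \sum_i _ = v ord0 j)//.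
rewrite (bigD1 j)//= eqxx mulr1 big1 ?addr0// => i ij.
by rewrite (negbTE ij) mulr0.
Qed.

Lemma eq_has_grad f df df' : has_grad f df -> (forall i x, df i x = df' i x) -> has_grad f df'.
Proof.
by move=> h E x v; have := h x v; rewrite (eq_bigr (fun i => v ord0 i * df' i x))// => i _; rewrite E.
Qed.

(** Functions of [y] obtained from coordinates and powers of [|a - y|^2]; they
    form a class closed under partial derivatives, which is how smoothness of
    all orders away from [a] is obtained. *)
Inductive radial_exp (a : 'rV[R]_n) : ('rV[R]_n -> R) -> Prop :=
| re_cst c : radial_exp a (fun=> c)
| re_coord j : radial_exp a (fun y => y ord0 j)
| re_pow c p : radial_exp a (fun y => c * sqnorm2 (a - y) `^ p)
| re_prim G c p : (forall t : R, 0 < t -> is_derive t 1 (G : R -> R^o) (c * t `^ p)) ->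
    radial_exp a (fun y => G (sqnorm2 (a - y)))
| re_add f g : radial_exp a f -> radial_exp a g -> radial_exp a (fun y => f y + g y)
| re_mul f g : radial_exp a f -> radial_exp a g -> radial_exp a (fun y => f y * g y).

Lemma is_derive_radial a (F : R -> R) d x i :
  is_derive (sqnorm2 (a - x)) 1 (F : R -> R^o) d ->
  is_derive x (e_ i) ((fun y => F (sqnorm2 (a - y))) : 'rV[R]_n -> R^o)
    (d * (-2 * (a ord0 i + (-1) * x ord0 i))).
Proof.
move=> dF; have h0 := is_derive_sqnorm2 (a - x) (- e_ i).
have h1 := is_derive_refl_rV h0.
have := @is_derive_comp1 R n F (fun y => sqnorm2 (a - y)) x (e_ i) _ d dF h1.
move=> h; apply: (is_derive_eq h); congr (_ * _).
under eq_bigr do rewrite [(- e_ i) _ _]mxE mulrN mulrC.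
by rewrite sumrN sum_delta !mxE; ring.
Qed.

Lemma radial_exp_smooth a f : radial_exp a f ->
  smooth_in [set y | 0 < sqnorm2 (a - y)] f.
Proof.
move: f; apply: (@smooth_in_class _ (radial_exp a)).
- have -> : [set y | 0 < sqnorm2 (a - y)] =
     (fun y : 'rV[R]_n => sqnorm2 (a - y)) @^-1` [set t | 0 < t] by [].
  by apply: open_comp => [x _|]; [exact: continuous_sqnorm2|exact: open_gt].
- move=> f; elim=> {f} [c|j|c p|G c p dG|f g _ IHf _ IHg|f g _ IHf _ IHg] x Ux.
  + exact: cst_continuous.
  + exact: coord_continuous.
  + apply: (@cvg_comp _ _ _ (fun y : 'rV[R]_n => sqnorm2 (a - y))
      (fun t : R => c * t `^ p) _ (nbhs (sqnorm2 (a - x)))); first exact: continuous_sqnorm2.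
    exact: is_derive_continuous1 (is_derive_cpowR c p Ux).
  + apply: (@cvg_comp _ _ _ (fun y : 'rV[R]_n => sqnorm2 (a - y))
      G _ (nbhs (sqnorm2 (a - x)))); first exact: continuous_sqnorm2.
    exact: is_derive_continuous1 (dG _ Ux).
  + by apply: (@cvgD R R^o _ (nbhs x) (nbhs_filter x)); [exact: IHf|exact: IHg].
  + by apply: (@cvgM R _ (nbhs x) (nbhs_filter x)); [exact: IHf|exact: IHg].
- move=> f; elim=> {f} [c|j|c p|G c p dG|f g rf IHf rg IHg|f g rf IHf rg IHg] i.
  + exists (fun=> 0); split; [exact: re_cst|move=> x _; exact: is_derive_cst].
  + exists (fun=> (e_ i) ord0 j); split; first exact: re_cst.
    by move=> x _; exact: is_derive_coord.
  + exists (fun y => (c * p * sqnorm2 (a - y) `^ (p - 1)) *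
      (-2 * (a ord0 i + (-1) * y ord0 i))); split.
      apply: re_mul; first exact: re_pow.
      apply: re_mul; first exact: re_cst.
      apply: re_add; first exact: re_cst.
      by apply: re_mul; [exact: re_cst|exact: re_coord].
    move=> x Ux; apply: (@is_derive_radial a (fun t => c * t `^ p)).
    exact: is_derive_cpowR.
  + exists (fun y => (c * sqnorm2 (a - y) `^ p) *
      (-2 * (a ord0 i + (-1) * y ord0 i))); split.
      apply: re_mul; first exact: re_pow.
      apply: re_mul; first exact: re_cst.
      apply: re_add; first exact: re_cst.
      by apply: re_mul; [exact: re_cst|exact: re_coord].
    by move=> x Ux; apply: is_derive_radial; exact: dG.
  + have [f' [rf' df]] := IHf i; have [g' [rg' dg]] := IHg i.
    exists (fun y => f' y + g' y); split; first exact: re_add.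
    move=> x Ux; exact: (@is_deriveD R 'rV[R]_n R^o f g x _ _ _ (df x Ux) (dg x Ux)).
  + have [f' [rf' df]] := IHf i; have [g' [rg' dg]] := IHg i.
    exists (fun y => f y * g' y + g y * f' y); split.
      by apply: re_add; apply: re_mul.
    move=> x Ux; exact: (@is_deriveM R 'rV[R]_n f g x _ _ _ (df x Ux) (dg x Ux)).
Qed.

Lemma is_derive_opp_dir f x v (d : R) :
  is_derive x v (f : 'rV[R]_n -> R^o) d -> is_derive x (- v) (f : 'rV[R]_n -> R^o) (- d).
Proof.
move=> /is_derive_lineP h; apply/is_derive_lineP.
have h0 : is_derive (- (0 : R)) 1 (fun t : R => (f (t *: v + x) : R^o)) d by rewrite oppr0.
have h1 : is_derive (0 : R) 1 (fun t : R => (- t : R^o)) (- 1).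
  by apply: is_derive_eq.
have h2 := is_derive1_comp h0 h1; rewrite mulrN1 in h2.
rewrite (_ : (fun t : R => _) = (fun t : R => (f (t *: v + x) : R^o)) \o (fun t : R => (- t : R^o)))//.
by apply/funext => t /=; rewrite scalerN scaleNr.
Qed.

Lemma partialE f i x d : is_derive x (e_ i) (f : 'rV[R]_n -> R^o) d -> partial i f x = d.
Proof. by move=> [_]. Qed.

Lemma partial_refl f df a i : has_grad f df ->
  partial i (fun y => f (a - y)) = fun y => - df i (a - y).
Proof.
move=> hf; apply/funext => y; apply: partialE.
apply: is_derive_refl_rV; have := hf (a - y) (- e_ i).
rewrite (_ : \sum_j _ = - df i (a - y))//.
under eq_bigr do rewrite [(- e_ i) _ _]mxE mulNr.
by rewrite sumrN sum_delta.
Qed.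

End smooth_class.

(** * A mollified Newton kernel *)

Section newton_kernel.
Context {R : realType} {n : nat}.
Notation rV := 'rV[R]_n.
Notation e_ i := (delta_mx ord0 i : rV).

(** A smoothing of the Newton kernel in the form in which it is used: [nkG],
    [nkD], [nkH], [nkT] are the kernel and its derivatives of order 1, 2, 3
    ([nkT j i] being [d_i d_i d_j]), and [nk_k], [nk_dk] are minus the Laplacian
    and its gradient.  Instead of a Dirac mass, minus the Laplacian is a
    mollifier supported within distance [tau] of the origin; beyond it the
    kernel and its first derivatives are harmonic. *)
Record newton_kernel (tau : R) := NewtonKernel {
  nkG : rV -> R;
  nkD : 'I_n -> rV -> R;
  nkH : 'I_n -> 'I_n -> rV -> R;
  nkT : 'I_n -> 'I_n -> rV -> R;
  nk_k : rV -> R;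
  nk_dk : 'I_n -> rV -> R;
  nkG_lbm : lbm nkG;
  nkD_lbm : forall i, lbm (nkD i);
  nkH_lbm : forall i j, lbm (nkH i j);
  nkT_lbm : forall i j, lbm (nkT i j);
  nkk_lbm : lbm nk_k;
  nkdk_lbm : forall i, lbm (nk_dk i);
  nkG_grad : has_grad nkG nkD;
  nkD_grad : forall j, has_grad (nkD j) (nkH j);
  nkH_der : forall i j x, is_derive x (e_ i) (nkH j i : rV -> R^o) (nkT j i x);
  nkk_grad : has_grad nk_k nk_dk;
  nkH_sym : forall i j x, nkH i j x = nkH j i x;
  nk_lap : forall x, \sum_i nkH i i x = - nk_k x;
  nk_dlap : forall j x, \sum_i nkT j i x = - nk_dk j x;
  nkk_ge0 : forall x, 0 <= nk_k x;
  nkk_even : forall x, nk_k (- x) = nk_k x;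
  nkk_supp : forall x, tau <= `|x| -> nk_k x = 0;
  nkk_int : J nk_k = 1;
  nk_harmonic : forall (Om : set rV) x, (forall y, Om y -> tau <= `|x - y|) ->
    harmonic_on Om (fun y => nkG (x - y)) /\
    forall j, harmonic_on Om (fun y => nkD j (x - y)) }.

Lemma sqnorm2_ge0 (x : rV) : 0 <= sqnorm2 x.
Proof. by apply: sumr_ge0 => i _; exact: sqr_ge0. Qed.

Lemma norm_sqnorm2 (x : rV) : `|x| ^+ 2 <= sqnorm2 x.
Proof.
rewrite -[leRHS]sqr_sqrtr ?sqnorm2_ge0//.
rewrite lerXn2r ?nnegrE ?sqrtr_ge0//; apply/ler_mx_normP; first exact: sqrtr_ge0.
move=> j; rewrite -sqrtr_sqr ler_wsqrtr// /sqnorm2 (bigD1 j)//= lerDl.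
by apply: sumr_ge0 => i _; exact: sqr_ge0.
Qed.

Lemma sqnorm2_le (x : rV) (r : R) : 0 <= r -> `|x| <= r -> sqnorm2 x <= n%:R * r ^+ 2.
Proof.
move=> r0 /(ler_mx_normP x r0) xr.
apply: le_trans (_ : \sum_(i < n) r ^+ 2 <= _); last by rewrite sumr_const card_ord mulr_natl.
apply: ler_sum => i _; rewrite -real_normK ?num_real//.
by rewrite lerXn2r ?nnegrE.
Qed.

Lemma lbm_sqnorm2 : lbm (@sqnorm2 R n).
Proof.
apply: lbm_sum => i; under eq_fun do rewrite expr2.
by apply: lbmM; exact: lbm_coord.
Qed.

(** The radial profile of the previous part in dimension [n = 2 * m], with [b
    = tau ^ 2 / 4], normalized by the total mass of its Laplacian. The mass is
    positive because the Laplacian is bounded below on a small cube. *)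
Lemma newton_kernel_exists (tau : R) : (0 < n)%N -> 0 < tau -> inhabited (newton_kernel tau).
Proof.
move=> n0 tau0; pose b := tau ^+ 2 / 4; pose m : R := n%:R / 2.
have m0 : 0 < m by rewrite divr_gt0// ltr0n.
have b0 : 0 < b by rewrite divr_gt0// exprn_gt0.
have btau : b < tau ^+ 2 by rewrite /b; have := exprn_gt0 2 tau0; lra.
have [F [dF [G [dG FG]]]] := prof_primitive m b0.
have d1 := is_derive_prof1 m b0.
have d2 := is_derive_prof2 m b0.
have dk := is_derive_profk m b0.
have c1 : continuous (prof1 m b) := derive_continuous d1.
have c2 : continuous (prof2 m b) := derive_continuous d2.
have c3 := @continuous_prof3 R m b b0.
have ck : continuous (profk m b) := derive_continuous dk.
have cF : continuous F := derive_continuous dF.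
pose q := @sqnorm2 R n.
pose f1 (x : rV) := prof1 m b (q x); pose f2 (x : rV) := prof2 m b (q x).
pose f3 (x : rV) := prof3 m b (q x).
have l1 : lbm f1 := lbm_comp1 c1 lbm_sqnorm2.
have l2 : lbm f2 := lbm_comp1 c2 lbm_sqnorm2.
have l3 : lbm f3 := lbm_comp1 c3 lbm_sqnorm2.
pose k (x : rV) := profk m b (q x).
have lk : lbm k := lbm_comp1 ck lbm_sqnorm2.
pose dkk (i : 'I_n) (x : rV) := 2 * x ord0 i * (- ((4 * m + 4) * prof2 m b (q x) + 4 * q x * prof3 m b (q x))).
pose D (i : 'I_n) (x : rV) := 2 * x ord0 i * f1 x.
pose H (j i : 'I_n) (x : rV) := 2 * (i == j)%:R * f1 x + 4 * (x ord0 j * x ord0 i * f2 x).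
pose T (j i : 'I_n) (x : rV) := 8 * (i == j)%:R * x ord0 i * f2 x + 4 * x ord0 j * f2 x +
  8 * x ord0 j * x ord0 i ^+ 2 * f3 x.
have lc (i : 'I_n) := @lbm_coord R n i.
have g1 : has_grad f1 (fun i x => 2 * x ord0 i * f2 x) := has_grad_radial d1.
have g2 : has_grad f2 (fun i x => 2 * x ord0 i * f3 x) := has_grad_radial d2.
have gD j : has_grad (D j) (H j).
  have h := has_gradM (has_gradZ 2 (has_grad_coord j)) g1.
  by apply: (eq_has_grad h) => i x; rewrite /H; ring.
have gH j i x : is_derive x (e_ i) (H j i : rV -> R^o) (T j i x).
  have h1 := has_gradZ (2 * (i == j)%:R) g1.
  have h2 := has_gradZ 4 (has_gradM (has_gradM (has_grad_coord j) (has_grad_coord i)) g2).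
  apply: (is_derive_eq (has_grad_partial (has_gradD h1 h2) i x)).
  by rewrite /T eqxx /=; have [->|ij] := eqVneq i j; ring.
have gk : has_grad k dkk := has_grad_radial dk.
have qE x : q x = \sum_i x ord0 i ^+ 2 by [].
have m2 : n%:R = 2 * m by rewrite /m; field.
have lapE x : \sum_i H i i x = - k x.
  rewrite (eq_bigr (fun i => 2 * f1 x + 4 * (x ord0 i ^+ 2 * f2 x))); last first.
    by move=> i _; rewrite /H eqxx mulr1; ring.
  rewrite big_split/= sumr_const card_ord -mulr_sumr -mulr_suml -qE -[_ *+ n]mulr_natr m2.
  by rewrite /k /profk /f1 /f2; ring.
have dlapE j x : \sum_i T j i x = - dkk j x.
  rewrite (eq_bigr (fun i => (8 * (i == j)%:R * x ord0 i * f2 x + 4 * x ord0 j * f2 x) +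
     8 * x ord0 j * f3 x * x ord0 i ^+ 2)); last by move=> i _; rewrite /T; ring.
  rewrite big_split/= big_split/= (bigD1 j)//= eqxx mulr1 big1 ?addr0; last first.
    by move=> i ij; rewrite (negbTE ij) mulr0 !mul0r.
  rewrite sumr_const card_ord -mulr_sumr -qE -[_ *+ n]mulr_natr m2.
  by rewrite /dkk -/(f2 x) -/(f3 x); ring.
have bm0 : 0 < 2 * m * (m + 1) * (m + 2) * b `^ (- m).
  have h1 : 0 < m + 1 by lra.
  have h2 : 0 < m + 2 by lra.
  have hp : 0 < b `^ (- m) by apply: powR_gt0.
  by rewrite mulr_gt0// mulr_gt0// mulr_gt0// mulr_gt0.
have k0 x : 0 <= k x.
  by rewrite /k profkE//; case: ifP => // _; rewrite mulr_ge0 ?sqr_ge0// ltW.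
have kfar x : b < q x -> k x = 0 by move=> bx; rewrite /k profkE// leNgt bx.
have kN x : k (- x) = k x.
  by rewrite /k /q /sqnorm2; congr (profk _ _ _); apply: eq_bigr => i _; rewrite mxE sqrrN.
have ksupp x : tau <= `|x| -> k x = 0.
  move=> tx; apply: kfar; apply: lt_le_trans btau _; apply: le_trans (norm_sqnorm2 x).
  by rewrite lerXn2r ?nnegrE// ltW.
have nk : nice k by split=> //; exists tau => x /ltW; exact: ksupp.
have intk : 0 < J k.
  pose rho := Num.sqrt (b / (2 * n%:R)).
  have nr : 0 < n%:R :> R by rewrite ltr0n.
  have rho0 : 0 < rho by rewrite sqrtr_gt0 divr_gt0// mulr_gt0.
  pose c := 2 * m * (m + 1) * (m + 2) * b `^ (- m) / 4.
  have low x : c * \1_(cbox rho) x <= k x.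
    rewrite indicE; have [xr|xr] := pselect (cbox rho x); last first.
      by rewrite memNset// mulr0.
    rewrite mem_set// mulr1.
    have qb : q x <= b / 2.
      apply: le_trans (sqnorm2_le (ltW rho0) _) _; first exact/(cboxE x (ltW rho0)).
      have b2 : 0 <= b / (2 * n%:R) by apply: ltW; rewrite divr_gt0// mulr_gt0.
      rewrite (sqr_sqrtr b2).
      by rewrite le_eqVlt; apply/orP; left; apply/eqP; field; rewrite gt_eqF.
    rewrite /k profkE// ifT; last by apply: le_trans qb _; lra.
    rewrite /c ler_pM2l//.
    have h : q x / b <= 1 / 2 by rewrite ler_pdivrMr//; lra.
    have h' : 1 / 2 <= 1 - q x / b by lra.
    have : (1 / 2) ^+ 2 <= (1 - q x / b) ^+ 2 by rewrite lerXn2r ?nnegrE//; lra.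
    by lra.
  have := le_J (niceZ c (nice_cbox rho)) nk low.
  rewrite (JZ _ (nice_cbox rho)) J_cbox ?(ltW rho0)//.
  have c0 : 0 < c by rewrite divr_gt0.
  have r2 : 0 < 2 * rho by rewrite mulr_gt0.
  by apply: lt_le_trans; rewrite mulr_gt0// exprn_gt0.
pose c := (J k)^-1.
have c0 : 0 < c by rewrite invr_gt0.
have gF : has_grad (fun z : rV => c * F (q z)) (fun i z => c * D i z).
  exact: (has_gradZ c (has_grad_radial dF)).
have harm (Om : set rV) x : (forall y, Om y -> tau <= `|x - y|) ->
    harmonic_on Om (fun y => c * F (q (x - y))) /\
    forall j, harmonic_on Om (fun y => c * D j (x - y)).
  move=> far.
  have farq y : Om y -> b < q (x - y).
    move=> /far h; apply: lt_le_trans btau _; apply: le_trans (norm_sqnorm2 _).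
    by rewrite lerXn2r ?nnegrE// ltW.
  pose U := [set y : rV | b < q (x - y)].
  have oU : open U.
    have -> : U = (fun y : rV => sqnorm2 (x - y)) @^-1` [set t | b < t] by [].
    by apply: open_comp => [z _|]; [exact: continuous_sqnorm2|exact: open_gt].
  have sm (f g : rV -> R) : radial_exp x g -> (forall y, U y -> f y = g y) -> smooth_on Om f.
    move=> rg fg; exists U; split; [exact: oU|exact: farq|].
    apply: (smooth_in_eq oU fg) => s y Uy.
    exact: (radial_exp_smooth rg s (lt_trans b0 Uy)).
  have h1 : smooth_on Om (fun y => c * F (q (x - y))).
    apply: (sm _ (fun y => c * G (sqnorm2 (x - y)))); last by move=> y Uy; rewrite -FG.
    exact: (re_mul (re_cst x c) (re_prim x dG)).
  split; [split=> //|move=> j; split].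
  - move=> y /interior_subset Oy; rewrite /laplacian.
    transitivity (\sum_i (c * H i i (x - y))); last first.
      by rewrite -mulr_sumr lapE kfar ?oppr0 ?mulr0//; exact: farq.
    apply: eq_bigr => i _; rewrite (partial_refl x i gF).
    rewrite (_ : (fun z => _) = fun z => - c * D i (x - z)); last first.
      by apply/funext => z; ring.
    by rewrite (partial_refl x i (has_gradZ (- c) (gD i))); ring.
  - apply: (sm _ (fun y => c * (2 * (x ord0 j + (-1) * y ord0 j)) *
       (-1 * sqnorm2 (x - y) `^ (- m)))) => [|y Uy].
      apply: re_mul; last exact: re_pow.
      apply: re_mul; first exact: re_cst.
      apply: re_mul; first exact: re_cst.
      by apply: re_add; [exact: re_cst|apply: re_mul; [exact: re_cst|exact: re_coord]].
    rewrite /D /f1 /prof1 /glue leNgt Uy/= !mxE; ring.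
  - move=> y /interior_subset Oy; rewrite /laplacian.
    transitivity (\sum_i (c * T j i (x - y))); last first.
      rewrite -mulr_sumr dlapE /dkk /prof2 /prof3 /glue leNgt farq//=.
      have q0 : 0 < q (x - y) := lt_trans b0 (farq _ Oy).
      have -> : q (x - y) `^ (- m - 1) = q (x - y) `^ (- m - 2) * q (x - y).
        rewrite -{3}[q (x - y)]powRr1 ?ltW// -powRD; last first.
          by apply/implyP => _; rewrite gt_eqF.
        by congr (_ `^ _); ring.
      ring.
    apply: eq_bigr => i _; rewrite (partial_refl x i (has_gradZ c (gD j))).
    apply: partialE; apply: (@is_derive_refl_rV R n (fun z => - (c * H j i z))).
    have h0 := @is_deriveZ R 'rV[R]_n R^o (H j i) (- c) _ _ _ (gH j i (x - y)).
    have h2 := is_derive_opp_dir h0.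
    have -> : c * T j i (x - y) = - (- c *: (T j i (x - y) : R^o)).
      by rewrite /GRing.scale/=; ring.
    rewrite (_ : (fun z => - (c * H j i z)) = (- c \*: (H j i : rV -> R^o)))//.
    by apply/funext => z; rewrite /= /GRing.scale/= mulNr.
have lq := lbm_comp1 cF lbm_sqnorm2.
have lZ (f : rV -> R) : lbm f -> lbm (fun x => c * f x) by exact: lbmZ.
have lD i : lbm (D i) by apply: lbmM => //; apply: lbmM => //; exact: lbm_cst.
have lH j i : lbm (H j i).
  apply: lbmD; first by apply: lbmM => //; exact: lbm_cst.
  by apply: lbmZ; apply: lbmM => //; exact: lbmM.
have lT j i : lbm (T j i).
  apply: lbmD; [apply: lbmD|]; apply: lbmM => //.
  - by apply: lbmM => //; exact: lbm_cst.
  - by apply: lbmM => //; exact: lbm_cst.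
  - apply: lbmM; first by apply: lbmM => //; exact: lbm_cst.
    by under eq_fun do rewrite expr2; exact: lbmM.
have ldk i : lbm (dkk i).
  apply: lbmM; first by apply: lbmM => //; exact: lbm_cst.
  apply: lbmN; apply: lbmD; apply: lbmM => //; first exact: lbm_cst.
  by apply: lbmM; [exact: lbm_cst|exact: lbm_sqnorm2].
constructor; refine (@NewtonKernel tau (fun x => c * F (q x)) (fun i x => c * D i x)
  (fun j i x => c * H j i x) (fun j i x => c * T j i x) (fun x => c * k x)
  (fun i x => c * dkk i x) _ _ _ _ _ _ _ _ _ _ _ _ _ _ _ _ _ _).
- exact: lZ.
- by move=> i; exact: lZ.
- by move=> i j; exact: lZ.
- by move=> i j; exact: lZ.
- exact: lZ.
- by move=> i; exact: lZ.
- exact: gF.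
- by move=> j; exact: has_gradZ.
- exact: has_gradZ.
- by move=> i j x; rewrite /H eq_sym; ring.
- by move=> x; rewrite -mulr_sumr lapE mulrN.
- by move=> j x; rewrite -mulr_sumr dlapE mulrN.
- by move=> x; rewrite mulr_ge0// ltW.
- by move=> x; rewrite kN.
- by move=> x h; rewrite ksupp ?mulr0.
- by rewrite (JZ c nk) mulVf// gt_eqF.
- exact: harm.
Qed.

End newton_kernel.

(** * Potentials of jets and Green's identity *)

Section inner_products.
Context {R : realType} {n : nat}.
Notation rV := 'rV[R]_n.
Implicit Types (f g : rV -> R) (F G : 'I_n -> rV -> R).

(** The L2 products of functions and of vector fields on the whole space.
    Functions on [Omega] enter through their extensions by 0. *)
Definition ip0 f g := J (fun x => f x * g x).
Definition ip1 F G := \sum_i ip0 (F i) (G i).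

Lemma nice_mul f g : nice f -> nice g -> nice (fun x => f x * g x).
Proof. by move=> nf ng; exact: niceMl nf (nice_lbm ng). Qed.

Lemma ip0C f g : ip0 f g = ip0 g f.
Proof. by apply: eq_J => x; rewrite mulrC. Qed.

Lemma ip1C F G : ip1 F G = ip1 G F.
Proof. by apply: eq_bigr => i _; exact: ip0C. Qed.

Lemma ip0_ge0 f : 0 <= ip0 f f.
Proof. by apply: J_ge0 => x; rewrite -expr2 sqr_ge0. Qed.

Lemma ip1_ge0 F : 0 <= ip1 F F.
Proof. by apply: sumr_ge0 => i _; exact: ip0_ge0. Qed.

Lemma ip0_linr f g h t : nice f -> nice g -> nice h ->
  ip0 h (fun x => f x + t * g x) = ip0 h f + t * ip0 h g.
Proof.
move=> nf ng nh; have n1 := nice_mul nh nf; have n2 := nice_mul nh ng.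
rewrite /ip0 -(JZ t n2) -(JD n1 (niceZ t n2)).
by apply: eq_J => x; ring.
Qed.

Lemma ip1_linr F G H t : (forall i, nice (F i)) -> (forall i, nice (G i)) ->
  (forall i, nice (H i)) ->
  ip1 H (fun i x => F i x + t * G i x) = ip1 H F + t * ip1 H G.
Proof.
move=> nF nG nH; rewrite /ip1 mulr_sumr -big_split/=.
by apply: eq_bigr => i _; exact: ip0_linr.
Qed.

Lemma ip0_quad f g t : nice f -> nice g ->
  ip0 (fun x => f x + t * g x) (fun x => f x + t * g x) =
  ip0 f f + 2 * t * ip0 f g + t ^+ 2 * ip0 g g.
Proof.
move=> nf ng; have nh := niceD nf (niceZ t ng).
rewrite (ip0_linr t nf ng nh) [ip0 _ f]ip0C [ip0 _ g]ip0C.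
rewrite (ip0_linr t nf ng nf) (ip0_linr t nf ng ng) [ip0 g f]ip0C; ring.
Qed.

Lemma ip1_quad F G t : (forall i, nice (F i)) -> (forall i, nice (G i)) ->
  ip1 (fun i x => F i x + t * G i x) (fun i x => F i x + t * G i x) =
  ip1 F F + 2 * t * ip1 F G + t ^+ 2 * ip1 G G.
Proof.
move=> nF nG; rewrite /ip1 !mulr_sumr -!big_split/=.
by apply: eq_bigr => i _; exact: ip0_quad.
Qed.

Lemma ip0_CS f g : nice f -> nice g -> `|ip0 f g| <= Num.sqrt (ip0 f f) * Num.sqrt (ip0 g g).
Proof.
move=> nf ng; rewrite -sqrtrM ?ip0_ge0// -sqrtr_sqr ler_wsqrtr//.
by apply: discr_le (ip0_ge0 g) _ => t; rewrite -(ip0_quad t nf ng) ip0_ge0.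
Qed.

Lemma ip1_CS F G : (forall i, nice (F i)) -> (forall i, nice (G i)) ->
  `|ip1 F G| <= Num.sqrt (ip1 F F) * Num.sqrt (ip1 G G).
Proof.
move=> nF nG; rewrite -sqrtrM ?ip1_ge0// -sqrtr_sqr ler_wsqrtr//.
by apply: discr_le (ip1_ge0 G) _ => t; rewrite -(ip1_quad t nF nG) ip1_ge0.
Qed.

(** Jensen's inequality for the probability measure [k (x - y) dy]: convolution
    with a mollifier contracts the L2 norm. *)
Lemma young_restricted (Om : set rV) (k g : rV -> R) : nice k -> nice g ->
  nice (\1_Om : rV -> R) ->
  (forall x, 0 <= k x) -> (forall x, k (- x) = k x) -> J k = 1 ->
  ip0 (fun x => \1_Om x * conv g k x) (fun x => \1_Om x * conv g k x) <= ip0 g g.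
Proof.
move=> nk ng nO k0 kN k1.
have lk := nice_lbm nk.
have ks x y : k (x - y) = k (y - x) by rewrite -opprB kN.
have kint x : J (fun y => k (x - y)) = 1.
  by rewrite -k1 -(J_shift (- x) nk); apply: eq_J => y; exact: ks.
have nks x : nice (fun y => k (x - y)).
  by rewrite (_ : (fun y => k (x - y)) = fun y => k (y + - x));
    [exact: nice_shift|apply/funext => y; exact: ks].
have ng2 := nice_mul ng ng.
pose c x := conv g k x.
have jensen x : c x * c x <= conv (fun y => g y * g y) k x.
  rewrite -subr_ge0.
  have -> : conv (fun y => g y * g y) k x - c x * c x =
      J (fun y => k (x - y) * (g y - c x) ^+ 2).
    have n1 : nice (fun y => g y * g y * k (x - y)) by exact: nice_conv_in.
    have n2 : nice (fun y => g y * k (x - y)) by exact: nice_conv_in.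
    transitivity (J (fun y => g y * g y * k (x - y)) - 2 * c x * J (fun y => g y * k (x - y)) +
      c x ^+ 2 * J (fun y => k (x - y))).
      by rewrite kint /c /conv; ring.
    rewrite -(JZ (2 * c x) n2) -(JZ (c x ^+ 2) (nks x)) -(JB n1 (niceZ _ n2)).
    rewrite -(JD (niceB n1 (niceZ _ n2)) (niceZ _ (nks x))).
    by apply: eq_J => y; ring.
  by apply: J_ge0 => y; rewrite mulr_ge0 ?sqr_ge0.
have lc : lbm c by exact: conv_lbm.
have lc2 := conv_lbm ng2 lk.
apply: (@le_trans _ _ (J (fun x => \1_Om x * conv (fun y => g y * g y) k x))).
  apply: le_J => [||x].
  - by apply: nice_mul; apply: niceMl.
  - exact: niceMl.
  - rewrite indicE; have [_|_] := boolP (x \in Om); last by rewrite !mul0r.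
    by rewrite !mul1r; exact: jensen.
have [_ ->] := J_fubini_conv nO ng2 lk.
apply: le_J => // [|y].
  apply: niceMl => //; rewrite (_ : (fun y => _) = conv \1_Om k); first exact: conv_lbm.
  by apply/funext => y; apply: eq_J => x; rewrite ks.
rewrite -[leRHS]mulr1 ler_wpM2l -?expr2 ?sqr_ge0// -(kint y).
apply: le_J => [||x]; last 1 first.
- by rewrite ks indicE; have [_|_] := boolP (x \in Om); rewrite ?mul1r ?mul0r.
- by apply: niceMl => //; exact: (lbm_shift (- y) lk).
- exact: nks.
Qed.

Lemma conv_has_grad g K dK : nice g -> lbm K -> (forall i, lbm (dK i)) ->
  has_grad K dK -> has_grad (conv g K) (fun i => conv g (dK i)).
Proof.
move=> ng lK ldK hK x v.
have lS : lbm (fun z => \sum_i v ord0 i * dK i z) by apply: lbm_sum => i; exact: lbmZ.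
have h := is_derive_conv ng lK lS (fun z => hK z v) x.
rewrite (_ : \sum_i _ = conv g (fun z => \sum_i v ord0 i * dK i z) x)//.
rewrite /conv (_ : J (fun y => g y * \sum_i v ord0 i * dK i (x - y)) =
  J (fun y => \sum_i (v ord0 i * (g y * dK i (x - y))))).
  rewrite J_sum => [|i]; last by apply: niceZ; exact: nice_conv_in.
  by apply: eq_bigr => i _; rewrite (JZ _ (nice_conv_in x ng (ldK i))).
by apply: eq_J => y; rewrite mulr_sumr; apply: eq_bigr => i _; ring.
Qed.

End inner_products.

Section potential.
Context {R : realType} {n : nat}.
Notation rV := 'rV[R]_n.
Notation e_ i := (delta_mx ord0 i : rV).
Variables (tau kap : R) (N : @newton_kernel R n tau).
Variables (W0 : rV -> R) (W : 'I_n -> rV -> R).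
Hypotheses (nW0 : nice W0) (nW : forall j, nice (W j)).

(** The potential generated by a density [W0] and a field of dipoles [W],
    namely [kap * (G * W0) - div (G * W)] with [G] the mollified Newton
    kernel; for the jet of a function this is the pairing of the jet with the
    kernel. *)
Definition pot x := kap * conv W0 (nkG N) x - \sum_j conv (W j) (nkD N j) x.
Definition dpot i x := kap * conv W0 (nkD N i) x - \sum_j conv (W j) (nkH N j i) x.
Definition ddpot i x := kap * conv W0 (nkH N i i) x - \sum_j conv (W j) (nkT N j i) x.

Lemma nk_nice : nice (nk_k N).
Proof.
split; first exact: nkk_lbm.
by exists tau => x /ltW; exact: nkk_supp.
Qed.

Lemma lbm_pot : lbm pot.
Proof.
apply: lbmB; first by apply/lbmZ/conv_lbm => //; exact: nkG_lbm.
by apply: lbm_sum => j; apply: conv_lbm => //; exact: nkD_lbm.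
Qed.

Lemma lbm_dpot i : lbm (dpot i).
Proof.
apply: lbmB; first by apply/lbmZ/conv_lbm => //; exact: nkD_lbm.
by apply: lbm_sum => j; apply: conv_lbm => //; exact: nkH_lbm.
Qed.

Lemma lbm_ddpot i : lbm (ddpot i).
Proof.
apply: lbmB; first by apply/lbmZ/conv_lbm => //; exact: nkH_lbm.
by apply: lbm_sum => j; apply: conv_lbm => //; exact: nkT_lbm.
Qed.

Lemma is_derive_sub_sum (f : rV -> R) (g : 'I_n -> rV -> R) x v df dg :
  is_derive x v (f : rV -> R^o) df ->
  (forall j, is_derive x v (g j : rV -> R^o) (dg j)) ->
  is_derive x v ((fun y => kap * f y - \sum_j g j y) : rV -> R^o)
    (kap * df - \sum_j dg j).
Proof.
move=> hf hg.
have h0 := @is_deriveZ R rV R^o f kap x v df hf.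
have h1 := @is_derive_sum R rV R^o n g x v dg hg.
have := @is_deriveB R rV R^o _ _ x v _ _ h0 h1.
rewrite (_ : (kap \*: (f : rV -> R^o)) - \sum_(i < n) (g i : rV -> R^o) =
  (fun y => kap * f y - \sum_j g j y)); first exact.
by apply/funext => y; rewrite !fctE fct_sumE.
Qed.

Lemma pot_grad : has_grad pot dpot.
Proof.
move=> x v.
have h0 := conv_has_grad nW0 (nkG_lbm N) (nkD_lbm N) (nkG_grad N) x v.
have h1 j := conv_has_grad (nW j) (nkD_lbm N j) (nkH_lbm N j) (nkD_grad N j) x v.
apply: (is_derive_eq (is_derive_sub_sum h0 h1)).
rewrite /dpot exchange_big/= mulr_sumr -sumrB; apply: eq_bigr => i _.
by rewrite mulrBr mulr_sumr; ring.
Qed.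

Lemma dpot_der i x : is_derive x (e_ i) (dpot i : rV -> R^o) (ddpot i x).
Proof.
apply: is_derive_sub_sum => [|j].
- apply: is_derive_conv => //; [exact: nkD_lbm|exact: nkH_lbm|].
  by move=> z; exact: has_grad_partial (nkD_grad N i) i z.
- apply: is_derive_conv => //; [exact: nkH_lbm|exact: nkT_lbm|].
  by move=> z; exact: nkH_der.
Qed.

Lemma sum_conv (g : rV -> R) (K : 'I_n -> rV -> R) x : nice g -> (forall i, lbm (K i)) ->
  \sum_i conv g (K i) x = conv g (fun z => \sum_i K i z) x.
Proof.
move=> ng lK; rewrite /conv -J_sum; last by move=> i; exact: nice_conv_in.
by apply: eq_J => y; rewrite mulr_sumr.
Qed.

Lemma convN (g K : rV -> R) x : nice g -> lbm K -> conv g (fun z => - K z) x = - conv g K x.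
Proof.
move=> ng lK; rewrite /conv -(JN (nice_conv_in x ng lK)).
by apply: eq_J => y; rewrite mulrN.
Qed.

Lemma sum_ddpot x : \sum_i ddpot i x =
  - (kap * conv W0 (nk_k N) x - \sum_j conv (W j) (nk_dk N j) x).
Proof.
rewrite /ddpot sumrB -mulr_sumr (sum_conv x nW0 (fun i => nkH_lbm N i i)) exchange_big/=.
rewrite (_ : (fun z => \sum_i nkH N i i z) = fun z => - nk_k N z); last first.
  by apply/funext => z; exact: nk_lap.
rewrite (convN x nW0 (nkk_lbm N)).
rewrite (eq_bigr (fun j => - conv (W j) (nk_dk N j) x)); last first.
  move=> j _; rewrite (sum_conv x (nW j) (fun i => nkT_lbm N j i)).
  rewrite (_ : (fun z => \sum_i nkT N j i z) = fun z => - nk_dk N j z).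
    by rewrite (convN x (nW j) (nkdk_lbm N j)).
  by apply/funext => z; exact: nk_dlap.
by rewrite sumrN; ring.
Qed.

(** Since [nk_k] is minus the Laplacian of the kernel, the potential solves
    [- Delta U = kap * W0 - div W] up to mollification; the mollifier, being
    even, is moved to the test function. *)
Lemma pot_green (psi : rV -> R) (dpsi : 'I_n -> rV -> R) :
  nice psi -> (forall i, nice (dpsi i)) ->
  (forall i x, is_derive x (e_ i) (psi : rV -> R^o) (dpsi i x)) ->
  ip1 dpot dpsi = kap * ip0 W0 (conv psi (nk_k N)) +
                  ip1 W (fun j => conv (dpsi j) (nk_k N)).
Proof.
move=> npsi ndpsi dpsiE.
have kN := nkk_even N.
have ks x y : nk_k N (x - y) = nk_k N (y - x) by rewrite -opprB kN.
have byp i : ip0 (dpot i) (dpsi i) = - J (fun x => ddpot i x * psi x).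
  rewrite (J_by_parts (lbm_dpot i) (lbm_ddpot i) npsi (ndpsi i) (dpot_der i) (dpsiE i)).
  by rewrite opprK.
rewrite /ip1 (eq_bigr _ (fun i _ => byp i)) sumrN -J_sum; last first.
  by move=> i; apply: niceMr => //; exact: lbm_ddpot.
pose A x := kap * (psi x * conv W0 (nk_k N) x).
pose B j x := psi x * conv (W j) (nk_dk N j) x.
have nA' : nice (fun x => psi x * conv W0 (nk_k N) x).
  by apply: niceMl => //; apply: conv_lbm => //; exact: nkk_lbm.
have nA : nice A by exact: niceZ.
have nB j : nice (B j).
  by apply: niceMl => //; apply: conv_lbm => //; exact: nkdk_lbm.
have -> : - J (fun x => \sum_i ddpot i x * psi x) = J A - \sum_j J (B j).
  rewrite -J_sum// -(JB nA (nice_sum _ nB)) -JN; last first.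
    by apply: nice_sum => i; apply: niceMr => //; exact: lbm_ddpot.
  apply: eq_J => x; rewrite -mulr_suml sum_ddpot /A /B -mulr_sumr; ring.
rewrite -sumrN /A (JZ _ nA'); congr (_ * _ + _).
  have [_ ->] := J_fubini_conv npsi nW0 (nkk_lbm N).
  by apply: eq_J => y; congr (_ * _); apply: eq_J => x; rewrite ks.
apply: eq_bigr => j _; rewrite /B.
have [_ ->] := J_fubini_conv npsi (nW j) (nkdk_lbm N j).
have inner y : J (fun x => psi x * nk_dk N j (x - y)) = - conv (dpsi j) (nk_k N) y.
  have dk x : is_derive x (e_ j) ((fun x => nk_k N (x - y)) : rV -> R^o) (nk_dk N j (x - y)).
    by apply: is_derive_shift_rV; exact: has_grad_partial (nkk_grad N) j _.
  have := J_by_parts (lbm_shift (- y) (nkk_lbm N)) (lbm_shift (- y) (nkdk_lbm N j))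
    npsi (ndpsi j) dk (dpsiE j).
  rewrite (_ : J (fun x => psi x * nk_dk N j (x - y)) = J (fun x => nk_dk N j (x + - y) * psi x)).
    move=> ->; congr (- _); apply: eq_J => x; by rewrite mulrC ks.
  by apply: eq_J => x; rewrite mulrC.
rewrite -JN.
  by apply: eq_J => y; rewrite inner mulrN opprK.
apply: niceMl => //; rewrite (_ : (fun y => _) = fun y => - conv (dpsi j) (nk_k N) y).
  by apply: lbmN; apply: conv_lbm => //; exact: nkk_lbm.
by apply/funext => y; exact: inner.
Qed.

End potential.

(** * Neighbourhoods of a compact set *)

Section neighbourhoods.
Context {R : realType} {n : nat}.
Notation rV := 'rV[R]_n.
Notation e_ i := (delta_mx ord0 i : rV).
Implicit Types (Om A U : set rV) (f : rV -> R).

(** Open neighbourhoods for the sup norm. *)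
Definition nb Om (s : R) : set rV := [set x | exists2 y, Om y & `|x - y| < s].

Lemma nb_open Om s : open (nb Om s).
Proof.
rewrite openE => x [y Oy xy]; apply/nbhs_ballP.
exists (s - `|x - y|); first by rewrite /= subr_gt0.
move=> z; rewrite -ball_normE/= => xz; exists y => //.
have := ler_normD (z - x) (x - y); rewrite addrA subrK => /le_lt_trans; apply.
by rewrite distrC -ltrBrDr.
Qed.

Lemma nb_sub Om s t : s <= t -> nb Om s `<=` nb Om t.
Proof. by move=> st x [y Oy xy]; exists y => //; exact: lt_le_trans st. Qed.

Lemma nb_self Om s : 0 < s -> Om `<=` nb Om s.
Proof. by move=> s0 x Ox; exists x => //; rewrite subrr normr0. Qed.

Lemma nb_step Om s t x y : nb Om s x -> `|x - y| < t -> nb Om (s + t) y.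
Proof.
move=> [z Oz xz] xy; exists z => //.
have := ler_normD (y - x) (x - z); rewrite addrA subrK => /le_lt_trans; apply.
by rewrite addrC ltrD// distrC.
Qed.

Lemma nb_cbox Om r s : Om `<=` cbox r -> 0 <= r -> 0 <= s -> nb Om s `<=` cbox (r + s).
Proof.
move=> Or r0 s0 x [y /Or/(cboxE y r0) yr xy]; apply/cboxE; first exact: addr_ge0.
have := ler_normD (x - y) y; rewrite subrK => /le_trans; apply.
by rewrite addrC lerD// ltW.
Qed.

Lemma compact_cbox Om : compact Om -> exists2 r, 0 <= r & Om `<=` cbox r.
Proof.
move=> cO; have /compact_bounded[M [_ bM]] := cO.
exists (`|M| + 1); first by rewrite addr_ge0.
move=> x Ox; apply/cboxE; first by rewrite addr_ge0.
apply: bM => //; apply: le_lt_trans (ler_norm M) _; by rewrite ltrDl.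
Qed.

(** Lebesgue numbers: uniform versions of local properties of pairs of points,
    such as continuity, with the second point ranging over a neighbourhood of
    the compact set. *)
Lemma compact_tube Om (P : rV -> rV -> Prop) : compact Om ->
  (forall x, Om x -> exists2 e : R, 0 < e &
     forall y z, `|y - x| < e -> `|z - x| < e -> P y z) ->
  exists2 s : R, 0 < s & forall x y, Om x -> `|x - y| < s -> P x y.
Proof.
move=> /compact_near_coveringP cO hP.
have := cO R (0 : R)^'+ (fun s x => forall y, `|x - y| < s -> P x y) _.
have cov : forall x, Om x -> \forall x' \near x & i \near (0 : R)^'+,
    (fun s x => forall y, `|x - y| < s -> P x y) i x'.
  move=> x /hP[e e0 he].
  have e20 : 0 < e / 2 by rewrite divr_gt0.
  exists ([set x' | `|x' - x| < e / 2], [set s | s < e / 2]).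
    split; last exact: nbhs_right_lt.
    apply/nbhs_ballP; exists (e / 2) => // y'; by rewrite -ball_normE/= distrC.
  move=> [x' s] /= [x'x se] y xy; apply: he.
    by apply: lt_trans x'x _; rewrite ltr_pdivrMr// ltr_pMr// ltr1n.
  have := ler_normD (y - x') (x' - x); rewrite addrA subrK => /le_lt_trans; apply.
  by rewrite [ltRHS]splitr ltrD// distrC; exact: lt_trans se.
move=> /(_ _ cov) /nbhs_right0P [d /= d0 hd].
exists (d / 2); first by rewrite divr_gt0.
have d2 : 0 < d / 2 by rewrite divr_gt0.
have db : ball_ (fun t : R => `|t|) 0 d (d / 2).
  by rewrite /ball_/= sub0r normrN gtr0_norm// ltr_pdivrMr// ltr_pMr// ltr1n.
by move=> x y Ox xy; apply: (hd _ db d2 x Ox y); rewrite add0r.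
Qed.

Lemma compact_tube_open Om U : compact Om -> open U -> Om `<=` U ->
  exists2 s : R, 0 < s & nb Om s `<=` U.
Proof.
move=> cO oU OU; have [x Ox|s s0 h] := @compact_tube Om (fun _ y => U y) cO.
  have /nbhs_ballP[e /= e0 eU] := open_nbhs_nbhs (conj oU (OU _ Ox)).
  by exists e => // _ z _ zx; apply: eU; rewrite -ball_normE/= distrC.
by exists s => // y [x Ox xy]; apply: (h x) => //; rewrite distrC.
Qed.

Lemma compact_tube_continuous Om f (w : R) : compact Om -> 0 < w ->
  (forall x, Om x -> {for x, continuous f}) ->
  exists2 s : R, 0 < s & forall x y, Om x -> `|x - y| < s -> `|f x - f y| <= w.
Proof.
move=> cO w0 cf; apply: compact_tube => // x Ox.
have w20 : 0 < w / 2 by rewrite divr_gt0.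
have /cvgrPdist_le/(_ _ w20)/nbhs_ballP[e /= e0 he] := cf x Ox.
exists e => // y z yx zx.
have h1 := he y; have h2 := he z; move: h1 h2; rewrite -!ball_normE/=.
rewrite ![`|x - _|]distrC => /(_ yx) h1 /(_ zx) h2.
have := ler_normD (f y - f x) (f x - f z); rewrite addrA subrK => /le_trans; apply.
by rewrite [leRHS]splitr lerD// distrC.
Qed.

Lemma compact_continuous_bounded Om f : compact Om ->
  (forall x, Om x -> {for x, continuous f}) ->
  exists2 M : R, 0 <= M & forall x, Om x -> `|f x| <= M.
Proof.
move=> cO cf.
have [M [Mreal hM]] : bounded_set (f @` Om : set R^o).
  apply: compact_bounded; apply: (@continuous_compact rV R^o f) => //.
  apply: continuous_in_subspaceT => x /set_mem; exact: cf.
exists (`|M| + 1) => [|x Ox]; first by rewrite addr_ge0.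
by apply: hM; [apply: le_lt_trans (ler_norm M) _; rewrite ltrDl|exists x].
Qed.

Lemma measurable_fun_open U f : open U ->
  (forall x, U x -> {for x, continuous f}) -> measurable_fun U f.
Proof.
move=> oU cf; apply: (@measurability _ _ _ _ _ _ _ (RGenOpens.measurableE R)).
move=> _ [_ [a [b ->]] <-]; apply: open_measurable_rV.
pose B : set rV := U `&` f @^-1` `]a, b[%classic.
suff : open B by [].
rewrite openE => x [Ux fx]; apply: filterI; first exact: open_nbhs_nbhs.
by apply: (cf x Ux); apply: open_nbhs_nbhs; split=> //; exact: interval_open.
Qed.

Lemma nice_restrict U A f r (M : R) : open U -> (forall x, U x -> {for x, continuous f}) ->
  measurable A -> A `<=` U -> A `<=` cbox r -> (forall x, A x -> `|f x| <= M) ->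
  nice (fun x => \1_A x * f x).
Proof.
move=> oU cf mA AU Ar fM.
have mf : measurable_fun A f by apply: (measurable_funS _ AU (measurable_fun_open oU cf)); exact: open_measurable_rV.
have E : (fun x => \1_A x * f x) = f \_ A.
  apply/funext => x; rewrite indicE patchE.
  by have [_|_] := boolP (x \in A); rewrite ?mul1r ?mul0r.
apply/niceP; split; first by rewrite E; apply/measurable_restrict => //; rewrite setTI.
exists (Num.max r 0), (Num.max M 0); split.
- by rewrite le_max lexx orbT.
- by rewrite le_max lexx orbT.
- move=> x; rewrite indicE; have [/set_mem/fM h|_] := boolP (x \in A).
    by rewrite mul1r le_max h.
  by rewrite mul0r normr0 le_max lexx orbT.
- move=> x xr; rewrite indicE memNset ?mul0r// => /Ar h; apply: xr.
  by apply: sub_cbox h; rewrite le_max lexx.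
Qed.

(** The indicators of the neighbourhoods converge pointwise to that of the
    compact, hence closed, set. *)
Lemma nb_volume Om (e : R) : compact Om -> 0 < e ->
  exists2 s0 : R, 0 < s0 & forall s, s <= s0 -> J \1_(nb Om s) <= J \1_Om + e.
Proof.
move=> cO e0.
have [r r0 Or] := compact_cbox cO.
have p2 k : 0 < 2 ^- k :> R by rewrite invr_gt0 exprn_gt0.
have p21 k : 2 ^- k <= 1 :> R by rewrite invf_le1 ?exprn_gt0// exprn_ege1// ler1n.
have nbr k : nb Om (2 ^- k) `<=` cbox (r + 1).
  by apply: subset_trans (nb_sub (p21 k)) _; exact: nb_cbox.
have r10 : 0 <= r + 1 by rewrite addr_ge0.
have [||||_ cv] := @J_dct R n (fun k => \1_(nb Om (2 ^- k))) \1_Om (r + 1) 1 r10.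
- by move=> k; apply: measurable_indic; apply: open_measurable_rV; exact: nb_open.
- by move=> k x; rewrite indicE; case: (_ \in _); rewrite ?normr1 ?normr0.
- by move=> k x xr; rewrite indicE memNset// => /nbr.
- move=> x; have [Ox|Ox] := pselect (Om x).
    apply: cvg_near_cst; apply: nearW => k.
    by rewrite !indicE !mem_set//; apply: nb_self.
  have clO : closed Om by apply: compact_closed => //; exact: norm_hausdorff.
  have /nbhs_ballP[d /= d0 hd] : nbhs x (~` Om).
    by apply: open_nbhs_nbhs; split=> //; exact: closed_openC.
  apply: cvg_near_cst; near=> k.
  rewrite !indicE !memNset// => -[y Oy xy]; apply: (hd y) => //.
  rewrite -ball_normE/=; apply: lt_trans xy _.
  near: k; have /cvgr_lt := @cvg_2V R; apply; exact: d0.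
have /cvgrPdist_le/(_ _ e0)[k _ /(_ k (leqnn k)) hk] := cv.
exists (2 ^- k) => // s sk.
apply: (@le_trans _ _ (J \1_(nb Om (2 ^- k)))); last first.
  by move: hk; rewrite /= ler_norml => /andP[]; lra.
have nn t : t <= 2 ^- k -> nice (\1_(nb Om t) : rV -> R).
  move=> tk; apply: nice_indic; first by apply: open_measurable_rV; exact: nb_open.
  by exists (r + 1); apply: subset_trans (nb_sub tk) (nbr k).
apply: le_J => [||x]; [exact: nn|exact: nn|rewrite !indicE ler_nat].
have [/set_mem/(nb_sub sk) h|_] := boolP (x \in nb Om s); last by [].
by rewrite mem_set.
Unshelve. all: end_near. Qed.

End neighbourhoods.

(** * Jets, variance and energy on a compact set *)

Section jets.
Context {R : realType} {n : nat}.
Notation rV := 'rV[R]_n.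
Notation e_ i := (delta_mx ord0 i : rV).
Variable (Om : set rV).
Implicit Types (f g h : rV -> R).

Lemma smooth_on_data h : smooth_on Om h -> exists U, [/\ open U, Om `<=` U,
  forall x, U x -> {for x, continuous h},
  forall i x, U x -> {for x, continuous (partial i h)} &
  forall i x, U x -> is_derive x (e_ i) (h : rV -> R^o) (partial i h x)].
Proof.
move=> [U [oU OU sh]]; exists U; split=> //.
- by move=> x Ux; have [] := sh [::] x Ux.
- by move=> i x Ux; have [] := sh [:: i] x Ux.
- by move=> i x Ux; have [_ /(_ i) /derivableP] := sh [::] x Ux.
Qed.

Lemma partial_lin U f g c i x : open U -> U x ->
  is_derive x (e_ i) (f : rV -> R^o) (partial i f x) ->
  is_derive x (e_ i) (g : rV -> R^o) (partial i g x) ->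
  is_derive x (e_ i) ((fun y => f y + c * g y) : rV -> R^o) (partial i f x + c * partial i g x).
Proof.
move=> oU Ux df dg.
have h := @is_deriveZ R rV R^o g c x (e_ i) _ dg.
exact: (@is_deriveD R rV R^o f _ x (e_ i) _ _ df h).
Qed.

Lemma smooth_in_lin U f g c : open U -> smooth_in U f -> smooth_in U g ->
  smooth_in U (fun x => f x + c * g x).
Proof.
move=> oU sf sg.
pose C (F : rV -> R) := exists s, F = fun y => iter_partial s f y + c * iter_partial s g y.
apply: (@smooth_in_class R n U C oU); last by exists [::].
- move=> F [s ->] x Ux; have [cf _] := sf s x Ux; have [cg _] := sg s x Ux.
  apply: (@cvgD R R^o _ (nbhs x) (nbhs_filter x)) => //.
  by apply: (@cvgM R _ (nbhs x) (nbhs_filter x)) => //; exact: cvg_cst.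
- move=> F [s ->] i; exists (fun y => iter_partial (i :: s) f y + c * iter_partial (i :: s) g y).
  split; first by exists (i :: s).
  move=> x Ux; have [_ /(_ i)/derivableP df] := sf s x Ux.
  have [_ /(_ i)/derivableP dg] := sg s x Ux.
  exact: (@partial_lin U _ _ c i x oU Ux df dg).
Qed.

Lemma smooth_on_lin f g c : smooth_on Om f -> smooth_on Om g ->
  smooth_on Om (fun x => f x + c * g x).
Proof.
move=> [U [oU OU sf]] [V [oV OV sg]]; exists (U `&` V); split.
- exact: openI.
- by move=> x Ox; split; [exact: OU|exact: OV].
- apply: smooth_in_lin; first exact: openI.
  + by move=> s x [Ux _]; exact: sf.
  + by move=> s x [_ Vx]; exact: sg.
Qed.

Lemma partial_on_lin f g c i x : smooth_on Om f -> smooth_on Om g -> Om x ->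
  partial i (fun y => f y + c * g y) x = partial i f x + c * partial i g x.
Proof.
move=> /smooth_on_data[U [oU OU _ _ df]] /smooth_on_data[V [oV OV _ _ dg]] Ox.
by apply: partialE; apply: (@partial_lin U) => //; [exact: OU|apply: df; exact: OU|apply: dg; exact: OV].
Qed.

Lemma laplacian_lin f g c x : smooth_on Om f -> smooth_on Om g -> Om° x ->
  laplacian (fun y => f y + c * g y) x = laplacian f x + c * laplacian g x.
Proof.
move=> sf sg Ox; rewrite /laplacian mulr_sumr -big_split/=; apply: eq_bigr => i _.
have Ox' := interior_subset Ox.
have [U [oU OU sfU]] := sf; have [V [oV OV sgV]] := sg.
transitivity (partial i (fun y => partial i f y + c * partial i g y) x).
  apply: (@near_eq_derive R rV R^o).
  near=> y; apply: (@partial_on_lin f g c i y sf sg).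
  by near: y; exact: Ox.
apply: partialE; apply: (@partial_lin U) => //; first exact: OU.
  by have [_ /(_ i)/derivableP] := sfU [:: i] x (OU _ Ox').
by have [_ /(_ i)/derivableP] := sgV [:: i] x (OV _ Ox').
Unshelve. all: end_near. Qed.

Lemma harmonic_on_lin f g c : harmonic_on Om f -> harmonic_on Om g ->
  harmonic_on Om (fun x => f x + c * g x).
Proof.
move=> [sf hf] [sg hg]; split; first exact: smooth_on_lin.
by move=> x Ox; rewrite laplacian_lin// hf// hg// mulr0 addr0.
Qed.

Lemma partial_cst i (c : R) : partial i (fun _ : rV => c) = fun=> 0.
Proof. by apply/funext => x; apply: partialE; exact: is_derive_cst. Qed.

Lemma partial_coord i j : partial i (fun y : rV => y ord0 j) = fun=> (i == j)%:R.
Proof.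
by apply/funext => x; apply: partialE; exact: (has_grad_partial (has_grad_coord j)).
Qed.

Lemma harmonic_on_cst (c : R) : harmonic_on Om (fun=> c).
Proof.
split; last first.
  by move=> x _; rewrite /laplacian big1// => i _; rewrite !partial_cst.
exists setT; split=> //; first exact: openT.
apply: (@smooth_in_class R n setT (fun F => exists c, F = fun=> c) openT); last by exists c.
- by move=> F [d ->] x _; exact: cst_continuous.
- move=> F [d ->] i; exists (fun=> 0); split; first by exists 0.
  by move=> x _; exact: is_derive_cst.
Qed.

Lemma harmonic_on_coord j : harmonic_on Om (fun x => x ord0 j).
Proof.
split; last first.
  by move=> x _; rewrite /laplacian big1// => i _; rewrite partial_coord partial_cst.
exists setT; split=> //; first exact: openT.
apply: (@smooth_in_class R n setT
  (fun F => (exists c, F = fun=> c) \/ F = fun x => x ord0 j) openT); last by right.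
- move=> F [[d ->]|->] x _; first exact: cst_continuous.
  exact: coord_continuous.
- move=> F [[d ->]|->] i.
    exists (fun=> 0); split; first by left; exists 0.
    by move=> x _; exact: is_derive_cst.
  exists (fun=> (i == j)%:R); split; first by left; exists (i == j)%:R.
  by move=> x _; exact: (has_grad_partial (has_grad_coord j)).
Qed.

(** The jet of a function on [Om], that is, its value and its gradient, extended
    by 0.  The gradient is truncated, not the gradient of a truncation. *)
Definition r0 h (x : rV) := \1_Om x * h x.
Definition r1 h (i : 'I_n) (x : rV) := \1_Om x * partial i h x.

Lemma r0_lin f g c : r0 (fun x => f x + c * g x) = fun x => r0 f x + c * r0 g x.
Proof. by apply/funext => x; rewrite /r0; ring. Qed.

Lemma r1_lin f g c : smooth_on Om f -> smooth_on Om g ->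
  r1 (fun x => f x + c * g x) = fun i x => r1 f i x + c * r1 g i x.
Proof.
move=> sf sg; apply/funext => i; apply/funext => x; rewrite /r1 indicE.
have [/set_mem Ox|_] := boolP (x \in Om); last by rewrite !mul0r; ring.
by rewrite (partial_on_lin c i sf sg Ox) !mul1r.
Qed.

Hypothesis cOm : compact Om.
Let mOm : measurable Om := compact_measurable_rV cOm.

Lemma nice_r0 h : smooth_on Om h -> nice (r0 h).
Proof.
move=> /smooth_on_data[U [oU OU ch _ _]].
have [r _ Or] := compact_cbox cOm.
have [M _ hM] := compact_continuous_bounded cOm (fun x Ox => ch x (OU _ Ox)).
exact: (nice_restrict oU ch mOm OU Or hM).
Qed.

Lemma nice_r1 h i : smooth_on Om h -> nice (r1 h i).
Proof.
move=> /smooth_on_data[U [oU OU _ ch _]].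
have [r _ Or] := compact_cbox cOm.
have [M _ hM] := compact_continuous_bounded cOm (fun x Ox => ch i x (OU _ Ox)).
exact: (nice_restrict oU (ch i) mOm OU Or hM).
Qed.

Lemma nice_indOm : nice (\1_Om : rV -> R).
Proof. by have [r _ Or] := compact_cbox cOm; apply: nice_indic => //; exists r. Qed.

Notation vol := (J (\1_Om : rV -> R)).

Lemma J_indE : (vol%:E = lebesgue_rV n Om)%E.
Proof.
rewrite (JE nice_indOm) integral_indic//; by rewrite setIT.
Qed.

Lemma vol_gt0 : Om° !=set0 -> 0 < vol.
Proof.
move=> [x /nbhs_ballP[e /= e0 he]].
have e20 : 0 < e / 2 by rewrite divr_gt0.
apply: lt_le_trans (_ : (2 * (e / 2)) ^+ n <= _); first by rewrite exprn_gt0// mulr_gt0.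
rewrite -(J_cbox (ltW e20)) -(J_shift (- x) (nice_cbox (e / 2))).
apply: le_J => [||y]; [exact: nice_shift (nice_cbox _)|exact: nice_indOm|].
rewrite !indicE ler_nat; have [/set_mem h|_] := boolP (y + - x \in _); last by [].
rewrite mem_set//; apply: he; rewrite -ball_normE/= distrC.
move/(cboxE _ (ltW e20)) : h => /le_lt_trans; apply.
by rewrite ltr_pdivrMr// ltr_pMr// ltr1n.
Qed.

Hypothesis vol0 : 0 < vol.

(** The uniform probability is the restriction of Lebesgue measure divided by
    the volume; from here on only [J] is used. *)
Lemma unifE f : nice (fun x => \1_Om x * f x) ->
  \int[unif mOm]_(x in Om) f x = J (fun x => \1_Om x * f x) / vol.
Proof.
move=> nf.
have c0 : 0 <= vol^-1 by rewrite invr_ge0 ltW.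
have E : (\int[unif mOm]_(x in Om) (f x)%:E =
    \int[mscale (NngNum c0) (lebesgue_rV n)]_(x in Om) (f x)%:E)%E.
  apply: eq_measure_integral => A mA AO.
  rewrite /unif /= /mnormalize /= /mrestr setTI -J_indE.
  rewrite eqe gt_eqF//= /mscale/= setIidl// muleC.
  by congr (_ * _)%E.
have mf : measurable_fun Om f.
  apply: (@eq_measurable_fun _ _ _ _ _ (fun x => \1_Om x * f x)).
    by move=> x xO; rewrite indicE xO mul1r.
  exact: measurable_funS (nice_meas nf).
have intf : (lebesgue_rV n).-integrable Om (EFin \o f).
  apply/(integrable_mkcond _ mOm).
  rewrite (_ : (EFin \o f) \_ Om = EFin \o (fun x => \1_Om x * f x)).
    exact: nice_integrable.
  apply/funext => x; rewrite patchE /= indicE.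
  by have [_|_] := boolP (x \in Om); rewrite ?mul1r ?mul0r.
have JfE : (J (fun x => \1_Om x * f x))%:E = (\int[lebesgue_rV n]_(x in Om) (f x)%:E)%E.
  rewrite (JE nf) [RHS]integral_mkcond; apply: eq_integral => x _.
  rewrite patchE indicE.
  by have [_|_] := boolP (x \in Om); rewrite ?mul1r ?mul0r.
rewrite /Rintegral E integralE.
have mp : measurable_fun Om (fun x => (f x)%:E) by exact/measurable_EFinP.
rewrite ge0_integral_mscale//; last exact: measurable_funepos.
rewrite ge0_integral_mscale//; last exact: measurable_funeneg.
have fp := integrable_pos_fin_num mOm intf.
have fn := integrable_neg_fin_num mOm intf.
rewrite -muleBr//; last exact: fin_num_adde_defr.
have -> : (\int[lebesgue_rV n]_(x in Om) (fun x0 => (f x0)%:E)^\+ x -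
   \int[lebesgue_rV n]_(x in Om) (fun x0 => (f x0)%:E)^\- x =
   (J (fun x => \1_Om x * f x))%:E)%E by rewrite JfE [RHS]integralE.
by rewrite /= mulrC.
Qed.

(** Variance and energy expressed by whole space integrals of jets. *)
Definition var0 h := ip0 (r0 h) (r0 h) / vol - (J (r0 h) / vol) ^+ 2.
Definition en0 h := ip1 (r1 h) (r1 h) / vol.

Lemma indic_idem (x : rV) : \1_Om x * \1_Om x = \1_Om x :> R.
Proof. by rewrite indicE; case: (_ \in _); rewrite ?mul1r ?mul0r. Qed.

Lemma var_unifE h : smooth_on Om h -> var_unif mOm h = var0 h.
Proof.
move=> sh; have nh := nice_r0 sh.
rewrite /var_unif /var0 (unifE nh).
have E : (fun x => \1_Om x * h x ^+ 2) = fun x => r0 h x * r0 h x.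
  apply/funext => x; rewrite /r0 -[in LHS](indic_idem x); ring.
by rewrite unifE E//; exact: nice_mul.
Qed.

Lemma energy_unifE h : smooth_on Om h -> energy_unif mOm h = en0 h.
Proof.
move=> sh; have nh i := nice_r1 i sh.
rewrite /energy_unif /en0.
have E : (fun x => \1_Om x * sqnorm2 (grad h x)) = fun x => \sum_i r1 h i x * r1 h i x.
  apply/funext => x; rewrite /sqnorm2 mulr_sumr; apply: eq_bigr => i _.
  rewrite mxE /r1 -[in LHS](indic_idem x); ring.
have nE : nice (fun x => \sum_i r1 h i x * r1 h i x).
  by apply: nice_sum => i; exact: nice_mul.
rewrite unifE ?E//; congr (_ / _).
by rewrite J_sum// => i; exact: nice_mul.
Qed.

End jets.

(** * Truncated potentials *)

Section cutoff.
Context {R : realType} {n : nat}.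
Notation rV := 'rV[R]_n.
Notation e_ i := (delta_mx ord0 i : rV).
Variables (Om : set rV) (tau : R) (N : @newton_kernel R n tau).
Hypotheses (cOm : compact Om) (tau0 : 0 < tau).

Lemma nice_nb s : nice (\1_(nb Om s) : rV -> R).
Proof.
have [r r0 Or] := compact_cbox cOm.
apply: nice_indic; first by apply: open_measurable_rV; exact: nb_open.
exists (r + `|s|); apply: subset_trans (nb_sub (ler_norm s)) _.
exact: nb_cbox.
Qed.

(** A [C^1] cutoff, equal to 1 on the [tau]-neighbourhood of [Om] and to 0
    outside its [3 * tau]-neighbourhood. *)
Definition chi : rV -> R := conv \1_(nb Om (2 * tau)) (nk_k N).
Definition dchi i : rV -> R := conv \1_(nb Om (2 * tau)) (nk_dk N i).

Lemma chi_lbm : lbm chi.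
Proof. by apply: conv_lbm; [exact: nice_nb|exact: nkk_lbm]. Qed.

Lemma dchi_lbm i : lbm (dchi i).
Proof. by apply: conv_lbm; [exact: nice_nb|exact: nkdk_lbm]. Qed.

Lemma chi_grad : has_grad chi dchi.
Proof.
apply: conv_has_grad; [exact: nice_nb|exact: nkk_lbm|exact: nkdk_lbm|exact: nkk_grad].
Qed.

Lemma nk_sym x y : nk_k N (x - y) = nk_k N (y - x).
Proof. by rewrite -opprB nkk_even. Qed.

Lemma nk_mass x : J (fun y => nk_k N (x - y)) = 1.
Proof.
rewrite -(nkk_int N) -(J_shift (- x) (nk_nice N)).
by apply: eq_J => y; exact: nk_sym.
Qed.

Lemma nk_nice_refl x : nice (fun y => nk_k N (x - y)).
Proof.
by rewrite (_ : (fun y => nk_k N (x - y)) = fun y => nk_k N (y + - x));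
  [exact: (nice_shift _ (nk_nice N))|apply/funext => y; exact: nk_sym].
Qed.

Lemma chi_in x : nb Om tau x -> chi x = 1.
Proof.
move=> xO; rewrite -(nk_mass x); apply: eq_J => y.
have [h|h] := leP tau `|x - y|; first by rewrite (nkk_supp N h) mulr0.
rewrite indicE mem_set ?mul1r//.
by rewrite (_ : 2 * tau = tau + tau); [exact: nb_step h|ring].
Qed.

Lemma chi_out x : ~ nb Om (3 * tau) x -> chi x = 0.
Proof.
move=> xO; rewrite /chi /conv -[RHS](@J0 R n); apply: eq_J => y.
have [h|h] := leP tau `|x - y|; first by rewrite (nkk_supp N h) mulr0.
rewrite indicE memNset ?mul0r// => yO; apply: xO.
rewrite (_ : 3 * tau = 2 * tau + tau); last by ring.
by apply: (nb_step yO); rewrite distrC.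
Qed.

Lemma chi_bound x : `|chi x| <= 1.
Proof.
have n1 := nice_conv_in x (nice_nb (2 * tau)) (nkk_lbm N).
have h y : 0 <= \1_(nb Om (2 * tau)) y * nk_k N (x - y).
  by rewrite mulr_ge0 ?nkk_ge0// indicE ler0n.
rewrite ger0_norm; last exact: J_ge0.
rewrite -(nk_mass x); apply: le_J => [||y]; [exact: n1|exact: nk_nice_refl|].
by rewrite ler_piMl ?nkk_ge0// indicE; case: (_ \in _).
Qed.

Lemma near_shift x (P : rV -> Prop) (s : R) : 0 < s ->
  (forall y, `|x - y| < s -> P y) -> \forall y \near x, P y.
Proof.
move=> s0 h; apply/nbhs_ballP; exists s => // y; rewrite -ball_normE/=; exact: h.
Qed.

Lemma dchi_in i x : nb Om tau x -> dchi i x = 0.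
Proof.
move=> xO.
have cc : \forall y \near x, (fun _ : rV => 1 : R^o) y = chi y.
  have := open_nbhs_nbhs (conj (@nb_open R n Om tau) xO); apply: filterS => y yO.
  by rewrite chi_in.
have h1 := near_eq_is_derive cc (is_derive_cst (1 : R^o) x (e_ i)).
have h2 := has_grad_partial chi_grad i x.
by rewrite -(partialE h2) (partialE h1).
Qed.

Lemma chi_near_out x : ~ nb Om (4 * tau) x -> \forall y \near x, chi y = 0.
Proof.
move=> xO; apply: (near_shift tau0) => y xy; apply: chi_out => yO; apply: xO.
rewrite (_ : 4 * tau = 3 * tau + tau); last by ring.
by apply: (nb_step yO); rewrite distrC.
Qed.

Lemma dchi_out i x : ~ nb Om (4 * tau) x -> dchi i x = 0.
Proof.
move=> xO.
have cc : \forall y \near x, (fun _ : rV => 0 : R^o) y = chi y.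
  by have := chi_near_out xO; apply: filterS => y ->.
have h1 := near_eq_is_derive cc (is_derive_cst (0 : R^o) x (e_ i)).
have h2 := has_grad_partial chi_grad i x.
by rewrite -(partialE h2) (partialE h1).
Qed.

Lemma chi_out4 x : ~ nb Om (4 * tau) x -> chi x = 0.
Proof.
move=> xO; apply: chi_out => h; apply: xO; apply: nb_sub h.
by rewrite ler_pM2r// ler_nat.
Qed.

Lemma dchi_bound : exists2 C, 0 <= C & forall i x, `|dchi i x| <= C.
Proof.
have [r r0 Or] := compact_cbox cOm.
have rb : nb Om (4 * tau) `<=` cbox (r + 4 * tau).
  by apply: nb_cbox => //; rewrite mulr_ge0// ltW.
have rt0 : 0 <= r + 4 * tau by rewrite addr_ge0// mulr_ge0// ltW.
have lS : lbm (fun x => \sum_i `|dchi i x|).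
  by apply: lbm_sum => i; apply: lbm_norm; exact: dchi_lbm.
have [C hC] := lS.2 (r + 4 * tau).
exists (Num.max C 0) => [|i x]; first by rewrite le_max lexx orbT.
have [/rb/(cboxE x rt0)/hC h|/dchi_out ->] := pselect (nb Om (4 * tau) x); last first.
  by rewrite normr0 le_max lexx orbT.
rewrite le_max; apply/orP; left; apply: le_trans h; apply: le_trans (ler_norm _).
by rewrite (bigD1 i)//= lerDl sumr_ge0.
Qed.

Section potential_cutoff.
Variables (kap : R) (W0 : rV -> R) (W : 'I_n -> rV -> R).
Hypotheses (kap0 : 0 <= kap) (nW0 : nice W0) (nW : forall j, nice (W j)).
Hypotheses (W0O : forall x, \1_Om x * W0 x = W0 x) (WO : forall j x, \1_Om x * W j x = W j x).

Let U := pot kap N W0 W.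
Let dU := dpot kap N W0 W.

Definition cutpot (x : rV) := chi x * U x.
Definition dcutpot i (x : rV) := chi x * dU i x + U x * dchi i x.

Lemma cutpot_out x : ~ nb Om (4 * tau) x -> cutpot x = 0 /\ forall i, dcutpot i x = 0.
Proof.
move=> xO; rewrite /cutpot /dcutpot (chi_out4 xO) mul0r; split=> // i.
by rewrite (dchi_out i xO) mul0r mulr0 addr0.
Qed.

(** On the [tau]-neighbourhood the cutoff is locally constant, so gradients
    agree as well. *)
Lemma cutpot_in x : nb Om tau x -> cutpot x = U x /\ forall i, dcutpot i x = dU i x.
Proof.
move=> xO; rewrite /cutpot /dcutpot (chi_in xO) mul1r; split=> // i.
by rewrite (dchi_in i xO) mul1r mulr0 addr0.
Qed.

Lemma nice_off_nb s (f : rV -> R) : lbm f -> (forall x, ~ nb Om s x -> f x = 0) -> nice f.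
Proof.
move=> lf fO; split=> //; have [r r0 Or] := compact_cbox cOm.
have rs0 : 0 <= r + `|s| by rewrite addr_ge0.
exists (r + `|s|) => x xr; apply: fO => /(nb_sub (ler_norm s)).
move=> /(nb_cbox Or r0 (normr_ge0 s))/(cboxE x rs0).
by rewrite leNgt xr.
Qed.

Lemma nice_cutpot : nice cutpot.
Proof.
apply: (@nice_off_nb (4 * tau)); last by move=> x /cutpot_out[].
by apply: lbmM; [exact: chi_lbm|exact: lbm_pot].
Qed.

Lemma nice_dcutpot i : nice (dcutpot i).
Proof.
apply: (@nice_off_nb (4 * tau)); last by move=> x /cutpot_out[].
by apply: lbmD; apply: lbmM; [exact: chi_lbm|exact: lbm_dpot|exact: lbm_pot|exact: dchi_lbm].
Qed.

Lemma cutpot_grad : has_grad cutpot dcutpot.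
Proof. exact: has_gradM chi_grad (pot_grad kap N nW0 nW). Qed.

(** The right-hand side of Green's identity. The jet is supported in [Om], so
    [young_restricted] removes the mollifier from the test function. *)
Lemma weak_rhs_le (psi : rV -> R) (dpsi : 'I_n -> rV -> R) :
  nice psi -> (forall i, nice (dpsi i)) ->
  kap * ip0 W0 (conv psi (nk_k N)) + ip1 W (fun j => conv (dpsi j) (nk_k N)) <=
  kap * (Num.sqrt (ip0 W0 W0) * Num.sqrt (ip0 psi psi)) +
  Num.sqrt (ip1 W W) * Num.sqrt (ip1 dpsi dpsi).
Proof.
move=> npsi ndpsi.
have nO := nice_indOm cOm.
have nc (g : rV -> R) : nice g -> nice (fun x => \1_Om x * conv g (nk_k N) x).
  by move=> ng; apply: niceMl => //; apply: conv_lbm => //; exact: nkk_lbm.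
have y0 (g : rV -> R) (ng : nice g) := young_restricted (nk_nice N) ng nO
  (nkk_ge0 N) (nkk_even N) (nkk_int N).
have E (V g : rV -> R) : (forall x, \1_Om x * V x = V x) ->
    ip0 V (conv g (nk_k N)) = ip0 V (fun x => \1_Om x * conv g (nk_k N) x).
  move=> VO; apply: eq_J => x; rewrite -[in LHS](VO x); ring.
apply: lerD.
  apply: ler_wpM2l => //; rewrite E//; apply: le_trans (ler_norm _) _.
  apply: le_trans (ip0_CS nW0 (nc _ npsi)) _.
  by rewrite ler_wpM2l ?sqrtr_ge0// ler_wsqrtr//; exact: y0.
rewrite /ip1 (eq_bigr (fun i => ip0 (W i) (fun x => \1_Om x * conv (dpsi i) (nk_k N) x))); last first.
  by move=> i _; exact: E.
apply: le_trans (ler_norm _) _.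
apply: le_trans (@ip1_CS R n W (fun i x => \1_Om x * conv (dpsi i) (nk_k N) x) nW
  (fun i => nc _ (ndpsi i))) _.
rewrite ler_wpM2l ?sqrtr_ge0// ler_wsqrtr// /ip1.
by apply: ler_sum => i _; exact: y0.
Qed.

Hypothesis (e : R) (e0 : 0 <= e).
Hypothesis tailU : forall x, nb Om (4 * tau) x -> ~ nb Om tau x ->
  `|U x| <= e /\ forall i, `|dU i x| <= e.

Variables (C : R) (C0 : 0 <= C) (hC : forall i x, `|dchi i x| <= C).

Lemma dcutpot_tail i x : ~ nb Om tau x -> `|dcutpot i x| <= (1 + C) * e.
Proof.
move=> xt; have [x4|/cutpot_out[_ ->]] := pselect (nb Om (4 * tau) x); last first.
  by rewrite normr0 mulr_ge0// addr_ge0.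
have [hU hd] := tailU x4 xt.
rewrite /dcutpot; apply: le_trans (ler_normD _ _) _.
rewrite [leRHS]mulrDl !normrM; apply: lerD.
  by rewrite ler_pM ?chi_bound.
by rewrite [leRHS]mulrC ler_pM.
Qed.

(** Green's identity tested with the truncated potential.  Replacing the gradient
    of the potential by that of its truncation costs an error outside the
    [tau]-neighbourhood only, where both are of size [e]. *)
Lemma cutpot_energy :
  ip1 dcutpot dcutpot <=
  kap * (Num.sqrt (ip0 W0 W0) * Num.sqrt (ip0 cutpot cutpot)) +
  Num.sqrt (ip1 W W) * Num.sqrt (ip1 dcutpot dcutpot) +
  n%:R * ((2 + C) * e) ^+ 2 * J \1_(nb Om (4 * tau)).
Proof.
have nV := nice_cutpot; have ndV := nice_dcutpot.
have nT := nice_nb (4 * tau).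
have green := pot_green kap N nW0 nW nV ndV (fun i x => has_grad_partial cutpot_grad i x).
have hw := weak_rhs_le nV ndV; rewrite -green in hw.
suff h : ip1 dcutpot dcutpot - ip1 dU dcutpot <=
    n%:R * ((2 + C) * e) ^+ 2 * J \1_(nb Om (4 * tau)) by rewrite /dU in h *; lra.
rewrite /ip1 -sumrB -[leRHS]mulrA.
apply: le_trans (_ : \sum_(i < n) (((2 + C) * e) ^+ 2 * J \1_(nb Om (4 * tau))) <= _); last first.
  by rewrite sumr_const card_ord -[leLHS]mulr_natl.
apply: ler_sum => i _.
have n1 : nice (fun x => dcutpot i x * dcutpot i x) by exact: nice_mul.
have n2 : nice (fun x => dU i x * dcutpot i x) by apply: niceMr => //; exact: lbm_dpot.
rewrite /ip0 -(JB n1 n2) -(JZ _ nT); apply: le_J => [||x]; [exact: niceB|exact: niceZ|].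
have rhs0 : 0 <= ((2 + C) * e) ^+ 2 * \1_(nb Om (4 * tau)) x.
  by rewrite mulr_ge0 ?sqr_ge0// indicE ler0n.
have [xt|xt] := pselect (nb Om tau x).
  by have [_ ->] := cutpot_in xt; rewrite subrr.
have [x4|/cutpot_out[_ ->]] := pselect (nb Om (4 * tau) x); last by rewrite !mulr0 subrr.
rewrite -mulrBl indicE mem_set// mulr1 expr2; apply: le_trans (ler_norm _) _.
have h1 := dcutpot_tail i xt; have [_ /(_ i) h2] := tailU x4 xt.
rewrite normrM; apply: ler_pM => //.
  by apply: le_trans (ler_normB _ _) _; rewrite (_ : (2 + C) * e = (1 + C) * e + e);
    [exact: lerD|ring].
by apply: le_trans h1 _; rewrite ler_wpM2r//; lra.
Qed.

End potential_cutoff.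

End cutoff.

(** * Testing the potential against a smooth function *)

Section lower_bound.
Context {R : realType} {n : nat}.
Notation rV := 'rV[R]_n.
Notation e_ i := (delta_mx ord0 i : rV).
Variables (Om : set rV) (tau : R) (N : @newton_kernel R n tau).
Hypotheses (cOm : compact Om) (tau0 : 0 < tau).
Variables (kap : R) (W0 : rV -> R) (W : 'I_n -> rV -> R).
Hypotheses (kap0 : 0 <= kap) (nW0 : nice W0) (nW : forall j, nice (W j)).
Hypotheses (W0O : forall x, \1_Om x * W0 x = W0 x) (WO : forall j x, \1_Om x * W j x = W j x).
Variables (e C : R).
Hypotheses (e0 : 0 <= e) (C0 : 0 <= C).
Hypothesis tailU : forall x, nb Om (4 * tau) x -> ~ nb Om tau x ->
  `|pot kap N W0 W x| <= e /\ forall i, `|dpot kap N W0 W i x| <= e.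
Hypothesis hC : forall i x, `|dchi Om N i x| <= C.
Variables (U : set rV) (w : rV -> R) (M om : R).
Hypotheses (oU : open U) (nbU : nb Om (4 * tau) `<=` U) (M0 : 0 <= M).
Hypothesis cw : forall x, U x -> {for x, continuous w}.
Hypothesis cdw : forall i x, U x -> {for x, continuous (partial i w)}.
Hypothesis dw : forall i x, U x -> is_derive x (e_ i) (w : rV -> R^o) (partial i w x).
Hypothesis wM : forall x, nb Om (4 * tau) x -> `|w x| <= M.
Hypothesis dwM : forall i x, nb Om (4 * tau) x -> `|partial i w x| <= M.
Hypothesis wom : forall y x, Om y -> `|y - x| < tau -> `|w y - w x| <= om.
Hypothesis dwom : forall i y x, Om y -> `|y - x| < tau ->
  `|partial i w y - partial i w x| <= om.

Let D := nb Om (4 * tau).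
Let psi (x : rV) := \1_D x * w x * chi Om N x.
Let dpsi i (x : rV) := \1_D x * partial i w x * chi Om N x + \1_D x * w x * dchi Om N i x.

Let mD : measurable D. Proof. by apply: open_measurable_rV; exact: nb_open. Qed.

Let Dr : exists r, D `<=` cbox r.
Proof.
have [r r0 Or] := compact_cbox cOm; exists (r + 4 * tau).
by apply: nb_cbox => //; rewrite mulr_ge0// ltW.
Qed.

Let nw : nice (fun x => \1_D x * w x).
Proof. by have [r hr] := Dr; exact: (nice_restrict oU cw mD nbU hr wM). Qed.

Let ndw i : nice (fun x => \1_D x * partial i w x).
Proof. by have [r hr] := Dr; exact: (nice_restrict oU (@cdw i) mD nbU hr (@dwM i)). Qed.

Let npsi : nice psi.
Proof. by apply: niceMl nw _; exact: chi_lbm. Qed.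

Let ndpsi i : nice (dpsi i).
Proof.
by apply: niceD; [apply: niceMl (ndw i) _; exact: chi_lbm|apply: niceMl nw _; exact: dchi_lbm].
Qed.

Let psi_der i x : is_derive x (e_ i) (psi : rV -> R^o) (dpsi i x).
Proof.
have [xD|xD] := pselect (D x); last first.
  have -> : dpsi i x = 0 by rewrite /dpsi indicE memNset// !mul0r addr0.
  have cc : \forall y \near x, (fun _ : rV => 0 : R^o) y = psi y.
    by have := chi_near_out N tau0 xD; apply: filterS => y hy; rewrite /psi hy mulr0.
  exact: near_eq_is_derive cc (is_derive_cst (0 : R^o) x (e_ i)).
have cc : \forall y \near x, ((fun y => w y * chi Om N y) : rV -> R^o) y = psi y.
  have := open_nbhs_nbhs (conj (@nb_open R n Om (4 * tau)) xD); apply: filterS => y yD.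
  by rewrite /psi indicE mem_set// mul1r.
have h := @is_deriveM R rV w (chi Om N) x (e_ i) _ _ (dw i (nbU xD))
  (has_grad_partial (chi_grad N cOm) i x).
have -> : dpsi i x = w x *: (dchi Om N i x : R^o) + chi Om N x *: (partial i w x : R^o).
  by rewrite /dpsi indicE mem_set// !mul1r /GRing.scale/=; ring.
exact: near_eq_is_derive cc h.
Qed.

(** The mollifier has range [tau], and at this range [g] differs from [f] by
    at most [om]. *)
Lemma conv_close (F f g : rV -> R) : nice F -> nice g -> nice (fun x => \1_Om x * f x) ->
  (forall x, \1_Om x * F x = F x) ->
  (forall y x, Om y -> `|y - x| < tau -> `|f y - g x| <= om) ->
  ip0 F (fun x => \1_Om x * f x) - om * J (fun x => `|F x|) <= ip0 F (conv g (nk_k N)).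
Proof.
move=> nF ng nf FO fg.
have lk := nkk_lbm N.
have n1 : nice (fun x => F x * (\1_Om x * f x)) by exact: nice_mul.
have n2 : nice (fun x => om * `|F x|) by apply: niceZ; exact: nice_norm.
have n3 : nice (fun x => F x * conv g (nk_k N) x).
  by apply: niceMl => //; exact: conv_lbm.
rewrite /ip0 -(JZ om (nice_norm nF)) -(JB n1 n2).
apply: le_J => [||y]; [exact: niceB|exact: n3|].
have [Oy|Oy] := pselect (Om y); last first.
  by rewrite -[F y]FO indicE memNset// !mul0r normr0 mulr0 subr0.
rewrite indicE mem_set// mul1r.
suff h : `|f y - conv g (nk_k N) y| <= om.
  have h2 : `|F y * (f y - conv g (nk_k N) y)| <= `|F y| * om by rewrite normrM ler_wpM2l.
  by move: h2; rewrite ler_norml mulrBr => /andP[]; lra.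
have ny := nk_nice_refl N y.
have nc := nice_conv_in y ng lk.
have -> : f y - conv g (nk_k N) y = J (fun x => f y * nk_k N (y - x) - g x * nk_k N (y - x)).
  by rewrite (JB (niceZ _ ny) nc) (JZ _ ny) nk_mass mulr1.
apply: le_trans (J_norm (niceB (niceZ _ ny) nc)) _.
rewrite -[om]mulr1 -(nk_mass N y) -(JZ om ny).
apply: le_J => [||x]; [exact/nice_norm/niceB/nc/niceZ|exact: niceZ|].
rewrite -mulrBl normrM (ger0_norm (nkk_ge0 N _)).
have [h|h] := leP tau `|y - x|; first by rewrite (nkk_supp N h) !mulr0.
by rewrite ler_wpM2r ?nkk_ge0//; exact: fg.
Qed.

Let V := dcutpot Om N kap W0 W.
Let nV i : nice (V i). Proof. exact: nice_dcutpot. Qed.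

Lemma nb_tau4 x : nb Om tau x -> nb Om (4 * tau) x.
Proof. by apply: nb_sub; rewrite ler_peMl ?(ltW tau0)// ler1n. Qed.

(** Green's identity tested with [psi], the function [w] cut off near [Om].
    The errors come from the mollifier (factor [om]), from the thin layer
    between [Om] and its [tau]-neighbourhood (square root of its volume), and
    from the region beyond, where the potential has size [e]. *)
Lemma cutpot_lower :
  kap * ip0 W0 (r0 Om w) + ip1 W (r1 Om w) <=
  Num.sqrt (ip1 V V) * Num.sqrt (ip1 (r1 Om w) (r1 Om w)) +
  Num.sqrt (ip1 V V) * Num.sqrt (n%:R * M ^+ 2 * (J \1_(nb Om tau) - J \1_Om)) +
  om * (kap * J (fun x => `|W0 x|) + \sum_j J (fun x => `|W j x|)) +
  n%:R * (e * ((1 + C) * M)) * J \1_(nb Om (4 * tau)).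
Proof.
have OU : Om `<=` U.
  by apply: subset_trans nbU; apply: subset_trans (nb_self tau0) _ => x; exact: nb_tau4.
have OD x : Om x -> D x by move=> /(nb_self tau0); exact: nb_tau4.
have [r rge0 Or] := compact_cbox cOm.
have mO := compact_measurable_rV cOm.
have nr0 : nice (r0 Om w).
  by apply: (nice_restrict oU cw mO OU Or) => x Ox; apply: wM; exact: OD.
have nr1 i : nice (r1 Om w i).
  by apply: (nice_restrict oU (@cdw i) mO OU Or) => x Ox; apply: dwM; exact: OD.
have green := pot_green kap N nW0 nW npsi ndpsi psi_der.
have inn (x : rV) : nb Om tau x -> psi x = w x /\ forall i, dpsi i x = partial i w x.
  move=> xt; have x4 : D x := nb_tau4 xt.
  rewrite /psi /dpsi indicE mem_set// (chi_in N xt); split=> [|i]; first by rewrite mul1r mulr1.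
  by rewrite (dchi_in N cOm i xt) mulr0 mulr1 addr0 mul1r.
have nbx y x : Om y -> `|y - x| < tau -> nb Om tau x.
  by move=> Oy yx; exists y => //; rewrite distrC.
have low : kap * ip0 W0 (r0 Om w) + ip1 W (r1 Om w) -
   om * (kap * J (fun x => `|W0 x|) + \sum_j J (fun x => `|W j x|)) <=
   ip1 (dpot kap N W0 W) dpsi.
  rewrite green.
  have h0 : ip0 W0 (r0 Om w) - om * J (fun x => `|W0 x|) <= ip0 W0 (conv psi (nk_k N)).
    apply: (@conv_close W0 w psi nW0 npsi nr0 W0O) => y x Oy yx.
    by have [-> _] := inn x (nbx _ _ Oy yx); exact: wom.
  have h1 i : ip0 (W i) (r1 Om w i) - om * J (fun x => `|W i x|) <=
      ip0 (W i) (conv (dpsi i) (nk_k N)).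
    apply: (@conv_close (W i) (partial i w) (dpsi i) (nW i) (ndpsi i) (nr1 i) (@WO i)) => y x Oy yx.
    by have [_ ->] := inn x (nbx _ _ Oy yx); exact: dwom.
  have := ler_wpM2l kap0 h0.
  have : \sum_i (ip0 (W i) (r1 Om w i) - om * J (fun x => `|W i x|)) <=
     \sum_i ip0 (W i) (conv (dpsi i) (nk_k N)) by apply: ler_sum => i _; exact: h1.
  rewrite sumrB -mulr_sumr /ip1; lra.
(* [dpsi] is split into its parts on [Om], on the layer ([S]) and beyond
   ([T]). *)
pose S i (x : rV) := (\1_(nb Om tau) x - \1_Om x) * (\1_D x * partial i w x).
have nS i : nice (S i).
  by apply: nice_mul => //; apply: niceB; [exact: nice_nb|exact: nice_indOm].
pose T i (x : rV) := (\1_D x - \1_(nb Om tau) x) * dpsi i x.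
have nT i : nice (T i).
  by apply: nice_mul => //; apply: niceB; exact: nice_nb.
have split_ x i : dpot kap N W0 W i x * dpsi i x =
    V i x * r1 Om w i x + V i x * S i x + dpot kap N W0 W i x * T i x.
  have [xt|xt] := pselect (nb Om tau x).
    have [_ hV] := cutpot_in N cOm kap W0 W xt.
    have [_ hp] := inn x xt.
    rewrite /V hV hp /r1 /S /T !indicE (mem_set xt) (mem_set (nb_tau4 xt) : x \in D).
    rewrite subrr mul0r mulr0 addr0 mul1r mulrBl mul1r; ring.
  have xO : ~ Om x by move=> /(nb_self tau0).
  rewrite /r1 /S /T !indicE (memNset xt) (memNset xO) subrr !mul0r !mulr0 !add0r subr0.
  have [xD|xD] := boolP (x \in D); first by rewrite mul1r.
  rewrite mul0r mulr0 /dpsi indicE (negbTE xD) !mul0r addr0 mulr0//.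
have ld i := lbm_dpot kap N nW0 nW i.
have up : ip1 (dpot kap N W0 W) dpsi = ip1 V (r1 Om w) + ip1 V S + ip1 (dpot kap N W0 W) T.
  rewrite /ip1 -!big_split/=; apply: eq_bigr => i _.
  have m1 : nice (fun x => V i x * r1 Om w i x) by exact: nice_mul.
  have m2 : nice (fun x => V i x * S i x) by exact: nice_mul.
  have m3 : nice (fun x => dpot kap N W0 W i x * T i x) by exact: niceMr.
  rewrite /ip0 -(JD m1 m2) -(JD (niceD m1 m2) m3); apply: eq_J => x; exact: split_.
have b1 : ip1 V (r1 Om w) <= Num.sqrt (ip1 V V) * Num.sqrt (ip1 (r1 Om w) (r1 Om w)).
  exact: le_trans (ler_norm _) (ip1_CS nV nr1).
have b2 : ip1 V S <= Num.sqrt (ip1 V V) *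
    Num.sqrt (n%:R * M ^+ 2 * (J \1_(nb Om tau) - J \1_Om)).
  apply: le_trans (le_trans (ler_norm _) (ip1_CS nV nS)) _.
  rewrite ler_wpM2l ?sqrtr_ge0// ler_wsqrtr// /ip1.
  apply: (@le_trans _ _ (\sum_(i < n) (M ^+ 2 * (J \1_(nb Om tau) - J \1_Om)))); last first.
    by rewrite sumr_const card_ord -[leLHS]mulr_natl mulrA.
  apply: ler_sum => i _.
  have nt := nice_nb cOm tau; have nO := nice_indOm cOm.
  rewrite -(JB nt nO) -(JZ _ (niceB nt nO)) /ip0; apply: le_J => [||x].
  - exact: nice_mul.
  - exact/niceZ/niceB.
  rewrite /S !indicE; have [/set_mem xt|xt] := boolP (x \in nb Om tau); last first.
    have -> : (x \in Om) = false.
      by apply/negbTE; apply: contra xt => /set_mem/(nb_self tau0)/mem_set.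
    by rewrite subrr !mul0r mulr0.
  have [_|_] := boolP (x \in Om); first by rewrite subrr !mul0r mulr0.
  rewrite (mem_set (nb_tau4 xt) : x \in D) subr0 !mul1r mulr1 -expr2.
  rewrite -real_normK ?num_real// lerXn2r ?nnegrE//.
  by apply: dwM; exact: nb_tau4.
have b3 : ip1 (dpot kap N W0 W) T <= n%:R * (e * ((1 + C) * M)) * J \1_(nb Om (4 * tau)).
  apply: (@le_trans _ _ (\sum_(i < n) (e * ((1 + C) * M) * J \1_(nb Om (4 * tau))))); last first.
    by rewrite sumr_const card_ord -[leLHS]mulr_natl mulrA.
  apply: ler_sum => i _.
  have nt := nice_nb cOm (4 * tau).
  rewrite -(JZ _ nt) /ip0; apply: le_J => [||x]; [exact: niceMr|exact: niceZ|].
  rewrite /T !indicE; have [/set_mem xD|xD] := boolP (x \in D); last first.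
    have -> : (x \in nb Om tau) = false.
      by apply/negbTE; apply: contra xD => /set_mem/nb_tau4/mem_set.
    by rewrite subrr mul0r !mulr0.
  have [_|/negP xt] := boolP (x \in nb Om tau).
    by rewrite subrr mul0r mulr0 mulr1 mulr_ge0// mulr_ge0// addr_ge0.
  have {}xt : ~ nb Om tau x by move=> /mem_set.
  rewrite subr0 mul1r mulr1; apply: le_trans (ler_norm _) _; rewrite normrM.
  have [_ /(_ i) h] := tailU xD xt.
  apply: ler_pM => //; rewrite /dpsi indicE (mem_set xD) !mul1r.
  apply: le_trans (ler_normD _ _) _; rewrite [leRHS]mulrDl mul1r !normrM.
  apply: lerD.
    by rewrite -[leRHS]mulr1 ler_pM ?dwM// chi_bound.
  by rewrite [leRHS]mulrC ler_pM ?wM.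
rewrite up in low; lra.
Qed.

End lower_bound.

(** * Almost orthogonality to harmonic functions *)

Section bilinear.
Context {R : realType} {n : nat}.
Notation rV := 'rV[R]_n.
Notation e_ i := (delta_mx ord0 i : rV).
Variables (Om : set rV) (kap : R).
Hypotheses (cOm : compact Om) (kap0 : 0 < kap).
Implicit Types f g h w : rV -> R.
Notation vol := (J (\1_Om : rV -> R)).

(** The zeroth order term lets the norm control [f] itself and not only its
    gradient; small [kap] keeps the product close to the Dirichlet form. *)
Definition bil f g := kap * ip0 (r0 Om f) (r0 Om g) + ip1 (r1 Om f) (r1 Om g).

Lemma bilC f g : bil f g = bil g f.
Proof. by rewrite /bil ip0C ip1C. Qed.

Lemma bil_ge0 f : 0 <= bil f f.
Proof. by rewrite addr_ge0 ?ip1_ge0// mulr_ge0 ?ip0_ge0// ltW. Qed.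

Lemma bil_lin w f g c : smooth_on Om w -> smooth_on Om f -> smooth_on Om g ->
  bil w (fun x => f x + c * g x) = bil w f + c * bil w g.
Proof.
move=> sw sf sg; rewrite /bil r0_lin r1_lin//.
rewrite ip0_linr ?ip1_linr; try by [exact: nice_r0|move=> i; exact: nice_r1].
by ring.
Qed.

Lemma bil_quad f g c : smooth_on Om f -> smooth_on Om g ->
  bil (fun x => f x + c * g x) (fun x => f x + c * g x) =
  bil f f + 2 * c * bil f g + c ^+ 2 * bil g g.
Proof.
move=> sf sg; have sl := smooth_on_lin c sf sg; rewrite (bil_lin c sl sf sg).
rewrite [bil _ f]bilC [bil _ g]bilC (bil_lin c sf sf sg) (bil_lin c sg sf sg) [bil g f]bilC; ring.
Qed.


Lemma bil_bound h (M : R) : 0 <= M -> smooth_on Om h ->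
  (forall y, Om y -> `|h y| <= M /\ forall i, `|partial i h y| <= M) ->
  bil h h <= (kap + n%:R) * M ^+ 2 * vol.
Proof.
move=> M0 sh hM.
have nO := nice_indOm cOm.
have sq (f : rV -> R) : nice (fun x => \1_Om x * f x) -> (forall y, Om y -> `|f y| <= M) ->
    ip0 (fun x => \1_Om x * f x) (fun x => \1_Om x * f x) <= M ^+ 2 * vol.
  move=> nf fM; rewrite -(JZ _ nO); apply: le_J => [||x]; [exact: nice_mul|exact: niceZ|].
  rewrite indicE; have [/set_mem Ox|_] := boolP (x \in Om); last by rewrite !mul0r mulr0.
  rewrite !mul1r mulr1 -expr2 -real_normK ?num_real// lerXn2r ?nnegrE//; exact: fM.
rewrite mulrDl mulrDl; apply: lerD.
  rewrite -mulrA ler_pM2l//; apply: sq; first exact: nice_r0.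
  by move=> y /hM[].
apply: (@le_trans _ _ (\sum_(i < n) (M ^+ 2 * vol))); last first.
  by rewrite sumr_const card_ord -[leLHS]mulr_natl mulrA.
apply: ler_sum => i _; apply: sq; first exact: nice_r1.
by move=> y /hM[_ /(_ i)].
Qed.

Definition almost_orthogonal (eta : R) w := smooth_on Om w /\
  forall h, harmonic_on Om h -> `|bil w h| <= eta * Num.sqrt (bil h h).

(** A near minimizer of the distance to the harmonic functions: perturbing it
    by [t * g] for every real [t] bounds the product with [g] through the
    discriminant. Comparison with the harmonic function 0 gives the last
    bound. *)
Lemma almost_orthogonal_exists f (eta : R) : smooth_on Om f -> 0 < eta ->
  exists h, [/\ harmonic_on Om h, almost_orthogonal eta (fun x => f x + (-1) * h x) &
    bil (fun x => f x + (-1) * h x) (fun x => f x + (-1) * h x) <= bil f f + eta ^+ 2].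
Proof.
move=> sf eta0.
pose E := [set bil (fun x => f x + (-1) * h x) (fun x => f x + (-1) * h x) | h in harmonic_on Om].
have infE : has_inf E.
  split; first by exists (bil (fun x => f x + (-1) * 0) (fun x => f x + (-1) * 0)), (fun=> 0);
    [exact: harmonic_on_cst|].
  by exists 0 => _ [h _ <-]; exact: bil_ge0.
have e0 : 0 < eta ^+ 2 by rewrite exprn_gt0.
have [_ [h hh <-] hlt] := inf_adherent e0 infE.
have ge_infE g : harmonic_on Om g ->
    inf E <= bil (fun x => f x + (-1) * g x) (fun x => f x + (-1) * g x).
  by move=> hg; apply: ge_inf; [case: infE|exists g].
exists h; have sw : smooth_on Om (fun x => f x + (-1) * h x).
  by case: hh => sh _; exact: (smooth_on_lin (-1) sf sh).
split; [exact: hh|split; first exact: sw|]; last first.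
  have := ge_infE _ (harmonic_on_cst Om 0).
  have -> : (fun x => f x + (-1) * 0) = f by apply/funext => x; rewrite mulr0 addr0.
  lra.
move=> g hg; set w := (fun x => f x + (-1) * h x) in sw hlt *.
have [sg _] := hg.
have etaE : eta = Num.sqrt (eta ^+ 2) by rewrite sqrtr_sqr gtr0_norm.
rewrite etaE -sqrtrM ?sqr_ge0// -sqrtr_sqr ler_wsqrtr//.
apply: discr_le (bil_ge0 g) _ => t.
have : inf E <= bil (fun x => w x + t * g x) (fun x => w x + t * g x).
  have := ge_infE _ (harmonic_on_lin (- t) hh hg); congr (_ <= _).
  by congr (bil _ _); apply/funext => x; rewrite /w; ring.
rewrite (bil_quad t sw sg); lra.
Qed.

(** The difference of two almost projections is itself harmonic, so both
    remainders may be tested against it. *)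
Lemma almost_orthogonal_close f h0 h (eta0 eta : R) : smooth_on Om f ->
  harmonic_on Om h0 -> harmonic_on Om h -> 0 <= eta0 -> 0 <= eta ->
  almost_orthogonal eta0 (fun x => f x + (-1) * h0 x) ->
  almost_orthogonal eta (fun x => f x + (-1) * h x) ->
  Num.sqrt (bil (fun x => h0 x + (-1) * h x) (fun x => h0 x + (-1) * h x)) <= eta0 + eta.
Proof.
move=> sf hh0 hh e00 e0 [sw0 o0] [sw o].
have hg := harmonic_on_lin (-1) hh0 hh.
move: hg; set g := (fun x => h0 x + (-1) * h x) => hg.
have [sg _] := hg.
set w0 := (fun x => f x + (-1) * h0 x) in sw0 o0; set w := (fun x => f x + (-1) * h x) in sw o.
have gE : bil g g = bil w g - bil w0 g.
  rewrite -mulN1r -[bil w g]bilC -[bil w0 g]bilC -(bil_lin (-1) sg sw sw0); congr (bil _ _).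
  by apply/funext => x; rewrite /g /w /w0; ring.
have b1 := o _ hg; have b2 := o0 _ hg.
have le : bil g g <= (eta0 + eta) * Num.sqrt (bil g g).
  rewrite {1}gE; apply: le_trans (ler_norm _) _; apply: le_trans (ler_normB _ _) _.
  by rewrite mulrDl addrC lerD.
have [->|s0] := eqVneq (Num.sqrt (bil g g)) 0; first by rewrite addr_ge0.
have sp : 0 < Num.sqrt (bil g g) by rewrite lt_def s0 sqrtr_ge0.
by rewrite -(ler_pM2r sp); apply: le_trans le; rewrite -expr2 sqr_sqrtr// bil_ge0.
Qed.

Lemma r0O w x : \1_Om x * r0 Om w x = r0 Om w x.
Proof. by rewrite /r0 mulrA indic_idem. Qed.

Lemma r1O w i x : \1_Om x * r1 Om w i x = r1 Om w i x.
Proof. by rewrite /r1 mulrA indic_idem. Qed.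

(** At distance [tau] from [Om] the potential is [bil w (G (x - .))], and its
    derivatives are the same with those of [G]; all these functions are harmonic
    on [Om], with norms bounded by a constant [L] that depends on the kernel but
    not on [w]. *)
Lemma pot_tail (tau : R) (N : @newton_kernel R n tau) : 0 < tau ->
  exists2 L, 0 <= L & forall w eta, 0 <= eta -> almost_orthogonal eta w ->
    forall x, nb Om (4 * tau) x -> ~ nb Om tau x ->
    `|pot kap N (r0 Om w) (r1 Om w) x| <= eta * L /\
    forall i, `|dpot kap N (r0 Om w) (r1 Om w) i x| <= eta * L.
Proof.
move=> tau0.
have [r rge0 Or] := compact_cbox cOm.
pose S (z : rV) := `|nkG N z| + \sum_i `|nkD N i z| + \sum_i \sum_j `|nkH N i j z|.
have lS : lbm S.
  apply: lbmD; [apply: lbmD|].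
  - exact: lbm_norm (nkG_lbm N).
  - by apply: lbm_sum => i; exact: lbm_norm (nkD_lbm N i).
  - by apply: lbm_sum => i; apply: lbm_sum => j; exact: lbm_norm (nkH_lbm N i j).
have [M' hM'] := lS.2 (r + 4 * tau + r).
pose M := Num.max M' 0.
have M0 : 0 <= M by rewrite le_max lexx orbT.
have t40 : 0 <= 4 * tau by rewrite mulr_ge0// ltW.
have SM x y : nb Om (4 * tau) x -> Om y -> S (x - y) <= M.
  move=> /(nb_cbox Or rge0 t40)/(cboxE x (addr_ge0 rge0 t40)) xr /Or/(cboxE y rge0) yr.
  rewrite le_max; apply/orP; left; apply: le_trans (ler_norm _) (hM' _ _).
  by apply: le_trans (ler_normB _ _) _; exact: lerD.
have p1 z : 0 <= \sum_i `|nkD N i z| by apply: sumr_ge0.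
have p2 z : 0 <= \sum_i \sum_j `|nkH N i j z|.
  by apply: sumr_ge0 => i _; apply: sumr_ge0.
have SG z : `|nkG N z| <= S z by rewrite /S -addrA lerDl addr_ge0.
have SD i z : `|nkD N i z| <= S z.
  have : `|nkD N i z| <= \sum_i `|nkD N i z| by rewrite (bigD1 i)//= lerDl sumr_ge0.
  have := normr_ge0 (nkG N z); have := p2 z; rewrite /S; lra.
have SH i j z : `|nkH N i j z| <= S z.
  have h1 : `|nkH N i j z| <= \sum_j `|nkH N i j z| by rewrite (bigD1 j)//= lerDl sumr_ge0.
  have h2 : \sum_j `|nkH N i j z| <= \sum_i \sum_j `|nkH N i j z|.
    rewrite [leRHS](bigD1 i)//= lerDl; apply: sumr_ge0 => k _; exact: sumr_ge0.
  have := normr_ge0 (nkG N z); have := p1 z; rewrite /S; lra.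
exists (Num.sqrt ((kap + n%:R) * M ^+ 2 * vol)); first exact: sqrtr_ge0.
move=> w eta eta0 [sw ow] x x4 xt.
have far y : Om y -> tau <= `|x - y|.
  by move=> Oy; rewrite leNgt; apply/negP => xy; apply: xt; exists y.
have [hG hD] := nk_harmonic N far.
have key (K : rV -> R) (dK : 'I_n -> rV -> R) : lbm K -> (forall i, lbm (dK i)) ->
    has_grad K dK -> harmonic_on Om (fun y => K (x - y)) ->
    (forall z, `|K z| <= S z) -> (forall i z, `|dK i z| <= S z) ->
    `|kap * conv (r0 Om w) K x - \sum_j conv (r1 Om w j) (dK j) x| <=
    eta * Num.sqrt ((kap + n%:R) * M ^+ 2 * vol).
  move=> lK ldK gK hK KS dKS.
  have -> : kap * conv (r0 Om w) K x - \sum_j conv (r1 Om w j) (dK j) x =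
      bil w (fun y => K (x - y)).
    rewrite /bil; congr (_ * _ + _).
      by apply: eq_J => y; rewrite /r0 -[in LHS](indic_idem Om y); ring.
    rewrite -sumrN; apply: eq_bigr => j _.
    rewrite /conv -JN; last by apply: nice_conv_in => //; exact: nice_r1.
    apply: eq_J => y; rewrite /r1 (partial_refl x j gK) -[in LHS](indic_idem Om y); ring.
  apply: le_trans (ow _ hK) _; rewrite ler_wpM2l// ler_wsqrtr//.
  apply: bil_bound => //; first by case: hK.
  move=> y Oy; split=> [|i]; first exact: le_trans (KS _) (SM _ _ x4 Oy).
  by rewrite (partial_refl x i gK) normrN; exact: le_trans (dKS _ _) (SM _ _ x4 Oy).
split=> [|i].
  exact: (key _ _ (nkG_lbm N) (nkD_lbm N) (nkG_grad N) hG SG SD).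
have := key _ _ (nkD_lbm N i) (nkH_lbm N i) (nkD_grad N i) (hD i) (SD i) (SH i).
rewrite /dpot; congr (`|_ - _| <= _); apply: eq_bigr => j _.
by congr (conv _ _ _); apply/funext => z; exact: nkH_sym.
Qed.

End bilinear.

(** * The Poincare estimate for almost orthogonal functions *)

Section core.
Context {R : realType} {n : nat}.
Notation rV := 'rV[R]_n.
Notation e_ i := (delta_mx ord0 i : rV).
Variables (Om : set rV).
Hypothesis cOm : compact Om.
Notation vol := (J (\1_Om : rV -> R)).
Notation nrm0 f := (Num.sqrt (ip0 (r0 Om f) (r0 Om f))).
Notation nrm1 f := (Num.sqrt (ip1 (r1 Om f) (r1 Om f))).

Lemma finite_common (I : finType) (P : I -> R -> Prop) :
  (forall i, exists2 s : R, 0 < s & forall t, t <= s -> P i t) ->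
  exists2 s : R, 0 < s & forall i t, t <= s -> P i t.
Proof.
move=> /(_ _) hP; have [s hs] := choice (fun i => (let: ex_intro2 s h1 h2 := hP i in
  ex_intro (fun s => 0 < s /\ forall t, t <= s -> P i t) s (conj h1 h2))).
exists (\big[Order.min/1]_i s i).
  by apply: lt_bigmin => // i _; have [] := hs i.
move=> i t tb; have [_] := hs i; apply.
by apply: le_trans tb _; exact: bigmin_le.
Qed.

(** Compactness yields one radius [s] for all the properties of [w] that are
    used near [Om]. *)
Lemma smooth_tube (w : rV -> R) (om : R) : smooth_on Om w -> 0 < om ->
  exists U, exists2 M, [/\ open U, 0 <= M,
    forall x, U x -> {for x, continuous w},
    forall i x, U x -> {for x, continuous (partial i w)} &
    forall i x, U x -> is_derive x (e_ i) (w : rV -> R^o) (partial i w x)] &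
  exists2 s : R, 0 < s & forall t, t <= s -> [/\ nb Om t `<=` U,
    forall x, nb Om t x -> `|w x| <= M,
    forall i x, nb Om t x -> `|partial i w x| <= M,
    forall y x, Om y -> `|y - x| < t -> `|w y - w x| <= om &
    forall i y x, Om y -> `|y - x| < t -> `|partial i w y - partial i w x| <= om].
Proof.
move=> /smooth_on_data[U [oU OU cw cdw dw]] om0; exists U.
have [M0 M00 hM0] := compact_continuous_bounded cOm (fun x Ox => cw x (OU _ Ox)).
have bd i : exists M, 0 <= M /\ forall x, Om x -> `|partial i w x| <= M.
  by have [M h1 h2] := compact_continuous_bounded cOm (fun x Ox => cdw i x (OU _ Ox)); exists M.
have [M1 hM1] := choice bd.
have S0 : 0 <= \sum_i M1 i by apply: sumr_ge0 => i _; have [] := hM1 i.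
exists (M0 + \sum_i M1 i + om).
  by split=> //; rewrite !addr_ge0// ltW.
have [s1 s10 hs1] := compact_tube_open cOm oU OU.
have [s2 s20 hs2] := compact_tube_continuous cOm om0 (fun x Ox => cw x (OU _ Ox)).
have [i|s3 s30 hs3] := @finite_common 'I_n (fun i t => forall y x, Om y -> `|y - x| < t ->
    `|partial i w y - partial i w x| <= om).
  have [s s0 hs] := compact_tube_continuous cOm om0 (fun x Ox => cdw i x (OU _ Ox)).
  by exists s => // t ts y x Oy yx; apply: hs => //; exact: lt_le_trans ts.
exists (Num.min s1 (Num.min s2 s3)); first by rewrite !lt_min s10 s20 s30.
move=> t; rewrite !le_min => /and3P[t1 t2 t3].
have c0 y x : Om y -> `|y - x| < t -> `|w y - w x| <= om.
  by move=> Oy yx; apply: hs2 => //; exact: lt_le_trans t2.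
have c1 i y x : Om y -> `|y - x| < t -> `|partial i w y - partial i w x| <= om.
  by move=> Oy yx; apply: hs3 yx.
have close (f : rV -> R) (m : R) x y : Om y -> `|f y| <= m -> `|f y - f x| <= om -> `|f x| <= m + om.
  move=> _ h1 h2; have := ler_normD (f y) (f x - f y).
  by rewrite addrC subrK distrC => /le_trans; apply; exact: lerD.
split=> //.
- exact: subset_trans (nb_sub t1) hs1.
- move=> x [y Oy xy]; apply: le_trans (_ : M0 + om <= _); last by rewrite lerD2r lerDl.
  by apply: (close w M0 x y Oy (hM0 y Oy)); apply: c0 => //; rewrite distrC.
- move=> i x [y Oy xy]; have [_ hi] := hM1 i.
  apply: le_trans (_ : M1 i + om <= _).
    by apply: (close _ _ x y Oy (hi y Oy)); apply: c1 => //; rewrite distrC.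
  rewrite lerD2r (bigD1 i)//= addrCA lerDl addr_ge0// sumr_ge0// => j _.
  by have [] := hM1 j.
Qed.

Variables (kap P a v' : R).
Hypotheses (kap0 : 0 < kap) (P0 : 0 <= P) (a0 : 0 < a) (v'a : v' < (2 * a) ^+ n).
Hypothesis hP : (2 * a) ^+ n * (a ^+ 2 / 6) <= P * ((2 * a) ^+ n - v').

Lemma cutpot_poincare tau (N : @newton_kernel R n tau) W0 W : 0 < tau ->
  nice W0 -> (forall j, nice (W j)) -> J \1_(nb Om (4 * tau)) <= v' ->
  Num.sqrt (ip0 (cutpot Om N kap W0 W) (cutpot Om N kap W0 W)) <=
  Num.sqrt P * Num.sqrt (ip1 (dcutpot Om N kap W0 W) (dcutpot Om N kap W0 W)).
Proof.
move=> tau0 nW0 nW hv; set V := cutpot _ _ _ _ _; set dV := dcutpot _ _ _ _ _.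
have [r rge0 Or] := compact_cbox cOm.
have nV : nice V by exact: nice_cutpot.
have ndV i : nice (dV i) by exact: nice_dcutpot.
have t40 : 0 <= 4 * tau by rewrite mulr_ge0// ltW.
have mA : measurable (nb Om (4 * tau)) by apply: open_measurable_rV; exact: nb_open.
have dc := @dirichlet_cube R n V dV (nb Om (4 * tau)) a (r + 4 * tau) a0 mA
  (nb_cbox Or rge0 t40) nV ndV
  (fun x h => (cutpot_out N cOm tau0 kap W0 W h).1) (cutpot_grad N cOm kap nW0 nW).
rewrite -sqrtrM// ler_wsqrtr//.
have E0 : J (fun x => V x ^+ 2) = ip0 V V by apply: eq_J => x; rewrite expr2.
have E1 : \sum_i J (fun x => dV i x ^+ 2) = ip1 dV dV.
  by apply: eq_bigr => i _; apply: eq_J => x; rewrite expr2.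
rewrite E0 E1 in dc.
have g0 : 0 < (2 * a) ^+ n - v' by rewrite subr_gt0.
rewrite -(ler_pM2r g0).
apply: le_trans (_ : ip0 V V * ((2 * a) ^+ n - J \1_(nb Om (4 * tau))) <= _).
  by rewrite ler_wpM2l ?ip0_ge0// lerD2l lerN2.
apply: le_trans dc _; rewrite [leRHS]mulrAC.
by rewrite ler_wpM2r ?ip1_ge0.
Qed.

Lemma J_abs_bound w : smooth_on Om w ->
  kap * J (fun x => `|r0 Om w x|) + \sum_j J (fun x => `|r1 Om w j x|) <=
  ((kap + n%:R) * vol + bil Om kap w w) / 2.
Proof.
move=> sw; have nO := nice_indOm cOm.
have h (g : rV -> R) : nice g -> (forall x, \1_Om x * g x = g x) ->
    J (fun x => `|g x|) <= (vol + ip0 g g) / 2.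
  move=> ng gO; have ngg := nice_mul ng ng.
  rewrite mulrC -(JD nO ngg) -(JZ _ (niceD nO ngg)).
  apply: le_J => [||x]; [exact: nice_norm|exact/niceZ/niceD|].
  rewrite -gO indicE; case: (_ \in _); last by rewrite !mul0r normr0 addr0 mulr0.
  rewrite !mul1r -expr2 -[g x ^+ 2]real_normK ?num_real//.
  by have := sqr_ge0 (1 - `|g x|); rewrite sqrrB expr1n mul1r; change (true%:R : R) with (1 : R); lra.
have h0 := h _ (nice_r0 cOm sw) (r0O Om w).
have h1 i := h _ (nice_r1 cOm i sw) (r1O Om w i).
have := ler_wpM2l (ltW kap0) h0.
have : \sum_j J (fun x => `|r1 Om w j x|) <= \sum_(j < n) (vol + ip0 (r1 Om w j) (r1 Om w j)) / 2.
  by apply: ler_sum => i _; exact: h1.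
rewrite -mulr_suml big_split/= sumr_const card_ord -[X in _ <= (X + _) / _]mulr_natl.
rewrite /bil /ip1; lra.
Qed.

(** With [p = |w|], [al = |D w|] and [b] the norm of the gradient of the
    truncated potential, [cutpot_energy] and the Dirichlet inequality give
    [b^2 <= (kap * sqrt P * p + al) * b + g^2], so [b <= kap * sqrt P * p + al
    + g]; this is inserted in [cutpot_lower]. *)
Lemma core_inequality tau (N : @newton_kernel R n tau) U w w0 (M C e om : R) : 0 < tau ->
  smooth_on Om w -> smooth_on Om w0 -> open U -> 0 <= M -> 0 <= C -> 0 <= e -> 0 <= om ->
  (forall i x, `|dchi Om N i x| <= C) ->
  (forall x, nb Om (4 * tau) x -> ~ nb Om tau x ->
    `|pot kap N (r0 Om w) (r1 Om w) x| <= e /\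
    forall i, `|dpot kap N (r0 Om w) (r1 Om w) i x| <= e) ->
  (forall x, U x -> {for x, continuous w0}) ->
  (forall i x, U x -> {for x, continuous (partial i w0)}) ->
  (forall i x, U x -> is_derive x (e_ i) (w0 : rV -> R^o) (partial i w0 x)) ->
  nb Om (4 * tau) `<=` U ->
  (forall x, nb Om (4 * tau) x -> `|w0 x| <= M) ->
  (forall i x, nb Om (4 * tau) x -> `|partial i w0 x| <= M) ->
  (forall y x, Om y -> `|y - x| < tau -> `|w0 y - w0 x| <= om) ->
  (forall i y x, Om y -> `|y - x| < tau -> `|partial i w0 y - partial i w0 x| <= om) ->
  J \1_(nb Om (4 * tau)) <= v' ->
  bil Om kap w w0 <=
  (kap * Num.sqrt P * nrm0 w + nrm1 w +
     Num.sqrt (n%:R * ((2 + C) * e) ^+ 2 * v')) *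
  (nrm1 w0 + Num.sqrt (n%:R * M ^+ 2 * (J \1_(nb Om tau) - vol))) +
  om * (((kap + n%:R) * vol + bil Om kap w w) / 2) +
  n%:R * (e * ((1 + C) * M)) * v'.
Proof.
move=> tau0 sw sw0 oU M0 C0 e0 om0 hC tail cw cdw dw nbU wM dwM wom dwom hv.
have nW0 := nice_r0 cOm sw; have nW i := nice_r1 cOm i sw.
have qb := cutpot_poincare N tau0 nW0 nW hv.
have en := @cutpot_energy _ _ _ _ N cOm tau0 kap _ _ (ltW kap0) nW0 nW (r0O Om w) (r1O Om w) e e0 tail C C0 hC.
have lo := cutpot_lower cOm tau0 (ltW kap0) nW0 nW (r0O Om w) (r1O Om w) e0 C0 tail hC
  oU nbU M0 cw cdw dw wM dwM wom dwom.
move: qb en lo.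
set b2 := ip1 (dcutpot _ _ _ _ _) _; set q2 := ip0 (cutpot _ _ _ _ _) _.
set p := nrm0 w; set al := nrm1 w.
have b20 : 0 <= b2 by exact: ip1_ge0.
have p0 : 0 <= p by exact: sqrtr_ge0.
have al0 : 0 <= al by exact: sqrtr_ge0.
have nv : 0 <= J (\1_(nb Om (4 * tau)) : rV -> R) by apply: J_ge0 => x; rewrite indicE ler0n.
have v0 : 0 <= v' by exact: le_trans hv.
set b := Num.sqrt b2; have bge0 : 0 <= b by exact: sqrtr_ge0.
have bb : b2 = b ^+ 2 by rewrite sqr_sqrtr.
set e2 := n%:R * ((2 + C) * e) ^+ 2 * v'.
have ne0 : 0 <= n%:R * ((2 + C) * e) ^+ 2 by rewrite mulr_ge0// sqr_ge0.
have e20 : 0 <= e2 by rewrite mulr_ge0.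
set g := Num.sqrt e2; have g0 : 0 <= g by exact: sqrtr_ge0.
have gg : e2 = g ^+ 2 by rewrite sqr_sqrtr.
set q := Num.sqrt q2; set sP := Num.sqrt P => qb en lo.
have ble : b <= kap * sP * p + al + g.
  have h1 : b ^+ 2 <= (kap * sP * p + al) * b + g ^+ 2.
    rewrite -bb -gg; apply: le_trans en _; rewrite (mulrDl (kap * sP * p)); apply: lerD.
      by rewrite lerD2r -!mulrA ler_wpM2l ?(ltW kap0)// [leRHS]mulrCA ler_wpM2l.
    by rewrite /e2 ler_wpM2l.
  have k0 : 0 <= kap * sP * p + al by rewrite addr_ge0// !mulr_ge0 ?sqrtr_ge0// ltW.
  rewrite leNgt; apply/negP => h2.
  have : (kap * sP * p + al + g) * b <= b * b by rewrite ler_wpM2r// ltW.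
  have gb : g < b by lra.
  have [g00|g1] := eqVneq g 0.
    rewrite g00 in h1 h2 *.
    have : (kap * sP * p + al) * b < b * b by rewrite ltr_pM2r; lra.
    by rewrite expr0n addr0 expr2 in h1; lra.
  have : g * g < g * b by rewrite ltr_pM2l// lt_def g1.
  by move: h1; rewrite !expr2; lra.
have jb := J_abs_bound sw.
set X := nrm1 w0 in lo *; set Y := Num.sqrt _ in lo *.
have X0 : 0 <= X by exact: sqrtr_ge0.
have Y0 : 0 <= Y by exact: sqrtr_ge0.
rewrite /bil; apply: le_trans lo _.
rewrite -mulrDr; apply: lerD; last first.
  by rewrite ler_wpM2l// !mulr_ge0// addr_ge0.
apply: lerD; first by rewrite ler_wpM2r// addr_ge0.
by rewrite ler_wpM2l.
Qed.

(** If [p > s * al + ep] then also [p > ep], and [p ^ 2 = (p - s * al) * p + s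
    * al * p] exceeds [ep ^ 2 + s * al * p]. *)
Lemma quadratic_slack (k s p al ep : R) : 0 < k -> 0 <= s -> 0 <= al -> 0 < ep ->
  k * p ^+ 2 <= k * s * p * al + k * ep ^+ 2 -> p <= s * al + ep.
Proof.
move=> k0 s0 al0 ep0; rewrite -!mulrA -mulrDr ler_pM2l// => h.
rewrite leNgt; apply/negP => lt.
have sa0 : 0 <= s * al by rewrite mulr_ge0.
have h1 : ep * ep < ep * p by rewrite ltr_pM2l//; lra.
have h2 : ep * p < (p - s * al) * p by rewrite ltr_pM2r; lra.
move: h; rewrite !expr2; lra.
Qed.

Lemma absorb_errors (k u p al X Y T th D S eta Q Q2 : R) : 0 <= u -> 0 <= al -> 0 <= th ->
  0 <= eta -> 0 <= Q -> al <= S -> u + al <= D -> X <= al + th -> Y <= th -> T <= th ->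
  eta * (Q * (S + 2 * th) + Q2 + th) <= th ->
  k * p ^+ 2 + al ^+ 2 <= (u + al + eta * Q) * (X + Y) + T + eta * Q2 + eta * th ->
  k * p ^+ 2 <= u * al + 2 * th * (D + 1).
Proof.
move=> u0 al0 th0 eta0 Q0 aS uD Xl Yl Tl eZ h.
have eQ0 : 0 <= eta * Q by rewrite mulr_ge0.
have c1 : (u + al + eta * Q) * (X + Y) <= (u + al + eta * Q) * (al + 2 * th).
  by apply: ler_wpM2l; lra.
have c2 : th * (u + al) <= th * D by exact: ler_wpM2l.
have c3 : eta * Q * (al + 2 * th) <= eta * Q * (S + 2 * th) by apply: ler_wpM2l => //; lra.
by move: eZ h c1 c2 c3; rewrite !expr2; lra.
Qed.

Lemma ip1_triangle (F G : 'I_n -> rV -> R) : (forall i, nice (F i)) -> (forall i, nice (G i)) ->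
  Num.sqrt (ip1 (fun i x => F i x + (-1) * G i x) (fun i x => F i x + (-1) * G i x)) <=
  Num.sqrt (ip1 F F) + Num.sqrt (ip1 G G).
Proof.
move=> nF nG; rewrite (ip1_quad (-1) nF nG).
have h0 : 0 <= Num.sqrt (ip1 F F) + Num.sqrt (ip1 G G) by rewrite addr_ge0 ?sqrtr_ge0.
rewrite -[leRHS]ger0_norm// -sqrtr_sqr ler_wsqrtr//.
have := ip1_CS nF nG; rewrite ler_norml => /andP[h _].
by rewrite [leRHS]sqrrD !sqr_sqrtr ?ip1_ge0//; lra.
Qed.

(** The errors have to add up to at most [kap * ep ^ 2 = 2 * th * (D + 1)].
    The parameters are chosen in this order: [th], then the first remainder
    [w0] orthogonal up to [th / 2], then its modulus [om], then [tau] and the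
    kernel, which determine [L], [Q], [Q2], and finally [eta]. *)
Lemma core_estimate (f : rV -> R) (ep : R) : (0 < n)%N -> vol < v' -> smooth_on Om f -> 0 < ep ->
  exists h, [/\ harmonic_on Om h, almost_orthogonal Om kap ep (fun x => f x + (-1) * h x) &
   nrm0 (fun x => f x + (-1) * h x) <= Num.sqrt P * nrm1 (fun x => f x + (-1) * h x) + ep].
Proof.
move=> n0 vv sf ep0.
have vol0 : 0 <= vol by apply: J_ge0 => x; rewrite indicE ler0n.
have v'0 : 0 <= v' by rewrite ltW// (le_lt_trans vol0).
have bf0 := bil_ge0 Om kap0 f.
pose S := Num.sqrt (bil Om kap f f + 1).
have S0 : 0 <= S by exact: sqrtr_ge0.
have S2 : S ^+ 2 = bil Om kap f f + 1 by rewrite sqr_sqrtr// addr_ge0.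
pose sP := Num.sqrt P; have sP0 : 0 <= sP by exact: sqrtr_ge0.
have k0 := ltW kap0.
have sk0 : 0 < Num.sqrt kap by rewrite sqrtr_gt0.
pose D := kap * sP * (S / Num.sqrt kap) + S.
have D0 : 0 <= D by rewrite /D addr_ge0// !mulr_ge0// invr_ge0 ltW.
pose K := ((kap + n%:R) * vol + S ^+ 2) / 2.
have K0 : 0 <= K.
  by rewrite /K mulr_ge0 ?invr_ge0// addr_ge0 ?sqr_ge0// mulr_ge0// addr_ge0.
pose th := kap * ep ^+ 2 / (2 * (D + 1)).
have D10 : 0 < 2 * (D + 1) by lra.
have th0 : 0 < th by rewrite /th divr_gt0// mulr_gt0// exprn_gt0.
have thE : 2 * th * (D + 1) = kap * ep ^+ 2.
  by rewrite /th; field; rewrite gt_eqF//; lra.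
have th20 : 0 < th / 2 by rewrite divr_gt0.
pose om := th / (K + 1).
have om0 : 0 < om by rewrite divr_gt0// ltr_wpDl.
have omK : om * K <= th.
  by rewrite /om mulrAC ler_pdivrMr ?ltr_wpDl// ler_pM2l//; lra.
have [h0 [hh0 ao0 _]] := almost_orthogonal_exists cOm kap0 sf th20.
pose w0 := fun x => f x + (-1) * h0 x.
have sw0 : smooth_on Om w0 by case: ao0.
have [U [M [oU M0 cw cdw dw] [s s0 hs]]] := smooth_tube sw0 om0.
pose e' := Num.min (v' - vol) (th ^+ 2 / (n%:R * M ^+ 2 + 1)).
have nM0 : 0 <= n%:R * M ^+ 2 by rewrite mulr_ge0// sqr_ge0.
have nM1 : 0 < n%:R * M ^+ 2 + 1 by rewrite ltr_wpDl.
have e'0 : 0 < e' by rewrite lt_min subr_gt0 vv divr_gt0// exprn_gt0.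
have [s1 s10 hs1] := nb_volume cOm e'0.
pose tau := Num.min s s1 / 4.
have tau0 : 0 < tau by rewrite divr_gt0// lt_min s0.
have t4 : 4 * tau = Num.min s s1 by rewrite /tau; field.
have [nbU wM dwM wom dwom] : [/\ nb Om (4 * tau) `<=` U,
    forall x, nb Om (4 * tau) x -> `|w0 x| <= M,
    forall i x, nb Om (4 * tau) x -> `|partial i w0 x| <= M,
    forall y x, Om y -> `|y - x| < 4 * tau -> `|w0 y - w0 x| <= om &
    forall i y x, Om y -> `|y - x| < 4 * tau -> `|partial i w0 y - partial i w0 x| <= om].
  by apply: hs; rewrite t4 ge_min lexx.
have tt : tau <= 4 * tau by rewrite ler_peMl ?(ltW tau0)// ler1n.
have v4 : J \1_(nb Om (4 * tau)) <= v'.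
  apply: le_trans (hs1 _ _) _; first by rewrite t4 ge_min lexx orbT.
  by rewrite -lerBrDl /e' ge_min lexx.
have Yle : Num.sqrt (n%:R * M ^+ 2 * (J \1_(nb Om tau) - vol)) <= th.
  rewrite -[leRHS]gtr0_norm// -sqrtr_sqr ler_wsqrtr//.
  apply: le_trans (_ : n%:R * M ^+ 2 * (th ^+ 2 / (n%:R * M ^+ 2 + 1)) <= _).
    rewrite ler_wpM2l// lerBlDl; apply: le_trans (hs1 _ _) _.
      by apply: le_trans tt _; rewrite t4 ge_min lexx orbT.
    by rewrite lerD2l /e' ge_min lexx orbT.
  rewrite mulrA ler_pdivrMr// mulrC; apply: ler_wpM2l; first exact: sqr_ge0.
  by rewrite lerDl.
have [N] := newton_kernel_exists n0 tau0.
have [C C0 hC] := dchi_bound N cOm tau0.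
have [L L0 hL] := pot_tail cOm kap0 N tau0.
pose Q := Num.sqrt (n%:R * ((2 + C) * L) ^+ 2 * v').
have Q0 : 0 <= Q by exact: sqrtr_ge0.
pose Q2 := n%:R * (L * ((1 + C) * M)) * v'.
have Q20 : 0 <= Q2 by rewrite /Q2 !mulr_ge0// addr_ge0.
pose Z := Q * (S + 2 * th) + Q2 + th.
have Z0 : 0 <= Z.
  have St : 0 <= S + 2 * th by rewrite addr_ge0// mulr_ge0// ltW.
  by rewrite /Z addr_ge0 ?(ltW th0)// addr_ge0// mulr_ge0.
have Z1 : 0 < Z + 1 by rewrite ltr_wpDl.
pose eta := Num.min (Num.min (th / 2) 1) (Num.min ep (th / (Z + 1))).
have eta0 : 0 < eta by rewrite !lt_min th20 ltr01 ep0/= divr_gt0.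
have [eth e1 eep eZ] : [/\ eta <= th / 2, eta <= 1, eta <= ep & eta * Z <= th].
  split; try by rewrite /eta !ge_min lexx ?orbT.
  have : eta <= th / (Z + 1) by rewrite /eta !ge_min lexx !orbT.
  rewrite ler_pdivlMr// mulrDr mulr1; by move=> hz; apply: le_trans hz; rewrite lerDl ltW.
(* The final remainder depends on [eta], hence on [tau]; the equation is
   tested with [w0] instead. *)
have [h [hh ao bw]] := almost_orthogonal_exists cOm kap0 sf eta0.
exists h; split; [exact: hh| |].
  have [sw hw] := ao; split=> // g hg; apply: le_trans (hw g hg) _.
  by rewrite ler_wpM2r ?sqrtr_ge0.
pose w := fun x => f x + (-1) * h x; rewrite -/w.
have sw : smooth_on Om w by case: ao.
pose g := fun x => h0 x + (-1) * h x.
have hg : harmonic_on Om g by exact: harmonic_on_lin (-1) hh0 hh.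
have sg : smooth_on Om g by case: hg.
have gle : Num.sqrt (bil Om kap g g) <= th.
  apply: le_trans (almost_orthogonal_close cOm kap0 sf hh0 hh (ltW th20) (ltW eta0) ao0 ao) _.
  by rewrite [leRHS]splitr lerD2l.
have wE : w = fun x => w0 x + 1 * g x by apply/funext => x; rewrite /w /w0 /g; ring.
have w0E : w0 = fun x => w x + (-1) * g x by apply/funext => x; rewrite /w /w0 /g; ring.
have Xle : nrm1 w0 <= nrm1 w + th.
  rewrite w0E (r1_lin (-1) sw sg); apply: le_trans (ip1_triangle _ _) _.
  - by move=> i; exact: nice_r1.
  - by move=> i; exact: nice_r1.
  rewrite lerD2l; apply: le_trans gle; rewrite ler_wsqrtr// /bil lerDr.
  by rewrite mulr_ge0// ip0_ge0.
have bww : bil Om kap w w <= bil Om kap w w0 + eta * th.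
  have -> : bil Om kap w w = bil Om kap w w0 + 1 * bil Om kap w g.
    by rewrite -(@bil_lin R n Om kap cOm w w0 g 1 sw sw0 sg) -wE.
  rewrite mul1r lerD2l; apply: le_trans (ler_norm _) _.
  by have [_ ow] := ao; apply: le_trans (ow _ hg) _; rewrite ler_wpM2l// ltW.
have bS : bil Om kap w w <= S ^+ 2.
  apply: le_trans bw _; rewrite S2 lerD2l -(expr1n _ 2) lerXn2r// ?nnegrE// ltW//.
have p0 : 0 <= nrm0 w by exact: sqrtr_ge0.
have al0 : 0 <= nrm1 w by exact: sqrtr_ge0.
have pp : nrm0 w ^+ 2 = ip0 (r0 Om w) (r0 Om w) by rewrite sqr_sqrtr// ip0_ge0.
have aa : nrm1 w ^+ 2 = ip1 (r1 Om w) (r1 Om w) by rewrite sqr_sqrtr// ip1_ge0.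
have bE : bil Om kap w w = kap * nrm0 w ^+ 2 + nrm1 w ^+ 2 by rewrite pp aa.
have aS : nrm1 w <= S.
  rewrite -(ler_pXn2r (ltn0Sn 1)) ?nnegrE//; apply: le_trans bS; rewrite bE lerDr.
  by rewrite mulr_ge0// sqr_ge0.
have pS : nrm0 w <= S / Num.sqrt kap.
  rewrite ler_pdivlMr// -(ler_pXn2r (ltn0Sn 1)) ?nnegrE ?mulr_ge0 ?sqrtr_ge0//.
  rewrite exprMn (sqr_sqrtr k0); apply: le_trans bS; rewrite bE mulrC lerDl.
  exact: sqr_ge0.
have eL0 : 0 <= eta * L by rewrite mulr_ge0// ltW.
have wom' y x : Om y -> `|y - x| < tau -> `|w0 y - w0 x| <= om.
  by move=> Oy yx; apply: wom => //; exact: lt_le_trans tt.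
have dwom' i y x : Om y -> `|y - x| < tau -> `|partial i w0 y - partial i w0 x| <= om.
  by move=> Oy yx; apply: dwom => //; exact: lt_le_trans tt.
have := core_inequality tau0 sw sw0 oU M0 C0 eL0 (ltW om0) hC (hL w eta (ltW eta0) ao)
  cw cdw dw nbU wM dwM wom' dwom' v4.
have -> : Num.sqrt (n%:R * ((2 + C) * (eta * L)) ^+ 2 * v') = eta * Q.
  rewrite (_ : _ * v' = eta ^+ 2 * (n%:R * ((2 + C) * L) ^+ 2 * v')); last by ring.
  by rewrite sqrtrM ?sqr_ge0// sqrtr_sqr gtr0_norm.
have -> : n%:R * (eta * L * ((1 + C) * M)) * v' = eta * Q2 by rewrite /Q2; ring.
rewrite -/sP => ci.
apply: (@quadratic_slack kap sP (nrm0 w) (nrm1 w) ep kap0 sP0 al0 ep0).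
have omB : om * (((kap + n%:R) * vol + bil Om kap w w) / 2) <= th.
  apply: le_trans omK; apply: ler_wpM2l; first exact: ltW.
  by rewrite /K ler_wpM2r ?invr_ge0// lerD2l.
rewrite -thE; apply: (absorb_errors _ al0 (ltW th0) (ltW eta0) Q0 aS _ Xle Yle omB eZ).
- by rewrite !mulr_ge0.
- by apply: lerD aS; apply: ler_wpM2l pS; exact: mulr_ge0.
- by rewrite -bE; apply: le_trans bww _; rewrite lerD2r.
Qed.

End core.

(** * The Poincare constant of harmonic functions *)

Section final.
Context {R : realType} {n : nat}.
Notation rV := 'rV[R]_n.
Notation e_ i := (delta_mx ord0 i : rV).
Variables (Om : set rV).
Hypotheses (cOm : compact Om) (Om0 : Om° !=set0).
Notation vol := (J (\1_Om : rV -> R)).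
Notation nrm0 f := (Num.sqrt (ip0 (r0 Om f) (r0 Om f))).
Notation nrm1 f := (Num.sqrt (ip1 (r1 Om f) (r1 Om f))).
Let vol0 : 0 < vol := vol_gt0 cOm Om0.
Let sc (c : R) : smooth_on Om (fun=> c) := (harmonic_on_cst Om c).1.

Lemma le_eps (A B G e0 : R) : 0 < e0 -> (forall e, 0 < e -> e <= e0 -> A <= B + e * G) -> A <= B.
Proof.
move=> e00 h; rewrite leNgt; apply/negP => BA.
have d0 : 0 < (A - B) / (2 * (`|G| + 1)).
  by rewrite divr_gt0 ?subr_gt0// mulr_gt0// ltr_wpDl.
have e1 : 0 < Num.min e0 ((A - B) / (2 * (`|G| + 1))) by rewrite lt_min e00.
have := h _ e1; rewrite ge_min lexx => /(_ isT).
set e := Num.min _ _ => h1.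
have h2 : e * G <= e * (`|G| + 1).
  by rewrite ler_pM2l//; have := ler_norm G; lra.
have h3 : e * (`|G| + 1) <= (A - B) / 2.
  have : e <= (A - B) / (2 * (`|G| + 1)) by rewrite ge_min lexx orbT.
  rewrite ler_pdivlMr; last by rewrite mulr_gt0// ltr_wpDl.
  lra.
lra.
Qed.

Lemma ip0_center f (c : R) : smooth_on Om f ->
  ip0 (r0 Om (fun x => f x + (- c) * 1)) (r0 Om (fun x => f x + (- c) * 1)) =
  ip0 (r0 Om f) (r0 Om f) - 2 * c * J (r0 Om f) + c ^+ 2 * vol.
Proof.
move=> sf; have nf := nice_r0 cOm sf; have n1 := nice_r0 cOm (sc 1).
rewrite (r0_lin Om f (fun=> 1) (- c)) (ip0_quad (- c) nf n1).
have -> : ip0 (r0 Om f) (r0 Om (fun=> 1)) = J (r0 Om f).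
  by apply: eq_J => x; rewrite /r0 mulr1 mulrAC indic_idem.
have -> : ip0 (r0 Om (fun=> 1)) (r0 Om (fun=> 1)) = vol.
  by apply: eq_J => x; rewrite /r0 mulr1 indic_idem.
by ring.
Qed.

(** The variance is the squared distance to the constants, attained at the
    mean. *)
Lemma var0_center f : smooth_on Om f -> vol * var0 Om f =
  ip0 (r0 Om (fun x => f x + (- (J (r0 Om f) / vol)) * 1))
      (r0 Om (fun x => f x + (- (J (r0 Om f) / vol)) * 1)).
Proof. by move=> sf; rewrite ip0_center// /var0; field; rewrite gt_eqF. Qed.

Lemma var0_le_center f (c : R) : smooth_on Om f -> vol * var0 Om f <=
  ip0 (r0 Om (fun x => f x + (- c) * 1)) (r0 Om (fun x => f x + (- c) * 1)).
Proof.
move=> sf; rewrite ip0_center// /var0 -subr_ge0.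
have -> : ip0 (r0 Om f) (r0 Om f) - 2 * c * J (r0 Om f) + c ^+ 2 * vol -
    vol * (ip0 (r0 Om f) (r0 Om f) / vol - (J (r0 Om f) / vol) ^+ 2) =
    vol * (c - J (r0 Om f) / vol) ^+ 2 by field; rewrite gt_eqF.
by rewrite mulr_ge0 ?sqr_ge0// ltW.
Qed.

Lemma var0_ge0 f : smooth_on Om f -> 0 <= var0 Om f.
Proof. by move=> sf; rewrite -(pmulr_rge0 _ vol0) var0_center// ip0_ge0. Qed.

Lemma en0_ge0 f : 0 <= en0 Om f.
Proof. by rewrite divr_ge0 ?ip1_ge0// ltW. Qed.

Lemma var0_cst f : smooth_on Om f -> ~ nonconstant_on Om f -> var0 Om f = 0.
Proof.
move=> sf /contrapT[c hc].
have E : r0 Om f = fun x => c * \1_Om x.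
  apply/funext => x; rewrite /r0 indicE.
  by have [/set_mem/hc ->|_] := boolP (x \in Om); rewrite ?mul1r ?mulr1 ?mul0r ?mulr0.
have nO := nice_indOm cOm.
apply/le_anti; rewrite var0_ge0// andbT -(pmulr_rle0 _ vol0).
apply: le_trans (var0_le_center c sf) _; rewrite ip0_center// E (JZ _ nO).
have -> : ip0 (fun x => c * \1_Om x) (fun x => c * \1_Om x) = c ^+ 2 * vol.
  rewrite -(JZ _ nO); apply: eq_J => x.
  rewrite -[in RHS](indic_idem Om x); ring.
lra.
Qed.


Lemma en0_coord j : en0 Om (fun x => x ord0 j) = 1.
Proof.
rewrite /en0 /ip1 (bigD1 j)//= big1 ?addr0 => [|i ij].
  rewrite (_ : ip0 _ _ = vol) ?divff ?gt_eqF//; apply: eq_J => x.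
  by rewrite /r1 partial_coord eqxx mulr1 indic_idem.
rewrite -[RHS](@J0 R n); apply: eq_J => x.
by rewrite /r1 partial_coord (negbTE ij) mulr0 mul0r.
Qed.

Lemma nonconstant_coord j : nonconstant_on Om (fun x => x ord0 j).
Proof.
move=> [c hc]; have [x /nbhs_ballP[e /= e0 he]] := Om0.
have h1 := hc x (he _ (ballxx x e0)).
have e20 : 0 < e / 2 by rewrite divr_gt0.
have hy : Om (x + (e / 2) *: e_ j).
  apply: he; rewrite -ball_normE/= opprD addrA subrr sub0r normrN normrZ gtr0_norm//.
  apply: le_lt_trans (_ : e / 2 < _); last by rewrite ltr_pdivrMr// ltr_pMr// ltr1n.
  rewrite ler_piMr// ?(ltW e20)//.
  apply/ler_mx_normP => // i; rewrite !mxE eqxx/=; case: (_ == _) => /=.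
    by rewrite normr1.
  by rewrite normr0.
have := hc _ hy; rewrite !mxE h1 !eqxx mulr1; lra.
Qed.

(** If [en0 h = 0] the quotient [var0 h / en0 h] is 0 by convention and gives no
    information.  Then [h + t * x_j] has energy [t ^ 2], so its variance is at
    most [p * t ^ 2], and [t] tends to 0. *)
Lemma harmonic_poincare_all (p : R) : (0 < n)%N ->
  (forall h, harmonic_on Om h -> nonconstant_on Om h -> var0 Om h / en0 Om h <= p) ->
  0 <= p /\ forall h, harmonic_on Om h -> var0 Om h <= p * en0 Om h.
Proof.
move=> n0 hp; pose j : 'I_n := Ordinal n0; pose X (x : rV) := x ord0 j.
have hX : harmonic_on Om X := harmonic_on_coord Om j; have [sX _] := hX.
have p0 : 0 <= p.
  by have := hp _ hX (@nonconstant_coord j); rewrite en0_coord divr1; apply: le_trans; exact: var0_ge0.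
have main h : harmonic_on Om h -> en0 Om h != 0 -> var0 Om h <= p * en0 Om h.
  move=> hh e0; have [sh _] := hh.
  have [/(hp _ hh)|/(var0_cst sh) ->] := pselect (nonconstant_on Om h).
    by rewrite ler_pdivrMr// lt_def e0 en0_ge0.
  by rewrite mulr_ge0// en0_ge0.
split=> // h hh; have [sh _] := hh.
have [e0|] := eqVneq (en0 Om h) 0; last exact: main.
rewrite e0 mulr0.
have i0 : ip1 (r1 Om h) (r1 Om h) = 0.
  by move/eqP: e0; rewrite mulf_eq0 invr_eq0 (gt_eqF vol0) orbF => /eqP.
have nh i := nice_r1 cOm i sh; have nX i := nice_r1 cOm i sX.
have c0 : ip1 (r1 Om h) (r1 Om X) = 0.
  by apply/eqP; rewrite -normr_le0; have := ip1_CS nh nX; rewrite i0 sqrtr0 mul0r.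
pose m t := J (r0 Om (fun x => h x + t * X x)) / vol.
have en t : en0 Om (fun x => h x + t * X x) = t ^+ 2.
  rewrite /en0 (r1_lin t sh sX) (ip1_quad t nh nX) i0 c0 mulr0 !add0r -mulrA.
  by rewrite -/(en0 Om X) en0_coord mulr1.
have vt t : 0 < t -> vol * var0 Om (fun x => h x + t * X x) <= vol * (p * t ^+ 2).
  move=> t0; rewrite ler_pM2l// -en; apply: main; first exact: harmonic_on_lin.
  by rewrite en expf_neq0// gt_eqF.
rewrite -(pmulr_rle0 _ vol0).
pose G := vol * p + 2 * Num.sqrt (vol * p) * nrm0 X + ip0 (r0 Om X) (r0 Om X).
apply: (@le_eps _ _ G 1) => // t t0 t1; rewrite add0r.
apply: le_trans (var0_le_center (m t) sh) _.
have sht := smooth_on_lin t sh sX.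
pose F := fun x => (h x + t * X x) + (- m t) * 1.
have sF : smooth_on Om F by exact: smooth_on_lin (- m t) sht (sc 1).
have -> : (fun x => h x + (- m t) * 1) = fun x => F x + (- t) * X x.
  by apply/funext => x; rewrite /F; ring.
have nF := nice_r0 cOm sF; have nX0 := nice_r0 cOm sX.
rewrite r0_lin (ip0_quad (- t) nF nX0).
have FF : ip0 (r0 Om F) (r0 Om F) <= t ^+ 2 * (vol * p).
  have := vt t t0; rewrite (var0_center sht) -/(m t) -/F; lra.
have FX : `|ip0 (r0 Om F) (r0 Om X)| <= t * Num.sqrt (vol * p) * nrm0 X.
  apply: le_trans (ip0_CS nF nX0) _; rewrite ler_wpM2r ?sqrtr_ge0//.
  have -> : t * Num.sqrt (vol * p) = Num.sqrt (t ^+ 2 * (vol * p)).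
    by rewrite [RHS]sqrtrM ?sqr_ge0// sqrtr_sqr gtr0_norm.
  exact: ler_wsqrtr.
have tt : t ^+ 2 <= t by rewrite expr2 ler_piMr// ltW.
have x0 : 0 <= ip0 (r0 Om X) (r0 Om X) by exact: ip0_ge0.
have vp : 0 <= vol * p by rewrite mulr_ge0// ltW.
have g1 : t ^+ 2 * (vol * p) <= t * (vol * p) by rewrite ler_wpM2r.
have g2 : t ^+ 2 * ip0 (r0 Om X) (r0 Om X) <= t * ip0 (r0 Om X) (r0 Om X) by rewrite ler_wpM2r.
have g3 : - (t * ip0 (r0 Om F) (r0 Om X)) <= t * (Num.sqrt (vol * p) * nrm0 X).
  rewrite -mulrN ler_pM2l//.
  apply: le_trans (ler_norm _) _; rewrite normrN; apply: le_trans FX _.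
  by rewrite -mulrA ler_piMl// mulr_ge0 ?sqrtr_ge0.
rewrite /G sqrrN; lra.
Qed.

End final.

(** * Adding up the two parts *)

Section decomposition.
Context {R : realType} {n : nat}.
Notation rV := 'rV[R]_n.
Variables (Om : set rV).
Hypotheses (cOm : compact Om) (Om0 : Om° !=set0).
Notation vol := (J (\1_Om : rV -> R)).
Notation nrm0 f := (Num.sqrt (ip0 (r0 Om f) (r0 Om f))).
Notation nrm1 f := (Num.sqrt (ip1 (r1 Om f) (r1 Om f))).
Let sc (c : R) : smooth_on Om (fun=> c) := (harmonic_on_cst Om c).1.

(** The energies of the two parts add up to [F] up to an error which is small
    relatively to these energies, so they are bounded by [2 * F + 1];
    Cauchy-Schwarz in the plane bounds [(sP * a + sp * x) ^ 2]. *)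
Lemma split_limit (sP sp c F A : R) : 0 <= sP -> 0 <= sp -> 0 <= c ->
  (forall ep, 0 < ep -> ep <= 1 -> exists a x t, [/\ 0 <= a, 0 <= x,
     F = a ^+ 2 + x ^+ 2 + 2 * t, `|t| <= ep * (c * (a ^+ 2 + x ^+ 2 + 1)) &
     A <= (sP * a + sp * x + ep) ^+ 2]) ->
  A <= (sP ^+ 2 + sp ^+ 2) * F.
Proof.
move=> sP0 sp0 c0 h.
pose Z := 2 * F + 2.
pose G := (sP ^+ 2 + sp ^+ 2) * (2 * c * Z) + (2 * (sP + sp) + 1) * Z.
have e0 : 0 < (4 * (c + 1))^-1 by rewrite invr_gt0; lra.
apply: (le_eps e0 (G := G)) => ep ep0 ele.
have epc : ep * (4 * (c + 1)) <= 1 by rewrite -ler_pdivlMr ?div1r//; lra.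
have epc' : ep * c * 4 <= 1 by apply: le_trans epc; rewrite mulrAC mulrC mulrA; lra.
have ep1 : ep <= 1.
  have : 0 <= ep * c by rewrite mulr_ge0// ltW.
  lra.
have [a [x [t [a0 x0 FE tle Ale]]]] := h ep ep0 ep1.
set y := a ^+ 2 + x ^+ 2 in FE tle.
have y0 : 0 <= y by rewrite /y addr_ge0// sqr_ge0.
have t4 : `|t| * 4 <= y + 1.
  have : ep * c * 4 * (y + 1) <= 1 * (y + 1) by rewrite ler_wpM2r//; lra.
  lra.
have t1 : - t <= `|t| by rewrite -normrN ler_norm.
have yZ : y + 1 <= Z by rewrite /Z; lra.
have epZ : ep * c * (y + 1) <= ep * c * Z by rewrite ler_wpM2l// mulr_ge0// ltW.
have yF : y <= F + 2 * (ep * c * Z) by lra.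
have aZ : a <= Z.
  apply: le_trans yZ; have := sqr_ge0 (1 - a); have := sqr_ge0 x; rewrite sqrrB expr1n /y; lra.
have xZ : x <= Z.
  apply: le_trans yZ; have := sqr_ge0 (1 - x); have := sqr_ge0 a; rewrite sqrrB expr1n /y; lra.
have k1 : (sP * a + sp * x) ^+ 2 <= (sP ^+ 2 + sp ^+ 2) * y.
  have := sqr_ge0 (sP * x - sp * a); rewrite /y !expr2; lra.
have k2 : (sP ^+ 2 + sp ^+ 2) * y <= (sP ^+ 2 + sp ^+ 2) * (F + 2 * (ep * c * Z)).
  by rewrite ler_wpM2l// addr_ge0// sqr_ge0.
have k3 : 2 * (ep * (sP * a + sp * x)) <= 2 * (ep * ((sP + sp) * Z)).
  rewrite ler_pM2l// ler_pM2l// mulrDl.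
  by rewrite lerD// ler_wpM2l.
have k4 : ep ^+ 2 <= ep * Z.
  by rewrite expr2 ler_pM2l//; lra.
apply: le_trans Ale _; rewrite sqrrD -[_ *+ 2]mulr_natl /G; lra.
Qed.

Lemma cross_bound (s1 sP sp al x : R) : 0 <= s1 -> 0 <= sP -> 0 <= sp -> 0 <= al -> 0 <= x ->
  s1 * x + (sP * al + 1) * (sp * x) <= (s1 + sP * sp + sp) * (al ^+ 2 + x ^+ 2 + 1).
Proof.
move=> s10 sP0 sp0 al0 x0.
have y1 : x <= al ^+ 2 + x ^+ 2 + 1.
  by have := sqr_ge0 (1 - x); have := sqr_ge0 al; rewrite sqrrB expr1n; lra.
have y2 : al * x <= al ^+ 2 + x ^+ 2 + 1.
  by have := sqr_ge0 (al - x); have := sqr_ge0 al; have := sqr_ge0 x; rewrite sqrrB; lra.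
have k1 := ler_wpM2l s10 y1.
have k2 := ler_wpM2l sp0 y1.
have k3 := ler_wpM2l (mulr_ge0 sP0 sp0) y2.
lra.
Qed.

Lemma r1_center f (c : R) : smooth_on Om f ->
  r1 Om (fun x => f x + c * 1) = r1 Om f.
Proof.
move=> sf; rewrite (r1_lin c sf (sc 1)); apply/funext => i; apply/funext => x.
by rewrite /r1 partial_cst !mulr0 addr0.
Qed.

Variables (p P a v' : R).
Hypotheses (p0 : 0 <= p) (P0 : 0 <= P) (a0 : 0 < a) (vv : vol < v') (v'a : v' < (2 * a) ^+ n).
Hypothesis hP : (2 * a) ^+ n * (a ^+ 2 / 6) <= P * ((2 * a) ^+ n - v').
Hypothesis n0 : (0 < n)%N.
Hypothesis harm : forall h, harmonic_on Om h -> var0 Om h <= p * en0 Om h.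

(** The harmonic part is centered at its mean, a harmonic function again, in
    order that its norm be controlled by its energy. *)
Lemma var0_le_sum f : smooth_on Om f -> var0 Om f <= (P + p) * en0 Om f.
Proof.
move=> sf; have vol0 := vol_gt0 cOm Om0.
pose sP := Num.sqrt P; pose sp := Num.sqrt p; pose s1 := Num.sqrt (p + 1).
have sP0 : 0 <= sP by exact: sqrtr_ge0.
have sp0 : 0 <= sp by exact: sqrtr_ge0.
have s10 : 0 <= s1 by exact: sqrtr_ge0.
rewrite -(ler_pM2l vol0) /en0.
have -> : vol * ((P + p) * (ip1 (r1 Om f) (r1 Om f) / vol)) =
    (sP ^+ 2 + sp ^+ 2) * ip1 (r1 Om f) (r1 Om f).
  by rewrite !sqr_sqrtr//; field; rewrite gt_eqF.
apply: (@split_limit sP sp (s1 + sP * sp + sp)) => //.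
  by rewrite !addr_ge0// mulr_ge0.
move=> ep ep0 ep1.
have [h [hh [sw ow] cw]] := core_estimate cOm ep0 P0 a0 v'a hP n0 vv sf ep0.
set w := fun x => f x + (-1) * h x in sw ow cw.
have [sh _] := hh.
pose m := J (r0 Om h) / vol; pose h1 := fun x => h x + (- m) * 1.
have hh1 : harmonic_on Om h1 by exact: harmonic_on_lin (- m) hh (harmonic_on_cst Om 1).
have [sh1 _] := hh1.
have nw0 := nice_r0 cOm sw; have nw1 i := nice_r1 cOm i sw.
have nh0 := nice_r0 cOm sh1; have nh1 i := nice_r1 cOm i sh1.
have fE : (fun x => f x + (- m) * 1) = fun x => w x + 1 * h1 x.
  by apply/funext => x; rewrite /w /h1; ring.
have x0 : 0 <= nrm1 h1 by exact: sqrtr_ge0.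
have al0 : 0 <= nrm1 w by exact: sqrtr_ge0.
have xx : nrm1 h1 ^+ 2 = ip1 (r1 Om h1) (r1 Om h1) by rewrite sqr_sqrtr// ip1_ge0.
have aa : nrm1 w ^+ 2 = ip1 (r1 Om w) (r1 Om w) by rewrite sqr_sqrtr// ip1_ge0.
have hp2 : ip0 (r0 Om h1) (r0 Om h1) <= p * nrm1 h1 ^+ 2.
  rewrite xx -(var0_center cOm Om0 sh) (r1_center (- m) sh).
  have := harm hh; rewrite -(ler_pM2l vol0) /en0 => /le_trans; apply.
  by rewrite le_eqVlt; apply/orP; left; apply/eqP; field; rewrite gt_eqF.
have hp : nrm0 h1 <= sp * nrm1 h1.
  rewrite -[nrm1 h1]ger0_norm// -sqrtr_sqr -sqrtrM// ler_wsqrtr//.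
exists (nrm1 w), (nrm1 h1), (ip1 (r1 Om w) (r1 Om h1)); split; [exact: al0|exact: x0| | |].
- transitivity (ip1 (r1 Om (fun x => w x + 1 * h1 x)) (r1 Om (fun x => w x + 1 * h1 x))).
    by rewrite -fE (r1_center (- m) sf).
  by rewrite xx aa (r1_lin 1 sw sh1) (ip1_quad 1 nw1 nh1) mulr1 expr1n mul1r addrAC.
- have b1 : bil Om ep h1 h1 <= (p + 1) * nrm1 h1 ^+ 2.
    rewrite /bil -[X in _ + X <= _]xx mulrDl mul1r lerD2r.
    apply: le_trans (_ : 1 * ip0 (r0 Om h1) (r0 Om h1) <= _); last by rewrite mul1r.
    by rewrite ler_wpM2r ?ip0_ge0.
  have b2 : Num.sqrt (bil Om ep h1 h1) <= s1 * nrm1 h1.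
    rewrite -[nrm1 h1]ger0_norm// -sqrtr_sqr -sqrtrM ?addr_ge0// ler_wsqrtr//.
  have b3 : `|bil Om ep w h1| <= ep * (s1 * nrm1 h1).
    by apply: le_trans (ow _ hh1) _; rewrite ler_pM2l.
  have b4 : `|ip0 (r0 Om w) (r0 Om h1)| <= (sP * nrm1 w + 1) * (sp * nrm1 h1).
    apply: le_trans (ip0_CS nw0 nh0) _; apply: ler_pM; rewrite ?sqrtr_ge0//.
    by apply: le_trans cw _; rewrite lerD2l.
  have -> : ip1 (r1 Om w) (r1 Om h1) = bil Om ep w h1 - ep * ip0 (r0 Om w) (r0 Om h1).
    by rewrite /bil; ring.
  apply: le_trans (ler_normB _ _) _; rewrite normrM (gtr0_norm ep0).
  apply: le_trans (_ : ep * (s1 * nrm1 h1) + ep * ((sP * nrm1 w + 1) * (sp * nrm1 h1)) <= _).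
    by rewrite lerD// ler_pM2l.
  rewrite -mulrDr ler_pM2l//.
  exact: cross_bound.
- apply: le_trans (var0_le_center cOm Om0 m sf) _; rewrite fE (r0_lin Om w h1 1).
  apply: le_trans (_ : (nrm0 w + nrm0 h1) ^+ 2 <= _); last first.
    rewrite lerXn2r ?nnegrE ?addr_ge0 ?sqrtr_ge0 ?mulr_ge0 ?(ltW ep0)//.
    by rewrite addrAC lerD.
  rewrite (ip0_quad 1 nw0 nh0) sqrrD !sqr_sqrtr ?ip0_ge0// expr1n mul1r mulr1.
  rewrite lerD2r lerD2l -[leRHS]mulr_natl ler_pM2l//.
  exact: le_trans (ler_norm _) (ip0_CS nw0 nh0).
Qed.

End decomposition.

(** * The constants *)

Section constants.
Context {R : realType} {n : nat}.
Notation rV := 'rV[R]_n.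
Variables (Om : set rV).
Hypotheses (cOm : compact Om) (Om0 : Om° !=set0) (n0 : (0 < n)%N).
Notation vol := (J (\1_Om : rV -> R)).
Let mOm : measurable Om := compact_measurable_rV cOm.
Let q : R := pi * expR 1.

(** The coordinates are harmonic with energy 1, so their variances are at most
    [p]. *)
Lemma harmonic_volume_le (p : R) : 0 < p ->
  (forall h, harmonic_on Om h -> var0 Om h <= p * en0 Om h) ->
  vol <= (Num.sqrt (p * pi *+ 2) * expR 2^-1) ^+ n.
Proof.
move=> p0 harm; have vol0 := vol_gt0 cOm Om0.
have [r _ Or] := compact_cbox cOm.
have sp : Num.sqrt p ^+ 2 = p by rewrite sqr_sqrtr// ltW.
pose X j (x : rV) := x ord0 j.
have hX j : harmonic_on Om (X j) := harmonic_on_coord Om j.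
have := @gaussian_volume_le R n Om (fun j => J (r0 Om (X j)) / vol) (Num.sqrt p) r.
rewrite sp sqrtr_gt0 => /(_ p0 mOm Or); apply.
pose Y j x := X j x + (- (J (r0 Om (X j)) / vol)) * 1.
have nY j : nice (r0 Om (Y j)).
  by apply: nice_r0 => //; case: (harmonic_on_lin (- (J (r0 Om (X j)) / vol)) (hX j) (harmonic_on_cst Om 1)).
apply: (@le_trans _ _ (\sum_j ip0 (r0 Om (Y j)) (r0 Om (Y j)))).
  rewrite /ip0 -J_sum; last by move=> j; exact: nice_mul.
  rewrite le_eqVlt; apply/orP; left; apply/eqP; apply: eq_J => x.
  rewrite mulr_sumr; apply: eq_bigr => j _.
  by rewrite /r0 /Y /X -[in LHS](indic_idem Om x) mulr1; ring.
apply: (@le_trans _ _ (\sum_(j < n) (vol * p))); last first.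
  by rewrite sumr_const card_ord -[leLHS]mulr_natl mulrA mulrAC.
apply: ler_sum => j _; have [sX _] := hX j.
rewrite -(var0_center cOm Om0 sX) ler_pM2l//.
by have := harm _ (hX j); rewrite en0_coord// mulr1.
Qed.

(** The cube has side [2 * a] with [a ^ 2 = be * p], and then the square root
    is the ratio of the [n]-th root of the bound on the volume of [Om] to the
    side of the cube. *)
Lemma poincare_of_ratio (p be de : R) : 0 < p -> 0 < be -> de < 1 ->
  Num.sqrt (q / (2 * be)) ^+ n < de ->
  (forall h, harmonic_on Om h -> var0 Om h <= p * en0 Om h) ->
  forall f, smooth_on Om f -> var0 Om f <= (be / (6 * (1 - de)) + 1) * p * en0 Om f.
Proof.
move=> p0 be0 de1 hde harm f sf.
pose a := Num.sqrt (be * p).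
have bp0 : 0 < be * p by rewrite mulr_gt0.
have a0 : 0 < a by rewrite sqrtr_gt0.
have a2 : a ^+ 2 = be * p by rewrite sqr_sqrtr// ltW.
have d0 : 0 < 1 - de by lra.
have A0 : 0 < (2 * a) ^+ n by rewrite exprn_gt0// mulr_gt0.
have q0 : 0 < q by rewrite mulr_gt0 ?pi_gt0 ?expR_gt0.
have cE : Num.sqrt (p * pi *+ 2) * expR 2^-1 = 2 * a * Num.sqrt (q / (2 * be)).
  apply/eqP; rewrite -(@eqrXn2 _ 2)//; last first.
    by rewrite !mulr_ge0 ?sqrtr_ge0// ltW.
  rewrite !exprMn a2 -expRM_natl.
  rewrite sqr_sqrtr; last by rewrite mulrn_wge0// mulr_ge0 ?pi_ge0// ltW.
  rewrite sqr_sqrtr; last by rewrite divr_ge0 ?(ltW q0)// mulr_ge0// ltW.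
  rewrite divff// -mulr_natl /q; apply/eqP; field.
  by rewrite gt_eqF.
have vv : vol < (2 * a) ^+ n * de.
  apply: le_lt_trans (harmonic_volume_le p0 harm) _.
  by rewrite cE exprMn ltr_pM2l.
rewrite [X in X * en0 _ _]mulrDl mul1r.
apply: (@var0_le_sum R n Om cOm Om0 p (be / (6 * (1 - de)) * p) a ((2 * a) ^+ n * de)
  (ltW p0) _ a0 vv _ _ n0 harm f sf).
- by rewrite mulr_ge0 ?(ltW p0)// divr_ge0 ?(ltW be0)// mulr_ge0// ltW.
- by rewrite -[ltRHS]mulr1 ltr_pM2l.
- rewrite a2 le_eqVlt; apply/orP; left; apply/eqP; field.
  by rewrite gt_eqF.
Qed.

(** The constant of harmonic functions may vanish a priori, whereas the volume
    bound needs it positive: it is increased by [ep], which then tends to 0. *)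
Lemma poincare_le_harmonic (C be de : R) : 0 < be -> de < 1 ->
  Num.sqrt (q / (2 * be)) ^+ n < de -> be / (6 * (1 - de)) + 1 <= C ->
  (neumann_poincare mOm <= C%:E * harmonic_poincare mOm)%E.
Proof.
move=> be0 de1 hde hC; have vol0 := vol_gt0 cOm Om0.
have b0 : 0 <= be / (6 * (1 - de)).
  by rewrite divr_ge0 ?(ltW be0)// mulr_ge0// subr_ge0 ltW.
have C0 : 0 < C by lra.
have sup h : harmonic_on Om h -> nonconstant_on Om h ->
    ((var0 Om h / en0 Om h)%:E <= harmonic_poincare mOm)%E.
  move=> hh nh; apply: ereal_sup_ubound; exists h => //.
  by have [sh _] := hh; rewrite (var_unifE cOm vol0 sh) (energy_unifE cOm vol0 sh).
have j : 'I_n := Ordinal n0.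
have := sup _ (harmonic_on_coord Om j) (@nonconstant_coord _ _ Om Om0 j).
case H : (harmonic_poincare mOm) => [p| |] // _; last by rewrite gt0_muley ?lte_fin ?leey.
have [p0 harm] : 0 <= p /\ forall h, harmonic_on Om h -> var0 Om h <= p * en0 Om h.
  apply: harmonic_poincare_all => // h hh nh.
  by have := sup h hh nh; rewrite H lee_fin.
rewrite -EFinM; apply: ereal_inf_lbound; exists (C * p) => //= f sf.
rewrite (var_unifE cOm vol0 sf) (energy_unifE cOm vol0 sf).
have e0 := en0_ge0 cOm Om0 f.
apply: (@le_eps R _ _ (C * en0 Om f) 1) => // ep ep0 _.
have pe0 : 0 < p + ep by rewrite ltr_wpDl.
have harm' h : harmonic_on Om h -> var0 Om h <= (p + ep) * en0 Om h.
  move=> hh; apply: le_trans (harm h hh) _.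
  by rewrite ler_wpM2r ?(en0_ge0 cOm Om0)// lerDl ltW.
apply: le_trans (poincare_of_ratio pe0 be0 de1 hde harm' sf) _.
apply: le_trans (_ : C * (p + ep) * en0 Om f <= _).
  by rewrite ler_wpM2r// ler_pM2r.
by rewrite le_eqVlt; apply/orP; left; apply/eqP; ring.
Qed.

End constants.

Lemma pi_expR1_lt12 (R : realType) : pi * expR 1 < 12 :> R.
Proof.
have h1 := @pihalf_lt2 R; have h2 := @expR1_lt3 R.
have h3 : (pi : R) < 4 by lra.
apply: lt_le_trans (_ : 4 * 3 <= _ :> R); last by lra.
by apply: ltr_pM h3 h2; [exact: pi_ge0|exact: expR_ge0].
Qed.

Theorem theorem12 (R : realType) :
  (exists C : R, 1 < C /\
     forall (n : nat) (Omega : set 'rV[R]_n) (cOmega : compact Omega),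
       (2 <= n)%N -> connected Omega -> smooth_boundary Omega ->
       Omega° !=set0 ->
       (neumann_poincare (compact_measurable_rV cOmega)
          <= C%:E * harmonic_poincare (compact_measurable_rV cOmega))%E) /\
  (exists n0 : nat,
     forall (n : nat) (Omega : set 'rV[R]_n) (cOmega : compact Omega),
       (n0 <= n)%N -> connected Omega -> smooth_boundary Omega ->
       Omega° !=set0 ->
       (neumann_poincare (compact_measurable_rV cOmega)
          <= 2%:E * harmonic_poincare (compact_measurable_rV cOmega))%E).
Proof.
have q12 := pi_expR1_lt12 R; set q : R := pi * expR 1 in q12.
have q0 : 0 < q by rewrite mulr_gt0 ?pi_gt0 ?expR_gt0.
split.
  exists 5; split; first by rewrite ltr1n.
  move=> n Om cOm n2 _ _ Om0.
  apply: (@poincare_le_harmonic R n Om cOm Om0 _ 5 12 (1 / 2)); rewrite -/q.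
  - exact: leq_trans n2.
  - lra.
  - lra.
  - have r2 : q / (2 * 12) < 1 / 2 by lra.
    have rge0 : 0 <= q / (2 * 12) by lra.
    apply: le_lt_trans (_ : Num.sqrt (q / (2 * 12)) ^+ 2 < _).
      apply: ler_wiXn2l n2; rewrite ?sqrtr_ge0// -[leRHS]sqrtr1 ler_wsqrtr//; lra.
    by rewrite sqr_sqrtr.
  - by rewrite le_eqVlt; apply/orP; left; apply/eqP; field.
pose be := (12 + q) / 4; pose de := (12 - q) / 24.
have be0 : 0 < be by rewrite /be; lra.
pose r := Num.sqrt (q / (2 * be)).
have r1 : `|r| < 1.
  rewrite ger0_norm ?sqrtr_ge0// -[ltRHS]sqrtr1 ltr_sqrt// ltr_pdivrMr; last by rewrite mulr_gt0.
  by rewrite /be; lra.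
have de0 : 0 < de by rewrite /de; lra.
have [N _ hN] : \forall n \near \oo, r ^+ n < de.
  by have /cvgr_lt := cvg_expr r1; apply.
exists N.+1 => n Om cOm Nn _ _ Om0.
apply: (@poincare_le_harmonic R n Om cOm Om0 _ 2 be de) => //.
- exact: leq_trans Nn.
- by rewrite /de; lra.
- by apply: hN; exact: ltnW.
- rewrite le_eqVlt; apply/orP; left; apply/eqP; rewrite /be /de; field; rewrite gt_eqF//; lra.
Qed.
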